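(* Let $\mathbb{F}$ be a field and let $A$ be a differential graded algebra over $\mathbb{F}$. Let $[m]\in HH^{-d}(A,A^\vee)$ be such that the morphism of $HH^*(A,A)$-modules $$HH^p(A,A)\to HH^{p-d}(A,A^\vee),\qquad a\mapsto a\cdot[m]$$ is an isomorphism. If $H_*(B^\vee)([m])=0$, then the Gerstenhaber algebra $HH^*(A,A)$ equipped with $H_*(B^\vee)$ is a Batalin–Vilkovisky algebra; that is, $HH^*(A,A)$ is a Batalin–Vilkovisky algebra for the operator $\Delta$ defined by $(\Delta a)\cdot[m]:=H_*(B^\vee)(a\cdot[m])$ for all $a\in HH^*(A,A)$.
   Context: **Grading.** An element of upper degree $p$ has lower degree $-p$, and $V^p=V_{-p}$. $|x|$ denotes lower degree. $A^\vee=\mathrm{Hom}(A,\mathbb{F})$ is the dual, with its usual dg $A$-bimodule structure (Koszul signs). $sA$ is the suspension, $(sA)_i=A_{i-1}$; elements of $T(sA)$ are written $[a_1|\cdots|a_k]$. **Hochschild complexes.** For a dg $(A,A)$-bimodule $N$, $\mathcal{C}^*(A;N)=(\mathrm{Hom}(T(sA),N),D_0+D_1)$, with $D_0(f)([\,])=d_N f([\,])$, $D_1(f)([\,])=0$, and for $k\ge1$, with $\bar\epsilon_i=|f|+|sa_1|+\cdots+|sa_{i-1}|$, $D_0(f)([a_1|\cdots|a_k])=d_N(f([a_1|\cdots|a_k]))-\sum_{i=1}^k(-1)^{\bar\epsilon_i}f([a_1|\cdots|d a_i|\cdots|a_k])$, $D_1(f)([a_1|\cdots|a_k])=-(-1)^{|sa_1||f|}a_1f([a_2|\cdots|a_k])-\sum_{i=2}^k(-1)^{\bar\epsilon_i}f([a_1|\cdots|a_{i-1}a_i|\cdots|a_k])+(-1)^{\bar\epsilon_k}f([a_1|\cdots|a_{k-1}])a_k$.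 $HH^*(A;N)$ (also written $HH^*(A,N)$) is its cohomology. $\mathcal{C}_*(A;A)=(A\otimes T(sA),d_1+d_2)$ is the usual Hochschild chain complex, and $\mathcal{C}^*(A;A^\vee)\cong\mathcal{C}_*(A;A)^\vee$, $g\mapsto\big(a_0[a_1|\cdots|a_n]\mapsto (g[a_1|\cdots|a_n])(a_0)\big)$. **Action, cup product, bracket.** For $f\in\mathcal{C}^*(A;A)$, $g\in\mathcal{C}^*(A;N)$, $(f\cdot g)([a_1|\cdots|a_n])=\sum_{p=0}^n f([a_1|\cdots|a_p])\cdot g([a_{p+1}|\cdots|a_n])$ (Koszul signs). This induces a left action of $HH^*(A,A)$ on $HH^*(A,N)$; for $N=A$ it is the cup product $\cup$. $HH^*(A,A)$ with $\cup$ and the bracket $\{f,g\}=f\circ g-(-1)^{(|f|+1)(|g|+1)}g\circ f$, where $f\circ g$ is the sum over all insertions of $g$ into $f$ (Koszul signs), is Gerstenhaber's Gerstenhaber algebra. **Connes (co)boundary.** $B$ is Connes' boundary on $\mathcal{C}_*(A;A)$ (on the normalized complex, $B(a_0[a_1|\cdots|a_n])=\sum_{i=0}^n\pm1[a_i|\cdots|a_n|a_0|\cdots|a_{i-1}]$ with Koszul signs), and $B^\vee(m)=(-1)^{|m|}m\circ B$ on $\mathcal{C}_*(A;A)^\vee\cong\mathcal{C}^*(A;A^\vee)$; $H_*(B^\vee)$ is the induced map on $HH^*(A,A^\vee)$. **Gerstenhaber algebra.** A commutative graded algebra $G$ with a linear map $\{-,-\}:G_i\otimes G_j\to G_{i+j+1}$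 such that $\{a,b\}=-(-1)^{(|a|+1)(|b|+1)}\{b,a\}$, $\{a,\{b,c\}\}=\{\{a,b\},c\}+(-1)^{(|a|+1)(|b|+1)}\{b,\{a,c\}\}$, and $\{a,bc\}=\{a,b\}c+(-1)^{(|a|+1)|b|}b\{a,c\}$. **Batalin–Vilkovisky algebra.** A Gerstenhaber algebra $G$ with a linear map $\Delta:G_i\to G_{i+1}$ such that $\Delta\circ\Delta=0$ and $\{a,b\}=(-1)^{|a|}\big(\Delta(a\cup b)-(\Delta a)\cup b-(-1)^{|a|}a\cup(\Delta b)\big)$.
   Formalization: Signs corrected: in D_0 the letter d a_i is read as d(s a_i) = −s(d a_i), else D² ≠ 0; B has leading sign −1, as with +1 the stated BV identity fails (F[x]/(x²), a = x d/dx, b = x); the isomorphism C^*(A;A^∨) ≅ C_*(A;A)^∨ carries the Koszul sign (−1)^{|a_0||[a_1|…|a_n]|}. *)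

(* Defs.v *)
From HB Require Import structures.
From mathcomp Require Import all_boot all_order all_algebra.
From mathcomp Require Import boolp classical_sets functions.
From mathcomp Require Import ring.

(* All degrees are lower degrees, so V^p is V_(- p) throughout.              *)

Set Implicit Arguments.
Unset Strict Implicit.
Unset Printing Implicit Defensive.

Import GRing.Theory.
Local Open Scope ring_scope.

Definition koszul (F : fieldType) (e : int) : F := (-1) ^ e.
Arguments koszul {F} e.

Section Koszul.
Variable F : fieldType.

Lemma koszulD i j : koszul (i + j) = koszul i * koszul j :> F.
Proof. by rewrite /koszul expfzDr // oppr_eq0 oner_eq0. Qed.

Lemma koszulE (i j k : int) : i = j + k + k -> koszul i = koszul j :> F.
Proof.
move=> ->; rewrite !koszulD -mulrA.
by rewrite /koszul -expfzMl mulrNN mulr1 exp1rz mulr1.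
Qed.

Lemma koszul0 : koszul 0 = 1 :> F.
Proof. by []. Qed.

End Koszul.

(* The carrier is an lmodType with its own product and unit, rather than an  *)
(* algType, because the latter would exclude the zero algebra.               *)
Record dgAlgebra (F : fieldType) := DGAlgebra {
  dga_sort :> lmodType F;
  dga_gr : int -> {pred dga_sort};
  dga_one : dga_sort;
  dga_mul : dga_sort -> dga_sort -> dga_sort;
  dga_d : dga_sort -> dga_sort;
  dga_gr_submod : forall i, submod_closed (dga_gr i);
  dga_gr_span : forall a, exists (s : seq int) (c : int -> dga_sort),
    (forall i, c i \in dga_gr i) /\ a = \sum_(i <- s) c i;
  dga_gr_free : forall (s : seq int) (c : int -> dga_sort),
    uniq s -> (forall i, c i \in dga_gr i) -> \sum_(i <- s) c i = 0 ->
    forall i, i \in s -> c i = 0;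
  dga_mul_linearl : forall b, linear (dga_mul^~ b);
  dga_mul_linearr : forall a, linear (dga_mul a);
  dga_mulA : associative dga_mul;
  dga_mul1 : left_id dga_one dga_mul;
  dga_mulr1 : right_id dga_one dga_mul;
  dga_gr1 : dga_one \in dga_gr 0;
  dga_grM : forall i j a b,
    a \in dga_gr i -> b \in dga_gr j -> dga_mul a b \in dga_gr (i + j);
  dga_d_linear : linear dga_d;
  dga_gr_d : forall i a, a \in dga_gr i -> dga_d a \in dga_gr (i - 1);
  dga_dd : forall a, dga_d (dga_d a) = 0;
  dga_leibniz : forall i a b, a \in dga_gr i ->
    dga_d (dga_mul a b) = dga_mul (dga_d a) b + koszul i *: dga_mul a (dga_d b)
}.
Arguments dga_gr {F} A i : rename.
Arguments dga_one {F} A : rename.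
Arguments dga_mul {F} A a b : rename.
Arguments dga_d {F} A a : rename.

Section Letters.
Variables (F : fieldType) (A : dgAlgebra F).

(* A homogeneous element of A together with its degree (0 lies in every      *)
(* degree, so the degree is part of the data).                               *)
Record letter := Letter {
  ldeg : int;
  lval : A;
  lvalP : lval \in dga_gr A ldeg
}.

Lemma letter_eq (x y : letter) : ldeg x = ldeg y -> lval x = lval y -> x = y.
Proof.
case: x y => [i a ai] [j b bj] /= eij eab.
by move: ai bj; rewrite eij eab => ai bj; rewrite (bool_irrelevance ai bj).
Qed.

Lemma gr_zero i : 0 \in dga_gr A i.
Proof. by case: (dga_gr_submod A i). Qed.

Lemma gr_opp i a : a \in dga_gr A i -> - a \in dga_gr A i.
Proof.
case: (dga_gr_submod A i) => z0 lc ai.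
by rewrite -[- a]addr0 -scaleN1r; apply: lc.
Qed.

Definition letter0 : letter := Letter (gr_zero 0).
Definition letter1 : letter := Letter (dga_gr1 A).
Definition lmul (x y : letter) : letter := Letter (dga_grM (lvalP x) (lvalP y)).
Definition ld (x : letter) : letter := Letter (dga_gr_d (lvalP x)).

(* The differential of the suspension: d (s a) = - s (d a). *)
Definition lsd (x : letter) : letter := Letter (gr_opp (lvalP (ld x))).

(* z = c x + y, in one and the same degree. *)
Definition letter_comb (c : F) (x y z : letter) : Prop :=
  [/\ ldeg x = ldeg z, ldeg y = ldeg z & lval z = c *: lval x + lval y].

(* The word [:: a_1; ..; a_k] stands for [a_1|..|a_k] in T(sA). *)
Definition word := seq letter.

Definition wdeg (w : word) : int := \sum_(x <- w) (ldeg x + 1).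

End Letters.

Arguments letter {F} A.
Arguments letter0 {F A}.
Arguments letter1 {F} A.
Arguments word {F} A.

(* The graded pieces are subspaces of one ambient space, so that no transport *)
(* between pieces of provably equal degrees is needed. Only homogeneous       *)
(* elements matter: [bim_d j] is the differential N_j -> N_(j-1), and         *)
(* [bim_l a j], [bim_r j ^~ a] are the actions of a homogeneous a on N_j.     *)
Record dgBimodule (F : fieldType) (A : dgAlgebra F) := DGBimodule {
  bim_sort :> lmodType F;
  bim_gr : int -> {pred bim_sort};
  bim_d : int -> bim_sort -> bim_sort;
  bim_l : letter A -> int -> bim_sort -> bim_sort;
  bim_r : int -> bim_sort -> letter A -> bim_sort;
  bim_gr_submod : forall i, submod_closed (bim_gr i);
  bim_d_linear : forall j, linear (bim_d j);
  bim_l_linear : forall a j, linear (bim_l a j);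
  bim_r_linear : forall a j, linear ((bim_r j)^~ a);
  bim_l_comb : forall c x y z j n, letter_comb c x y z -> n \in bim_gr j ->
    bim_l z j n = c *: bim_l x j n + bim_l y j n;
  bim_r_comb : forall c x y z j n, letter_comb c x y z -> n \in bim_gr j ->
    bim_r j n z = c *: bim_r j n x + bim_r j n y;
  bim_gr_d : forall j n, n \in bim_gr j -> bim_d j n \in bim_gr (j - 1);
  bim_gr_l : forall a j n,
    n \in bim_gr j -> bim_l a j n \in bim_gr (ldeg a + j);
  bim_gr_r : forall a j n,
    n \in bim_gr j -> bim_r j n a \in bim_gr (j + ldeg a);
  bim_l1 : forall j n, n \in bim_gr j -> bim_l (letter1 A) j n = n;
  bim_r1 : forall j n, n \in bim_gr j -> bim_r j n (letter1 A) = n;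
  bim_lA : forall a b j n, n \in bim_gr j ->
    bim_l (lmul a b) j n = bim_l a (ldeg b + j) (bim_l b j n);
  bim_rA : forall a b j n, n \in bim_gr j ->
    bim_r j n (lmul a b) = bim_r (j + ldeg a) (bim_r j n a) b;
  bim_lr : forall a b j n, n \in bim_gr j ->
    bim_r (ldeg a + j) (bim_l a j n) b = bim_l a (j + ldeg b) (bim_r j n b);
  bim_dd : forall j n, n \in bim_gr j -> bim_d (j - 1) (bim_d j n) = 0;
  bim_leibnizl : forall a j n, n \in bim_gr j ->
    bim_d (ldeg a + j) (bim_l a j n) =
      bim_l (ld a) j n + koszul (ldeg a) *: bim_l a (j - 1) (bim_d j n);
  bim_leibnizr : forall a j n, n \in bim_gr j ->
    bim_d (j + ldeg a) (bim_r j n a) =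
      bim_r (j - 1) (bim_d j n) a + koszul j *: bim_r j n (ld a)
}.

Arguments bim_gr {F A} N j : rename.
Arguments bim_d {F A} N j n : rename.
Arguments bim_l {F A} N a j n : rename.
Arguments bim_r {F A} N j n a : rename.

Section RegularBimodule.
Variables (F : fieldType) (A : dgAlgebra F).

Definition regular : dgBimodule A.
Proof.
refine (@DGBimodule F A (dga_sort A) (dga_gr A)
  (fun _ n => dga_d A n)
  (fun a _ n => dga_mul A (lval a) n)
  (fun _ n a => dga_mul A n (lval a))
  _ _ _ _ _ _ _ _ _ _ _ _ _ _ _ _ _).
- exact: dga_gr_submod.
- by move=> _; exact: dga_d_linear.
- by move=> a _; exact: dga_mul_linearr.
- by move=> a _; exact: dga_mul_linearl.
- by move=> c x y z j n [_ _ ->] _; exact: dga_mul_linearl.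
- by move=> c x y z j n [_ _ ->] _; exact: dga_mul_linearr.
- exact: dga_gr_d.
- by move=> a j n nj; apply: dga_grM => //; exact: lvalP.
- by move=> a j n nj; apply: dga_grM => //; exact: lvalP.
- by move=> j n _; exact: dga_mul1.
- by move=> j n _; exact: dga_mulr1.
- by move=> a b j n _ /=; rewrite dga_mulA.
- by move=> a b j n _ /=; rewrite dga_mulA.
- by move=> a b j n _ /=; rewrite dga_mulA.
- by move=> j n _; exact: dga_dd.
- by move=> a j n _ /=; apply: dga_leibniz; exact: lvalP.
- by move=> a j n nj /=; apply: dga_leibniz.
Defined.

End RegularBimodule.
Arguments regular {F} A.

Section DualBimodule.
Variables (F : fieldType) (A : dgAlgebra F).

(* Hom(A, F)_n is the space of linear forms on A_(- n), extended by zero to   *)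
(* the homogeneous elements of the other degrees.                            *)
Definition dual_sort : lmodType F := letter A -> F^o.

Lemma dual0E b : (0 : dual_sort) b = 0. Proof. by []. Qed.

Lemma dual_leibnizE c (phi psi : dual_sort) b :
  (psi + c *: phi) b = psi b + c * phi b.
Proof. by []. Qed.

Lemma dual_combE c (phi psi : dual_sort) b :
  (c *: phi + psi) b = c * phi b + psi b.
Proof. by []. Qed.

Definition dual_gr (n : int) : {pred dual_sort} := [pred phi : dual_sort |
  `[< (forall c x y z, letter_comb c x y z -> phi z = c * phi x + phi y) /\
      (forall x, ldeg x <> - n -> phi x = 0) >]].

Definition dual_d (j : int) (phi : dual_sort) : dual_sort :=
  fun b => (- koszul j : F) *: phi (ld b).

Definition dual_l (a : letter A) (j : int) (phi : dual_sort) : dual_sort :=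
  fun b => (koszul (ldeg a * (j + ldeg b)) : F) *: phi (lmul b a).

Definition dual_r (j : int) (phi : dual_sort) (a : letter A) : dual_sort :=
  fun b => phi (lmul a b).

Lemma dual_grP n (phi : dual_sort) : reflect
  ((forall c x y z, letter_comb c x y z -> phi z = c * phi x + phi y) /\
   (forall x, ldeg x <> - n -> phi x = 0)) (phi \in dual_gr n).
Proof. exact: asboolP. Qed.

Lemma dual_gr_val0 n (phi : dual_sort) x :
  phi \in dual_gr n -> lval x = 0 -> phi x = 0.
Proof.
case/dual_grP => lin _ x0.
have h : letter_comb (- 1) x x x by split=> //; rewrite x0 scaler0 addr0.
by have := lin _ _ _ _ h; rewrite mulN1r addNr.
Qed.

Lemma dual_dE j phi b : dual_d j phi b = - koszul j * (phi (ld b) : F) :> F.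
Proof. by []. Qed.

Lemma dual_lE a j phi b :
  dual_l a j phi b = koszul (ldeg a * (j + ldeg b)) * (phi (lmul b a) : F) :> F.
Proof. by []. Qed.

Definition dual : dgBimodule A.
Proof.
refine (@DGBimodule F A dual_sort dual_gr dual_d dual_l dual_r
  _ _ _ _ _ _ _ _ _ _ _ _ _ _ _ _ _).
- move=> n; split=> [|c phi psi /dual_grP [phil phi0] /dual_grP [psil psi0]].
    by apply/dual_grP; split=> // c *; rewrite !dual0E mulr0 addr0.
  apply/dual_grP; split=> [e x y z h|x hx]; rewrite ?dual_combE.
    by rewrite (phil _ _ _ _ h) (psil _ _ _ _ h); ring.
  by rewrite (phi0 _ hx) (psi0 _ hx) mulr0 addr0.
- move=> j c phi psi; apply/funext => b.
  by rewrite dual_combE !dual_dE dual_combE; ring.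
- move=> a j c phi psi; apply/funext => b.
  by rewrite dual_combE !dual_lE dual_combE; ring.
- by move=> a j c phi psi; apply/funext => b; rewrite /dual_r ?dual_combE.
- move=> c x y z j phi [dx dy vz] /dual_grP [phil _]; apply/funext => b.
  rewrite ?dual_combE !dual_lE dx dy.
  rewrite (phil c (lmul b x) (lmul b y)); first by ring.
  by split; rewrite /= ?dx ?dy ?vz ?dga_mul_linearr.
- move=> c x y z j phi [dx dy vz] /dual_grP [phil _]; apply/funext => b.
  rewrite /dual_r ?dual_combE.
  apply: phil.
  by split; rewrite /= ?dx ?dy ?vz ?dga_mul_linearl.
- move=> j phi phij; case/dual_grP: (phij) => phil phi0; apply/dual_grP; split.
    move=> c x y z [dx dy vz]; rewrite !dual_dE.
    rewrite (phil c (ld x) (ld y)); first by ring.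
    by split; rewrite /= ?dx ?dy ?vz ?dga_d_linear.
  move=> x hx; rewrite !dual_dE phi0 ?mulr0 //= => h; apply: hx.
  by rewrite -[ldeg x](subrK 1) h; ring.
- move=> a j phi phij; case/dual_grP: (phij) => phil phi0; apply/dual_grP; split.
    move=> c x y z [dx dy vz]; rewrite ?dual_lE dx dy.
    rewrite (phil c (lmul x a) (lmul y a)); first by ring.
    by split; rewrite /= ?dx ?dy ?vz ?dga_mul_linearl.
  move=> x hx; rewrite ?dual_lE phi0 ?mulr0 //= => h; apply: hx.
  by rewrite -[ldeg x](addrK (ldeg a)) h; ring.
- move=> a j phi phij; case/dual_grP: (phij) => phil phi0; apply/dual_grP; split.
    move=> c x y z [dx dy vz]; rewrite /dual_r.
    by apply: phil; split; rewrite /= ?dx ?dy ?vz ?dga_mul_linearr.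
  move=> x hx; rewrite /dual_r phi0 //= => h; apply: hx.
  by rewrite -[ldeg x](addKr (ldeg a)) h; ring.
- move=> j phi phij; apply/funext => b; rewrite dual_lE /= mul0r koszul0 mul1r.
  by congr phi; apply: letter_eq; rewrite /= ?addr0 ?dga_mulr1.
- move=> j phi phij; apply/funext => b; rewrite /dual_r /=.
  by congr phi; apply: letter_eq; rewrite /= ?add0r ?dga_mul1.
- move=> a b j phi phij; apply/funext => c; rewrite !dual_lE /= mulrA -koszulD.
  congr (_ * phi _).
    by apply: (@koszulE _ _ _ (- (ldeg a * ldeg b))); ring.
  by apply: letter_eq; rewrite /= ?addrA ?dga_mulA.
- move=> a b j phi phij; apply/funext => c; rewrite /dual_r /=.
  by congr phi; apply: letter_eq; rewrite /= ?addrA ?dga_mulA.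
- move=> a b j phi phij; apply/funext => c; rewrite /dual_r !dual_lE /= addrA.
  by congr (_ * phi _); apply: letter_eq; rewrite /= ?addrA ?dga_mulA.
- move=> j phi phij; apply/funext => b; rewrite !dual_dE.
  by rewrite (dual_gr_val0 phij) ?mulr0 //= dga_dd.
- move=> a j phi phij; case/dual_grP: (phij) => phil _; apply/funext => b.
  rewrite dual_leibnizE !dual_dE ?dual_lE.
  rewrite !dual_dE ?dual_lE.
  rewrite -[ldeg (ld a)]/(ldeg a - 1) -[ldeg (ld b)]/(ldeg b - 1).
  have -> : phi (ld (lmul b a)) =
      koszul (ldeg b) * phi (lmul b (ld a)) + phi (lmul (ld b) a).
    apply: phil; split; rewrite /= ?addrA //; first by ring.
    by rewrite addrC (dga_leibniz _ (lvalP b)).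
  have -> : koszul ((ldeg a - 1) * (j + ldeg b)) =
      koszul (ldeg a) * koszul (ldeg a * (j - 1 + ldeg b)) * koszul j
      * koszul (ldeg b) :> F.
    rewrite -!koszulD.
    by apply: (@koszulE _ _ _ (- j - ldeg b)); ring.
  have -> : ldeg a * (j + (ldeg b - 1)) = ldeg a * (j - 1 + ldeg b) by ring.
  by rewrite koszulD; ring.
- move=> a j phi phij; case/dual_grP: (phij) => phil _; apply/funext => b.
  rewrite dual_leibnizE !dual_dE /dual_r dual_dE.
  have -> : phi (ld (lmul a b)) =
      koszul (ldeg a) * phi (lmul a (ld b)) + phi (lmul (ld a) b).
    apply: phil; split; rewrite /= ?addrA //; first by ring.
    by rewrite addrC (dga_leibniz _ (lvalP a)).
  by rewrite koszulD; ring.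
Defined.

End DualBimodule.
Arguments dual {F} A.

Section Hochschild.
Variables (F : fieldType) (A : dgAlgebra F) (N : dgBimodule A).
Local Notation cofun := (word A -> bim_sort N).
Implicit Types (p : int) (f : cofun) (w : word A).

Lemma cofun0E w : (0 : cofun) w = 0. Proof. by []. Qed.

Lemma cofun_combE c f g w : (c *: f + g) w = c *: f w + g w.
Proof. by []. Qed.

(* A linear map T(sA) -> N of degree p, given on the words of homogeneous    *)
(* letters: linearity on each tensor power is multilinearity in the letters. *)
Definition multilinear f : Prop := forall c u v x y z, letter_comb c x y z ->
  f (u ++ z :: v) = c *: f (u ++ x :: v) + f (u ++ y :: v).

Definition is_cochain p f : Prop :=
  multilinear f /\ forall w, f w \in bim_gr N (p + wdeg w).

Record cochain p := Cochain {
  cochain_fun :> cofun;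
  cochainP : is_cochain p cochain_fun
}.

(* The letter d a_i of the i-th term is the differential - s (d a_i) of s a_i *)
(* in sA; this is what makes D0 + D1 square to zero.                          *)
Definition hochD0 p f : cofun := fun w =>
  bim_d N (p + wdeg w) (f w)
  - \sum_(0 <= i < size w) koszul (p + wdeg (take i w)) *:
      f (take i w ++ lsd (nth letter0 w i) :: drop i.+1 w).

Definition hochD1 p f : cofun := fun w =>
  if w is a :: v then
    let u := take (size v) w in
    - (koszul ((ldeg a + 1) * p) *: bim_l N a (p + wdeg v) (f v))
    - \sum_(1 <= i < size w) koszul (p + wdeg (take i w)) *:
        f (take i.-1 w ++
           lmul (nth letter0 w i.-1) (nth letter0 w i) :: drop i.+1 w)
    + koszul (p + wdeg u) *: bim_r N (p + wdeg u) (f u) (last a v)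
  else 0.

Definition hochD p f : cofun := hochD0 p f + hochD1 p f.

Lemma hochD_linear p : linear (hochD p).
Proof.
move=> c f g; apply/funext => w; rewrite /hochD !fctE.
have sumE (I : Type) (r : seq I) (s : I -> F) (t : I -> word A) :
    \sum_(i <- r) s i *: (c *: f (t i) + g (t i)) =
    c *: (\sum_(i <- r) s i *: f (t i)) + \sum_(i <- r) s i *: g (t i).
  rewrite scaler_sumr -big_split /=; apply: eq_bigr => i _.
  by rewrite scalerDr !scalerA mulrC.
have addE (x y x' y' : N) :
    c *: x + y + (c *: x' + y') = c *: (x + x') + (y + y').
  by rewrite scalerDr addrACA.
have oppE (x y : N) : - (c *: x + y) = c *: (- x) - y.
  by rewrite scalerN opprD.
have scaE (k : F) (x y : N) : k *: (c *: x + y) = c *: (k *: x) + k *: y.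
  by rewrite scalerDr !scalerA mulrC.
rewrite /hochD0 /hochD1; case: w => [|a v].
  by rewrite !addr0 !big_nil !subr0 bim_d_linear.
by rewrite bim_d_linear bim_l_linear bim_r_linear !sumE !scaE !oppE !addE.
Qed.

Definition is_cocycle p : {pred cofun} :=
  [pred f | `[< is_cochain p f /\ hochD p f = 0 >]].

Lemma is_cocycleP p f :
  reflect (is_cochain p f /\ hochD p f = 0) (f \in is_cocycle p).
Proof. exact: asboolP. Qed.

Lemma is_cocycle_submod p : submod_closed (is_cocycle p).
Proof.
split=> [|c f g /is_cocycleP [[fl fd] fD] /is_cocycleP [[gl gd] gD]].
  apply/is_cocycleP; split; first split.
  - by move=> c u v x y z _; rewrite !cofun0E scaler0 addr0.
  - by move=> w; case: (bim_gr_submod N (p + wdeg w)).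
  - by have := hochD_linear p (-1) 0 0; rewrite scaler0 addr0 scaleN1r addNr.
apply/is_cocycleP; split; first split.
- move=> e u v x y z h; rewrite !cofun_combE (fl _ _ _ _ _ _ h) (gl _ _ _ _ _ _ h).
  by rewrite !scalerDr !scalerA mulrC addrACA.
- move=> w; case: (bim_gr_submod N (p + wdeg w)) => _; apply.
    exact: fd.
  exact: gd.
- by rewrite hochD_linear fD gD scaler0 addr0.
Qed.

HB.instance Definition _ p :=
  GRing.isSubmodClosed.Build F cofun (is_cocycle p) (is_cocycle_submod p).

Record cocycle p := Cocycle {
  cocycle_val : cofun;
  cocycle_valP : cocycle_val \in is_cocycle p
}.

HB.instance Definition _ p := [isSub for @cocycle_val p].
HB.instance Definition _ p := [Choice of cocycle p by <:].
HB.instance Definition _ p := [SubChoice_isSubLmodule of cocycle p by <:].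

Definition cocycle_cochain p (z : cocycle p) : cochain p :=
  Cochain (proj1 (elimT (is_cocycleP _ _) (cocycle_valP z))).

Definition is_coboundary p : {pred cocycle p} :=
  [pred z | `[< exists g : cochain (p + 1), cocycle_val z = hochD (p + 1) g >]].
Arguments is_coboundary p : clear implicits.

Lemma is_coboundaryP p (z : cocycle p) :
  reflect (exists g : cochain (p + 1), cocycle_val z = hochD (p + 1) g)
          (z \in is_coboundary p).
Proof. exact: asboolP. Qed.

Lemma is_coboundary_submod p : submod_closed (is_coboundary p).
Proof.
split=> [|c x y /is_coboundaryP [g gx] /is_coboundaryP [h hy]].
  apply/is_coboundaryP.
  exists (cocycle_cochain (0 : cocycle (p + 1))) => /=.
  by have := hochD_linear (p + 1) (-1) 0 0; rewrite scaler0 addr0 scaleN1r addNr.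
apply/is_coboundaryP.
suff ghP : is_cochain (p + 1) (c *: (g : cofun) + (h : cofun)).
  by exists (Cochain ghP); rewrite /= hochD_linear -gx -hy.
case: g h {gx hy} => g [gl gd] [h [hl hd]] /=; split.
- move=> e u v a b z abz.
  rewrite !cofun_combE (gl _ _ _ _ _ _ abz) (hl _ _ _ _ _ _ abz).
  by rewrite !scalerDr !scalerA mulrC addrACA.
- move=> w; case: (bim_gr_submod N (p + 1 + wdeg w)) => _; apply.
    exact: gd.
  exact: hd.
Qed.

HB.instance Definition _ p :=
  GRing.isSubmodClosed.Build F (cocycle p) (is_coboundary p)
    (is_coboundary_submod p).

(* HH p is the cohomology in lower degree p, that is HH^(- p)(A; N). *)
Definition HH p := Quotient.quot (is_coboundary p).

HB.instance Definition _ p := GRing.Zmodule.on (HH p).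
HB.instance Definition _ p := EqQuotient.on (HH p).

Definition HHrepr p (x : HH p) : cocycle p := repr x.
Definition HHpi p (z : cocycle p) : HH p := \pi_(HH p)%qT z.

Lemma HHreprK p (x : HH p) : HHpi (HHrepr x) = x.
Proof. exact: reprK. Qed.

Lemma HHpiP p (x y : cocycle p) :
  HHpi x = HHpi y <-> x - y \in is_coboundary p.
Proof. by rewrite Quotient.idealrBE; split=> /eqP. Qed.

Lemma HHpiD p (x y : cocycle p) : HHpi (x + y) = HHpi x + HHpi y.
Proof. by rewrite /HHpi [LHS]Quotient.pi_add. Qed.

Definition HHscale p (c : F) (x : HH p) : HH p := HHpi (c *: HHrepr x).

Lemma HHpiZ p c (z : cocycle p) : HHpi (c *: z) = HHscale c (HHpi z).
Proof.
apply/HHpiP; rewrite -scalerBr.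
by apply: rpredZ; apply/HHpiP; rewrite HHreprK.
Qed.

Fact HHscaleA p a b (x : HH p) :
  HHscale a (HHscale b x) = HHscale (a * b) x.
Proof. by rewrite -[x]HHreprK -!HHpiZ scalerA. Qed.

Fact HHscale1 p : left_id 1 (@HHscale p).
Proof. by move=> x; rewrite -[x]HHreprK -!HHpiZ scale1r. Qed.

Fact HHscaleDr p : right_distributive (@HHscale p) +%R.
Proof.
move=> c x y; rewrite -[x]HHreprK -[y]HHreprK -HHpiD -!HHpiZ -HHpiD.
by rewrite scalerDr.
Qed.

Fact HHscaleDl p (x : HH p) : {morph (@HHscale p)^~ x : a b / a + b}.
Proof.
by move=> a b; rewrite -[x]HHreprK -!HHpiZ -HHpiD scalerDl.
Qed.

HB.instance Definition _ p := GRing.Zmodule_isLmodule.Build F (HH p)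
  (@HHscaleA p) (@HHscale1 p) (@HHscaleDr p) (@HHscaleDl p).

(* The class of a cocycle f of degree p, and 0 if f is not one. It is only    *)
(* applied to cochain operations which send cocycles to cocycles.            *)
Definition HHclass p (f : cofun) : HH p :=
  HHpi (insubd (0 : cocycle p) f).

End Hochschild.

Arguments HH {F A} N p.
Arguments HHclass {F A N} p f.

Section Operations.
Variables (F : fieldType) (A : dgAlgebra F).
Local Notation CA := (cochain (regular A)).
Local Notation HHA := (HH (regular A)).

Definition cochain_letter p (f : CA p) (w : word A) : letter A :=
  @Letter F A (p + wdeg w) (f w) (proj2 (cochainP f) w).

Definition unit_cochain (w : word A) : A :=
  if w is [::] then dga_one A else 0.

Definition act (N : dgBimodule A) p q (f : CA p) (g : cochain N q)
    (w : word A) : N :=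
  \sum_(0 <= i < (size w).+1) koszul (q * wdeg (take i w)) *:
    bim_l N (cochain_letter f (take i w)) (q + wdeg (drop i w)) (g (drop i w)).

(* The insertion of g at position i, fed with the j letters that follow.     *)
Definition circ p q (f : CA p) (g : CA q) (w : word A) : A :=
  \sum_(0 <= i < (size w).+1) \sum_(0 <= j < (size w - i).+1)
    koszul ((q + 1) * wdeg (take i w)) *:
      f (take i w ++
         cochain_letter g (take j (drop i w)) :: drop j (drop i w)).

Definition bracket p q (f : CA p) (g : CA q) (w : word A) : A :=
  circ f g w - koszul ((p + 1) * (q + 1)) *: circ g f w.

(* A formal linear combination of elementary tensors a_0[a_1|..|a_n] in      *)
(* A (x) T(sA).                                                              *)
Definition chain := seq (F * (letter A * word A)).

(* B = - (1 - t) s N, where N is the sum of the cyclic rotations, s puts 1 in *)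
(* front and t moves the last letter to the front, all with Koszul signs in  *)
(* the suspended letters. On the normalized complex only the terms in 1[..]  *)
(* survive. The overall sign is the one that fits the sign conventions for   *)
(* the bracket, for the transpose of B and for Batalin-Vilkovisky algebras:   *)
(* for A = F[x]/(x^2) in degree 0, the derivation a = x d/dx, b = x, and m    *)
(* the linear form dual to x, one has a b = 0, Delta b = 0 and {a, b} = x,   *)
(* which forces Delta a = 1, whereas + (1 - t) s N would yield Delta a = - 1. *)
Definition connesB (a : letter A) (w : word A) : chain :=
  flatten [seq
    let b := rot i (a :: w) in
    let s : F := koszul (wdeg (take i (a :: w)) * wdeg (drop i (a :: w))) in
    let l := last a b in
    let b' := letter1 A :: take (size w) b in
    [:: (- s, (letter1 A, b));
        (s * koszul ((ldeg l + 1) * wdeg b'), (l, b'))]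
    | i <- iota 0 (size w).+1].

(* The isomorphism between C^*(A; A^dual) and the dual of C_*(A; A), with the *)
(* Koszul sign for exchanging a_0 and [a_1|..|a_n].                          *)
Definition chain_form (g : word A -> dual A) (a : letter A) (w : word A) : F :=
  koszul (F := F) (ldeg a * wdeg w) * g w a.

Definition form_cochain (m : letter A -> word A -> F) : word A -> dual A :=
  fun w a => koszul (F := F) (ldeg a * wdeg w) * m a w.

Definition form_eval (m : letter A -> word A -> F) (c : chain) : F :=
  \sum_(t <- c) t.1 * m t.2.1 t.2.2.

Definition connes_dual p (g : cochain (dual A) p) : word A -> dual A :=
  form_cochain (fun a w =>
    koszul p * form_eval (chain_form g) (connesB a w)).

Definition HHunit : HHA 0 :=
  HHclass (N := regular A) 0 unit_cochain.

Definition HHact (N : dgBimodule A) i j (x : HHA i) (y : HH N j) :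
    HH N (i + j) :=
  HHclass (i + j)
    (act (cocycle_cochain (HHrepr x)) (cocycle_cochain (HHrepr y))).

Definition HHcup i j (x : HHA i) (y : HHA j) : HHA (i + j) := HHact x y.

Definition HHbracket i j (x : HHA i) (y : HHA j) : HHA (i + j + 1) :=
  HHclass (N := regular A) (i + j + 1)
    (bracket (cocycle_cochain (HHrepr x)) (cocycle_cochain (HHrepr y))).

Definition HHconnes i (x : HH (dual A) i) : HH (dual A) (i + 1) :=
  HHclass (i + 1) (connes_dual (cocycle_cochain (HHrepr x))).

End Operations.

(* Transport between pieces of provably equal degrees. *)
Definition gcast (F : fieldType) (G : int -> lmodType F) i j (e : i = j)
  (x : G i) : G j := ecast k (G k) e x.

Section GradedStructures.
Variables (F : fieldType) (G : int -> lmodType F).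

Lemma deg_br_anti (i j : int) : j + i + 1 = i + j + 1.
Proof. by ring. Qed.

Lemma deg_jacobi_l (i j k : int) : i + j + 1 + k + 1 = i + (j + k + 1) + 1.
Proof. by ring. Qed.

Lemma deg_jacobi_r (i j k : int) : j + (i + k + 1) + 1 = i + (j + k + 1) + 1.
Proof. by ring. Qed.

Lemma deg_poisson_l (i j k : int) : i + j + 1 + k = i + (j + k) + 1.
Proof. by ring. Qed.

Lemma deg_poisson_r (i j k : int) : j + (i + k + 1) = i + (j + k) + 1.
Proof. by ring. Qed.

Record is_gerstenhaber (one : G 0)
    (mul : forall i j, G i -> G j -> G (i + j))
    (br : forall i j, G i -> G j -> G (i + j + 1)) : Prop := IsGerstenhaber {
  ger_mul_linearl : forall i j (b : G j), linear (fun a : G i => mul i j a b);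
  ger_mul_linearr : forall i j (a : G i), linear (mul i j a);
  ger_mulA : forall i j k (a : G i) (b : G j) (c : G k),
    gcast (addrA i j k) (mul i (j + k) a (mul j k b c)) =
    mul (i + j) k (mul i j a b) c;
  ger_mul1 : forall i (a : G i), gcast (add0r i) (mul 0 i one a) = a;
  ger_mulr1 : forall i (a : G i), gcast (addr0 i) (mul i 0 a one) = a;
  ger_mulC : forall i j (a : G i) (b : G j),
    mul i j a b = koszul (i * j) *: gcast (addrC j i) (mul j i b a);
  ger_br_linearl : forall i j (b : G j), linear (fun a : G i => br i j a b);
  ger_br_linearr : forall i j (a : G i), linear (br i j a);
  ger_br_anti : forall i j (a : G i) (b : G j),
    br i j a b =
    - (koszul ((i + 1) * (j + 1)) *: gcast (deg_br_anti i j) (br j i b a));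
  ger_jacobi : forall i j k (a : G i) (b : G j) (c : G k),
    br i (j + k + 1) a (br j k b c) =
    gcast (deg_jacobi_l i j k) (br (i + j + 1) k (br i j a b) c) +
    koszul ((i + 1) * (j + 1)) *:
      gcast (deg_jacobi_r i j k) (br j (i + k + 1) b (br i k a c));
  ger_poisson : forall i j k (a : G i) (b : G j) (c : G k),
    br i (j + k) a (mul j k b c) =
    gcast (deg_poisson_l i j k) (mul (i + j + 1) k (br i j a b) c) +
    koszul ((i + 1) * j) *:
      gcast (deg_poisson_r i j k) (mul j (i + k + 1) b (br i k a c))
}.

Record is_batalin_vilkovisky (one : G 0)
    (mul : forall i j, G i -> G j -> G (i + j))
    (br : forall i j, G i -> G j -> G (i + j + 1))
    (Delta : forall i, G i -> G (i + 1)) : Prop := IsBatalinVilkovisky {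
  bv_gerstenhaber : is_gerstenhaber one mul br;
  bv_Delta_linear : forall i, linear (Delta i);
  bv_Delta_Delta : forall i (a : G i), Delta (i + 1) (Delta i a) = 0;
  bv_bracket : forall i j (a : G i) (b : G j),
    br i j a b = koszul i *:
      (Delta (i + j) (mul i j a b)
       - gcast (addrAC i 1 j) (mul (i + 1) j (Delta i a) b)
       - koszul i *: gcast (addrA i j 1) (mul i (j + 1) a (Delta j b)))
}.

End GradedStructures.

(* Main.v *)
Require Import Defs.
From HB Require Import structures.
From mathcomp Require Import all_boot all_order all_algebra.
From mathcomp Require Import boolp functions.

From Stdlib Require Import Btauto Ring.
From mathcomp Require Import ring.

Set Implicit Arguments.
Unset Strict Implicit.
Unset Printing Implicit Defensive.

Import GRing.Theory.
Local Open Scope ring_scope.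

(** A Hochschild cochain of A with values in A is a coderivation of the tensor
  coalgebra T(sA). The differential and the product of A form one such cochain
  mu, of square zero, and the Hochschild differential is the commutator with mu.
  A cochain with values in the dual of A is a functional X on the chains a[w];
  these are words with a marked letter, read cyclically. A cochain f acts on
  functionals in two ways: by the Lie derivative L_f (lie), which inserts f
  everywhere in the cyclic word, and by the contraction i_f (the action of f,
  which is lie_pair with mu outermost). The differential is L_mu.

  Two formulas hold up to homotopy on cocycles, where B is the transpose of the
  operator of Connes:
  - [B, i_f] = L_f, the Cartan formula (cartan_formula);
  - [L_f, i_g] = i_{f,g} (lie_action_commutator), from an identity that
    sorts the compositions of insertions (lie_pair_circ).
  On cohomology they combine to i_{a,b} = [[B, i_a], i_b] (rho_bracket).
  Moreover i is multiplicative for the cup product, i_a and i_b commute in the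
  graded sense by the homotopy of Gerstenhaber (hochD_circ), and B has square
  zero. In the unnormalised complex B has terms without the unit in front; on
  cocycles they are removed by a homotopy (connes_unit_front).

  Since a |-> i_a m is bijective, an identity in HH(A, A) holds as soon as the
  operators agree on m. The Jacobi and Poisson identities hold for all double
  commutators with an operator of square zero, and the other axioms of
  Gerstenhaber algebras follow in the same way. Finally i_(Delta a) m = B i_a m
  defines Delta, and as B m = 0 the value of [[B, i_a], i_b] on m has three
  terms, which are those of the Batalin-Vilkovisky identity; Delta Delta = 0
  because B B = 0. *)

(** * Signs and linear identities *)

Definition oddz (e : int) : bool := odd `|e|%N.

Lemma oddzS m : oddz (m + 1) = ~~ oddz m.
Proof.
rewrite /oddz; case: m => n; first by rewrite addrC -intS.
by rewrite NegzE abszN intS opprD addrAC addNr add0r abszN /= negbK.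
Qed.

Lemma oddzD m n : oddz (m + n) = xorb (oddz m) (oddz n).
Proof.
have S (k l : int) : oddz (k + l) = xorb (oddz k) (oddz l) <->
    oddz (k + (l + 1)) = xorb (oddz k) (oddz (l + 1)).
  by rewrite addrA !oddzS; case: (oddz _) (oddz k) (oddz l) => [] [] [].
elim: n => [|n IH|n IH]; first by rewrite addr0; case: oddz.
  by rewrite intS [1 + _]addrC; exact: (S _ _).1 IH.
by apply/(S _ _).2; rewrite intS opprD addrAC addNr add0r.
Qed.

Lemma oddzN m : oddz (- m) = oddz m.
Proof. by rewrite /oddz abszN. Qed.

Lemma oddzM m n : oddz (m * n) = andb (oddz m) (oddz n).
Proof. by rewrite /oddz abszM oddM. Qed.

Lemma koszul_oddz (F : fieldType) e : koszul e = (-1) ^+ (oddz e) :> F.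
Proof.
have key n : (-1) ^+ odd n = (-1) ^+ n :> F by rewrite signr_odd.
rewrite /koszul /oddz key; case: e => n //.
by rewrite NegzE abszN absz_nat -exprz_inv invrN1.
Qed.

Lemma koszul_parity (F : fieldType) e e' :
  oddz e = oddz e' -> koszul e = koszul e' :> F.
Proof. by rewrite !koszul_oddz => ->. Qed.

Lemma koszul_pm (F : fieldType) e : koszul e = 1 :> F \/ koszul e = - 1 :> F.
Proof. by rewrite koszul_oddz; case: oddz; [right | left]. Qed.

Lemma koszul1 (F : fieldType) : koszul 1 = - 1 :> F.
Proof. by []. Qed.

Ltac oddz_norm :=
  rewrite ?(oddzD, oddzM, oddzN, (erefl : oddz 0 = false),
            (erefl : oddz 1 = true), (erefl : oddz 2 = false)).

Ltac oddz_gen :=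
  repeat match goal with |- context [oddz ?x] => generalize (oddz x); intro end.

(** Two Koszul signs are equal when their exponents agree modulo 2, where the
  exponents are polynomials in the degrees. The parities of the degrees live in
  the Boolean ring; idempotence of its elements is rarely needed, and then few
  of them occur, so that a truth table decides. *)
Ltac bool_ring := let G := Get_goal in ring_lookup (PackRing Ring) [] G.
Ltac parity := apply: koszul_parity; oddz_norm;
  first [bool_ring | oddz_gen; btauto].

(** The square-zero extension of F by V. It turns linear identities in V into
  identities of a commutative ring, which a ring normaliser decides. *)
Definition sqzero (F : fieldType) (V : lmodType F) : Type := (F * V)%type.

Section SquareZero.
Variables (F : fieldType) (V : lmodType F).
Local Notation E := (sqzero V).

HB.instance Definition _ := GRing.Zmodule.on E.

Definition sqzero_mul (x y : E) : E := (x.1 * y.1, x.1 *: y.2 + y.1 *: x.2).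
Definition sqzero_one : E := (1, 0).

Fact sqzero_mulA : associative sqzero_mul.
Proof.
move=> [a u] [b v] [c w]; rewrite /sqzero_mul /=; congr pair; first exact: mulrA.
by rewrite !scalerDr !scalerA -!addrA; congr (_ *: _ + (_ *: _ + _ *: _));
  ring.
Qed.

Fact sqzero_mulC : commutative sqzero_mul.
Proof. by move=> [a u] [b v]; rewrite /sqzero_mul /= mulrC addrC. Qed.

Fact sqzero_mul1 : left_id sqzero_one sqzero_mul.
Proof.
by move=> [a u]; rewrite /sqzero_mul /= mul1r scale1r scaler0 addr0.
Qed.

Fact sqzero_mulDl : left_distributive sqzero_mul +%R.
Proof.
move=> [a u] [b v] [c w]; rewrite /sqzero_mul /=; congr pair; first exact: mulrDl.
by rewrite /= scalerDl scalerDr addrACA.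
Qed.

Fact sqzero_one_neq0 : sqzero_one != 0.
Proof. by apply/eqP => -[] /eqP; rewrite oner_eq0. Qed.

HB.instance Definition _ := GRing.Zmodule_isComNzRing.Build E
  sqzero_mulA sqzero_mulC sqzero_mul1 sqzero_mulDl sqzero_one_neq0.

Definition sqz_vec (v : V) : E := (0, v).
Definition sqz_scal (c : F) : E := (c, 0).

Lemma sqz_vec_inj u v : sqz_vec u = sqz_vec v -> u = v.
Proof. by case. Qed.

Lemma sqz_vecD u v : sqz_vec (u + v) = sqz_vec u + sqz_vec v.
Proof. by congr pair; rewrite /= ?addr0. Qed.

Lemma sqz_vecN u : sqz_vec (- u) = - sqz_vec u.
Proof. by congr pair; rewrite /= oppr0. Qed.

Lemma sqz_vec0 : sqz_vec 0 = 0. Proof. by []. Qed.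

Lemma sqz_vecZ c u : sqz_vec (c *: u) = sqz_scal c * sqz_vec u.
Proof. by congr pair; rewrite /= ?mulr0 // scale0r addr0. Qed.

Lemma sqz_scalM c d : sqz_scal (c * d) = sqz_scal c * sqz_scal d.
Proof. by congr pair; rewrite /= !scaler0 addr0. Qed.

Lemma sqz_scalD c d : sqz_scal (c + d) = sqz_scal c + sqz_scal d.
Proof. by congr pair; rewrite /= addr0. Qed.

Lemma sqz_scalN c : sqz_scal (- c) = - sqz_scal c.
Proof. by congr pair; rewrite /= oppr0. Qed.

Lemma sqz_scal1 : sqz_scal 1 = 1. Proof. by []. Qed.

End SquareZero.

(** Closes an identity between linear combinations of opaque vectors. *)
Ltac module := apply: sqz_vec_inj;
  rewrite ?(sqz_vecD, sqz_vecN, sqz_vec0, sqz_vecZ);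
  rewrite ?(sqz_scalM, sqz_scalD, sqz_scalN, sqz_scal1); ring.

(** * Sums over the factorisations of a word *)

Section Splits.
Variables (T : Type) (F : fieldType) (V : lmodType F).
Implicit Types (w u v : seq T) (K : seq T -> seq T -> V).

Definition split2 w K : V :=
  \sum_(0 <= i < (size w).+1) K (take i w) (drop i w).

Lemma split2_nil K : split2 [::] K = K [::] [::].
Proof. by rewrite /split2 big_nat1. Qed.

Lemma split2_cons a w K :
  split2 (a :: w) K = K [::] (a :: w) + split2 w (fun u v => K (a :: u) v).
Proof. by rewrite /split2 /= big_nat_recl. Qed.

Lemma split2_rcons a w K :
  split2 (rcons w a) K =
  split2 w (fun u v => K u (rcons v a)) + K (rcons w a) [::].
Proof.
elim: w K => [|b w IH] K /=; first by rewrite split2_cons !split2_nil.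
by rewrite !split2_cons IH addrA.
Qed.

Lemma eq_split2 w K K' : (forall u v, w = u ++ v -> K u v = K' u v) ->
  split2 w K = split2 w K'.
Proof.
by move=> e; apply: eq_bigr => i _; apply: e; rewrite cat_take_drop.
Qed.

Lemma split2D w K K' :
  split2 w (fun u v => K u v + K' u v) = split2 w K + split2 w K'.
Proof. exact: big_split. Qed.

Lemma split2Z c w K : split2 w (fun u v => c *: K u v) = c *: split2 w K.
Proof. by rewrite /split2 scaler_sumr. Qed.

Lemma split2_0 w K : (forall u v, w = u ++ v -> K u v = 0) -> split2 w K = 0.
Proof.
by move=> e; apply: big1 => i _; apply: e; rewrite cat_take_drop.
Qed.

Lemma split2_ins b u v K : split2 (u ++ b :: v) K =
  split2 u (fun u1 u2 => K u1 (u2 ++ b :: v)) +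
  split2 v (fun v1 v2 => K (u ++ b :: v1) v2).
Proof.
elim: u K => [|a u IH] K /=; first by rewrite split2_cons !split2_nil.
by rewrite !split2_cons IH addrA.
Qed.

Lemma split2A w (K : seq T -> seq T -> seq T -> V) :
  split2 w (fun u r => split2 u (fun u1 u2 => K u1 u2 r)) =
  split2 w (fun u1 r => split2 r (fun u2 v => K u1 u2 v)).
Proof.
elim: w K => [|a w IH] K; first by rewrite !split2_nil.
rewrite split2_cons [RHS]split2_cons split2_nil split2_cons -addrA -IH -split2D.
by congr (_ + _); apply: eq_split2 => u v _; rewrite split2_cons.
Qed.

Lemma split2_swap w w' (K : seq T -> seq T -> seq T -> seq T -> V) :
  split2 w (fun u v => split2 w' (fun u' v' => K u v u' v')) =
  split2 w' (fun u' v' => split2 w (fun u v => K u v u' v')).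
Proof. exact: exchange_big. Qed.

Lemma split2_nil1 w K : (forall a u v, K (a :: u) v = 0) ->
  split2 w K = K [::] w.
Proof.
move=> e; case: w => [|a w]; rewrite ?split2_nil // split2_cons.
by rewrite split2_0 ?addr0.
Qed.

Lemma split2_nil2 w K : (forall a u v, K u (rcons v a) = 0) ->
  split2 w K = K w [::].
Proof.
move=> e; case/lastP: w => [|w a]; rewrite ?split2_nil // split2_rcons.
by rewrite split2_0 ?add0r.
Qed.

Definition head_case (v : seq T) (k : V) (G : T -> seq T -> V) : V :=
  if v is a :: v' then G a v' else k.

Definition last_case (v : seq T) (k : V) (G : seq T -> T -> V) : V :=
  if rev v is a :: v' then G (rev v') a else k.

Lemma last_case_rcons v a k G : last_case (rcons v a) k G = G v a.
Proof. by rewrite /last_case rev_rcons revK. Qed.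

Lemma last_case_nil k G : last_case [::] k G = k.
Proof. by []. Qed.

(** A letter next to the cut may be counted on either side of it. This makes terms
  from the two sides of a cut cancel or telescope. *)
Lemma split2_move w (G : seq T -> T -> seq T -> V) :
  split2 w (fun u v => last_case u 0 (fun u' a => G u' a v)) =
  split2 w (fun u v => head_case v 0 (fun a v' => G u a v')).
Proof.
elim: w G => [|b w IH] G; first by rewrite !split2_nil.
rewrite !split2_cons /= last_case_nil add0r.
rewrite -(IH (fun u => G (b :: u))).
transitivity (split2 w (fun u v => head_case u (G [::] b v)
   (fun _ _ => last_case u 0 (fun u' a => G (b :: u') a v)))).
  apply: eq_split2 => u v _; case/lastP: u => [|u a].
    exact: (last_case_rcons [::]).
  by rewrite -rcons_cons !last_case_rcons; case: u.
case: w {IH} => [|c w]; first by rewrite !split2_nil /= addr0.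
by rewrite !split2_cons /= last_case_nil add0r.
Qed.

Definition split3 w (K : seq T -> seq T -> seq T -> V) : V :=
  split2 w (fun u r => split2 r (fun v z => K u v z)).

Implicit Types L : seq T -> seq T -> seq T -> V.

Lemma eq_split3 w L L' :
  (forall u v z, w = u ++ v ++ z -> L u v z = L' u v z) ->
  split3 w L = split3 w L'.
Proof.
move=> e; apply: eq_split2 => u r e1; apply: eq_split2 => v z e2.
by apply: e; rewrite e1 e2.
Qed.

Lemma split3D w L L' :
  split3 w (fun u v z => L u v z + L' u v z) = split3 w L + split3 w L'.
Proof.
rewrite /split3 -split2D; apply: eq_split2 => u v _; exact: split2D.
Qed.

Lemma split3Z c w L :
  split3 w (fun u v z => c *: L u v z) = c *: split3 w L.
Proof.
rewrite /split3 -split2Z; apply: eq_split2 => u v _; exact: split2Z.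
Qed.

Lemma split3_0 w L :
  (forall u v z, w = u ++ v ++ z -> L u v z = 0) -> split3 w L = 0.
Proof.
move=> e; apply: split2_0 => u r e1; apply: split2_0 => v z e2.
by apply: e; rewrite e1 e2.
Qed.

End Splits.

Section Reassociation.
Variables (T : Type) (F : fieldType) (V : lmodType F).
Local Notation W := (seq T).

Lemma split32_1 (w : W) (K : W -> W -> W -> W -> V) :
  split3 w (fun u v z => split2 u (fun u1 u2 => K u1 u2 v z)) =
  split2 w (fun u1 r => split3 r (fun u2 v z => K u1 u2 v z)).
Proof.
rewrite /split3 -[RHS]split2A; apply: eq_split2 => u r _.
exact: (split2_swap r u (fun v z u1 u2 => K u1 u2 v z)).
Qed.

Lemma split23_1 (w : W) (K : W -> W -> W -> W -> V) :
  split2 w (fun x y => split3 x (fun u v z => K u v z y)) =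
  split3 w (fun u v r => split2 r (fun z y => K u v z y)).
Proof.
rewrite /split3 split2A; apply: eq_split2 => u r _; exact: split2A.
Qed.

Lemma split32_2 (w : W) (K : W -> W -> W -> W -> V) :
  split3 w (fun u v z => split2 v (fun v1 v2 => K u v1 v2 z)) =
  split3 w (fun u v1 r => split2 r (fun v2 z => K u v1 v2 z)).
Proof. by apply: eq_split2 => u r _; exact: split2A. Qed.

Lemma split33_1 (w : W) (K : W -> W -> W -> W -> W -> V) :
  split3 w (fun u v z => split3 u (fun u1 u2 u3 => K u1 u2 u3 v z)) =
  split3 w (fun u1 u2 r => split3 r (fun u3 v z => K u1 u2 u3 v z)).
Proof.
rewrite (split32_1 w (fun u1 r v z => split2 r (fun u2 u3 => K u1 u2 u3 v z))).
apply: eq_split2 => u1 r _; exact: split32_1.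
Qed.

Lemma split33_2 (w : W) (K : W -> W -> W -> W -> W -> V) :
  split3 w (fun u v z => split3 v (fun v1 v2 v3 => K u v1 v2 v3 z)) =
  split3 w (fun u v1 r => split3 r (fun v2 v3 z => K u v1 v2 v3 z)).
Proof. by apply: eq_split2 => u r _; exact: split23_1. Qed.

Lemma split322 (w : W) (K : W -> W -> W -> W -> W -> V) :
  split3 w (fun u v z =>
    split2 u (fun u1 u2 => split2 z (fun z1 z2 => K u1 u2 v z1 z2))) =
  split3 w (fun u1 u2 r => split3 r (fun v z1 z2 => K u1 u2 v z1 z2)).
Proof. exact: split32_1. Qed.

End Reassociation.

Section WordDegree.
Variables (F : fieldType) (A : dgAlgebra F).

Lemma wdeg_nil : wdeg ([::] : word A) = 0.
Proof. by rewrite /wdeg big_nil. Qed.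

Lemma wdeg_cons (a : letter A) (w : word A) :
  wdeg (a :: w) = ldeg a + 1 + wdeg w.
Proof. by rewrite /wdeg big_cons. Qed.

Lemma wdeg_cat (u v : word A) : wdeg (u ++ v) = wdeg u + wdeg v.
Proof. by rewrite /wdeg big_cat. Qed.

Lemma wdeg_rcons (a : letter A) (w : word A) :
  wdeg (rcons w a) = wdeg w + (ldeg a + 1).
Proof. by rewrite -cats1 wdeg_cat wdeg_cons wdeg_nil addr0. Qed.

Definition wdegE := (wdeg_nil, wdeg_cons, wdeg_cat, wdeg_rcons).

End WordDegree.

Ltac ksign := rewrite ?scalerA -?koszulD; congr (_ *: _);
  rewrite ?wdegE /= ?wdegE; parity.

Notation "f $ w" := (cochain_letter f w) (at level 10, w at level 9).

(** * Insertions in a word *)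

Section Insertion.
Variables (F : fieldType) (A : dgAlgebra F).
Local Notation word := (@word F A).
Local Notation CA := (cochain (regular A)).

Variable V : lmodType F.
Implicit Types (K X : word -> V) (u v w y z : word).

(** The value on w of K composed with the coderivation of the tensor coalgebra
  whose corestriction is the cochain h. *)
Definition ins p (h : CA p) K w : V :=
  split3 w (fun u v z => koszul ((p + 1) * wdeg u) *: K (u ++ h $ v :: z)).

Lemma insD p (h : CA p) K K' w :
  ins h (fun y => K y + K' y) w = ins h K w + ins h K' w.
Proof. by rewrite -split3D; apply: eq_split3 => u v z _; rewrite scalerDr. Qed.

Lemma insZ p (h : CA p) c K w :
  ins h (fun y => c *: K y) w = c *: ins h K w.
Proof.
by rewrite -split3Z; apply: eq_split3 => u v z _; rewrite !scalerA mulrC.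
Qed.

Lemma wdeg_ins p (h : CA p) u v z :
  wdeg (u ++ h $ v :: z) = wdeg (u ++ v ++ z) + (p + 1).
Proof. by rewrite !wdegE /=; ring. Qed.

Lemma eq_ins p (h : CA p) K K' w :
  (forall y, wdeg y = wdeg w + (p + 1) -> K y = K' y) -> ins h K w = ins h K' w.
Proof.
move=> e; apply: eq_split3 => u v z ew; congr (_ *: _).
by apply: e; rewrite wdeg_ins ew.
Qed.

Lemma ins_split2 p (h : CA p) (K : word -> word -> V) w :
  ins h (fun y => split2 y K) w =
  split2 w (fun u v => ins h (fun y => K y v) u) +
  split2 w (fun u v => koszul ((p + 1) * wdeg u) *: ins h (K u) v).
Proof.
rewrite /ins.
transitivity (
    split3 w (fun u v z => split2 z (fun z1 z2 =>
      koszul ((p + 1) * wdeg u) *: K (u ++ h $ v :: z1) z2)) +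
    split3 w (fun u v z => split2 u (fun u1 u2 =>
      koszul ((p + 1) * wdeg (u1 ++ u2)) *: K u1 (u2 ++ h $ v :: z)))).
  rewrite -split3D; apply: eq_split3 => u v z _.
  rewrite split2_ins scalerDr addrC -!split2Z; congr (_ + _).
  by apply: eq_split2 => u1 u2 ->.
rewrite -split23_1 split32_1; congr (_ + _).
apply: eq_split2 => u r _; rewrite -split3Z; apply: eq_split3 => u2 v z _.
rewrite scalerA -koszulD; congr (_ *: _).
by rewrite wdeg_cat; parity.
Qed.

Lemma ins_mark p (h : CA p) K z a y :
  ins h K (z ++ a :: y) =
  ins h (fun z' => K (z' ++ a :: y)) z +
  koszul ((p + 1) * (wdeg z + ldeg a + 1)) *: ins h (fun y' => K (z ++ a :: y')) y +
  split2 z (fun z1 z2 => split2 y (fun y1 y2 =>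
    koszul ((p + 1) * wdeg z1) *: K (z1 ++ h $ (z2 ++ a :: y1) :: y2))).
Proof.
rewrite {1}/ins /split3 split2_ins addrAC; congr (_ + _).
  rewrite -split2D; apply: eq_split2 => z1 z2 _; rewrite split2_ins.
  congr (_ + _); apply: eq_split2 => z21 z22 _.
  by rewrite -catA.
rewrite -split2Z; apply: eq_split2 => y1 r _.
rewrite -split2Z; apply: eq_split2 => y2 y3 _.
rewrite scalerA -koszulD -catA; congr (_ *: _).
by rewrite !wdegE; parity.
Qed.

(** The composite coderivation in which g is inserted inside an argument of h,
  with h outermost. *)
Definition nest p q (h : CA p) (g : CA q) K w : V :=
  split3 w (fun u v z => koszul ((p + 1 + (q + 1)) * wdeg u) *:
    ins g (fun y => K (u ++ h $ y :: z)) v).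

Definition ins_pair p q (h : CA p) (g : CA q) K w : V :=
  split3 w (fun u v z =>
    koszul ((p + 1) * wdeg u + (q + 1) * (wdeg u + wdeg v)) *:
    ins g (fun y => K (u ++ h $ v :: y)) z).

(** The second insertion either swallows the letter produced by the first, or
  takes place on one of the two sides of it. *)
Lemma ins_ins p q (h : CA p) (g : CA q) K w :
  ins g (ins h K) w = nest h g K w +
    (ins_pair h g K w + koszul ((p + 1) * (q + 1)) *: ins_pair g h K w).
Proof.
transitivity (
  split3 w (fun u v z => koszul ((q + 1) * wdeg u) *:
     ins h (fun y => K (y ++ g $ v :: z)) u) +
  split3 w (fun u v z => koszul ((q + 1) * wdeg u) *:
     (koszul ((p + 1) * (wdeg u + ldeg (g $ v) + 1)) *:
       ins h (fun y => K (u ++ g $ v :: y)) z)) +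
  split3 w (fun u v z => split2 u (fun u1 u2 => split2 z (fun z1 z2 =>
     koszul ((q + 1) * wdeg (u1 ++ u2)) *:
     (koszul ((p + 1) * wdeg u1) *: K (u1 ++ h $ (u2 ++ g $ v :: z1) :: z2)))))).
  rewrite -!split3D; apply: eq_split3 => u v z _.
  rewrite ins_mark !scalerDr; congr (_ + _).
  rewrite -!split2Z; apply: eq_split2 => u1 u2 ->.
  by rewrite -!split2Z.
rewrite addrC; congr (_ + _).
  transitivity (split3 w (fun u v z => split3 v (fun v1 v2 v3 =>
     koszul ((p + 1 + (q + 1)) * wdeg u + (q + 1) * wdeg v1) *:
     K (u ++ h $ (v1 ++ g $ v2 :: v3) :: z)))); last first.
    apply: eq_split3 => u v z _; rewrite /ins -split3Z.
    by apply: eq_split3 => v1 v2 v3 _; ksign.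
  rewrite split322 split33_2.
  by do 2!(apply: eq_split3 => ? ? ? _); ksign.
congr (_ + _).
  transitivity (split3 w (fun u v z => split3 u (fun u1 u2 u3 =>
    koszul ((q + 1) * wdeg (u1 ++ u2 ++ u3) + (p + 1) * wdeg u1) *:
     K (u1 ++ h $ u2 :: u3 ++ g $ v :: z)))).
    apply: eq_split3 => u v z _; rewrite -split3Z.
    apply: eq_split3 => u1 u2 u3 ->; rewrite -!catA /=; ksign.
  rewrite split33_1; apply: eq_split3 => u v r _; rewrite -split3Z.
  by apply: eq_split3 => ? ? ? _; ksign.
rewrite -split3Z; apply: eq_split3 => ? ? ? _; ksign.
Qed.

(** Inserting two cochains in either order differs only by inserting one of
  them inside the other: this is the pre-Lie identity of the circle product. *)
Lemma ins_comm p q (h : CA p) (g : CA q) K w :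
  ins g (ins h K) w - nest h g K w =
  koszul ((p + 1) * (q + 1)) *: (ins h (ins g K) w - nest g h K w).
Proof.
rewrite !ins_ins !(addrC (nest _ _ _ _)) !addrK scalerDr scalerA -koszulD.
rewrite addrC; congr (_ + _); rewrite -[LHS]scale1r -koszul0.
by congr (_ *: _); parity.
Qed.

End Insertion.

(** * Multilinearity and the structure cochain *)

Section Slots.
Variables (F : fieldType) (A : dgAlgebra F) (V : lmodType F).
Local Notation word := (@word F A).
Local Notation CA := (cochain (regular A)).
Implicit Types (phi : letter A -> V) (X : word -> V).

Definition letter_linear phi : Prop :=
  forall c x y z, letter_comb c x y z -> phi z = c *: phi x + phi y.

Definition mlinear X : Prop := forall u v, letter_linear (fun x => X (u ++ x :: v)).

Lemma letter_linear0 phi x : letter_linear phi -> lval x = 0 -> phi x = 0.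
Proof.
move=> lin x0; have h : letter_comb (- 1) x x x.
  by split=> //; rewrite x0 scaler0 addr0.
by rewrite (lin _ _ _ _ h) scaleN1r addNr.
Qed.

Lemma letter_linearZ phi c x y : letter_linear phi ->
  ldeg x = ldeg y -> lval y = c *: lval x -> phi y = c *: phi x.
Proof.
move=> lin xy vy; pose z := Letter (gr_zero A (ldeg y)).
rewrite (lin c x z y) 1?(letter_linear0 (x := z)) ?addr0 //.
by split=> //=; rewrite addr0.
Qed.

(** Letters carry a degree, so they cannot be added; through this map a
  letter-linear expression is evaluated at sums of elements of one degree. *)
Definition on_degree phi n (a : A) : V :=
  if boolP (a \in dga_gr A n) is AltTrue h then phi (Letter h) else 0.

Lemma on_degreeE phi n x : ldeg x = n -> on_degree phi n (lval x) = phi x.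
Proof.
move=> <-; rewrite /on_degree; case: {-}_ / boolP => [h|]; last by rewrite lvalP.
by congr phi; apply: letter_eq.
Qed.

Lemma on_degree_comb phi n c a b : letter_linear phi ->
  a \in dga_gr A n -> b \in dga_gr A n ->
  on_degree phi n (c *: a + b) = c *: on_degree phi n a + on_degree phi n b.
Proof.
move=> lin an bn; have abn : c *: a + b \in dga_gr A n.
  by case: (dga_gr_submod A n) => _; apply.
rewrite -[c *: a + b]/(lval (Letter abn)) -[a]/(lval (Letter an)).
rewrite -{2}[b]/(lval (Letter bn)) !on_degreeE //.
by apply: lin.
Qed.

Lemma gr_split2 (T : Type) (w : seq T) n (K : seq T -> seq T -> A) :
  (forall u v, w = u ++ v -> K u v \in dga_gr A n) ->
  split2 w K \in dga_gr A n.
Proof.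
have [z0 lc] := dga_gr_submod A n.
move=> h; rewrite /split2; elim/big_rec: _ => // i x _ xn.
by rewrite -[K _ _]scale1r; apply: lc => //; apply: h; rewrite cat_take_drop.
Qed.

Lemma gr_split3 (T : Type) (w : seq T) n (K : seq T -> seq T -> seq T -> A) :
  (forall u v z, w = u ++ v ++ z -> K u v z \in dga_gr A n) ->
  split3 w K \in dga_gr A n.
Proof.
move=> h; apply: gr_split2 => u r e1; apply: gr_split2 => v z e2.
by apply: h; rewrite e1 e2.
Qed.

Lemma on_degree_split2 (T : Type) (w : seq T) phi n (K : seq T -> seq T -> A) :
  letter_linear phi -> (forall u v, w = u ++ v -> K u v \in dga_gr A n) ->
  on_degree phi n (split2 w K) = split2 w (fun u v => on_degree phi n (K u v)).
Proof.
move=> lin h; have [z0 lc] := dga_gr_submod A n.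
have h' i : K (take i w) (drop i w) \in dga_gr A n.
  by apply: h; rewrite cat_take_drop.
have on0 : on_degree phi n 0 = 0.
  by rewrite -[0]/(lval (Letter z0)) on_degreeE // (letter_linear0 lin).
rewrite /split2; elim: (index_iota _ _) => [|i r IH]; first by rewrite !big_nil.
rewrite !big_cons -IH -[K _ _ in LHS]scale1r on_degree_comb ?scale1r //.
elim: {IH} r => [|j r IH]; first by rewrite big_nil.
by rewrite big_cons -[K _ _]scale1r; apply: lc.
Qed.

Lemma on_degree_split3 (T : Type) (w : seq T) phi n
    (K : seq T -> seq T -> seq T -> A) :
  letter_linear phi ->
  (forall u v z, w = u ++ v ++ z -> K u v z \in dga_gr A n) ->
  on_degree phi n (split3 w K) =
  split3 w (fun u v z => on_degree phi n (K u v z)).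
Proof.
move=> lin h; rewrite on_degree_split2 // => [|u r e1]; last first.
  by apply: gr_split2 => v z e2; apply: h; rewrite e1 e2.
apply: eq_split2 => u r e1; rewrite on_degree_split2 // => v z e2.
by apply: h; rewrite e1 e2.
Qed.

Lemma circE p q (f : CA p) (g : CA q) w :
  circ f g w = ins g (fun y => f y : A) w.
Proof.
apply: eq_bigr => i _; rewrite /split2 size_drop; exact: eq_bigr.
Qed.

Lemma gr_letter_ins p q (f : CA p) (g : CA q) u v z :
  (f (u ++ g $ v :: z) : A) \in dga_gr A (p + q + 1 + wdeg (u ++ v ++ z)).
Proof.
have := proj2 (cochainP f) (u ++ g $ v :: z).
rewrite wdeg_ins; congr (_ \in dga_gr A _); ring.
Qed.

Lemma gr_circ p q (f : CA p) (g : CA q) w :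
  circ f g w \in dga_gr A (p + q + 1 + wdeg w).
Proof.
rewrite circE; apply: gr_split3 => u v z ->.
have [_ lc] := dga_gr_submod A (p + q + 1 + wdeg (u ++ v ++ z)).
by rewrite -[_ *: _]addr0; apply: lc; [exact: gr_letter_ins | exact: gr_zero].
Qed.

(** The circle product takes values in A, not in the letters; this turns it into
  an insertion inside an arbitrary linear expression. *)
Lemma ins_slot p q (f : CA p) (g : CA q) phi w : letter_linear phi ->
  ins g (fun y => phi (f $ y)) w =
  on_degree phi (p + q + 1 + wdeg w) (circ f g w).
Proof.
move=> lin; rewrite circE on_degree_split3 // => [|u v z ->]; last first.
  have [_ lc] := dga_gr_submod A (p + q + 1 + wdeg (u ++ v ++ z)).
  by rewrite -[_ *: _]addr0; apply: lc; [exact: gr_letter_ins | exact: gr_zero].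
apply: eq_split3 => u v z e.
rewrite -[_ *: f _]addr0 on_degree_comb ?gr_zero //; last first.
  by rewrite e; exact: gr_letter_ins.
rewrite -[0 in RHS]/(lval (Letter (gr_zero A (p + q + 1 + wdeg w)))) !on_degreeE //.
rewrite [X in _ = _ + X](letter_linear0 lin) // addr0.
by rewrite -[f _]/(lval (f $ (u ++ g $ v :: z))) on_degreeE //= e wdeg_ins; ring.
Qed.

End Slots.

Section StructureCochain.
Variables (F : fieldType) (A : dgAlgebra F).
Local Notation word := (@word F A).

(** The sign comes from the suspension of the first argument. *)
Definition mu_fun (w : word) : regular A :=
  match w with
  | [:: a] => dga_d A (lval a)
  | [:: a; b] => koszul (ldeg a) *: dga_mul A (lval a) (lval b)
  | _ => 0
  end.

Lemma mu_cochain : is_cochain (-2) mu_fun.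
Proof.
split=> [c u v x y z xyz|w].
  have [xz yz vz] := xyz.
  case: u => [|a [|b [|e u]]] /=; case: v => [|a' [|b' v]] /=;
   rewrite ?scaler0 ?addr0 //.
  - by rewrite vz dga_d_linear.
  - by rewrite vz xz yz dga_mul_linearl scalerDr !scalerA mulrC.
  - by rewrite vz dga_mul_linearr scalerDr !scalerA mulrC.
have z0 n : (0 : A) \in dga_gr A n by exact: gr_zero.
case: w => [|a [|b [|c w]]] //=.
  have := dga_gr_d (lvalP a); congr (_ \in dga_gr A _).
  by rewrite !wdegE; ring.
have [_ lc] := dga_gr_submod A (-2 + wdeg [:: a; b]).
rewrite -[_ *: _]addr0; apply: lc => //.
have := dga_grM (lvalP a) (lvalP b); congr (_ \in dga_gr A _).
by rewrite !wdegE; ring.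
Qed.

(** The differential and the product of A, in suspended form. Its coderivation
  is the differential of the bar construction, and the Hochschild differential
  is the commutator with it. *)
Definition mu : cochain (regular A) (-2) := Cochain mu_cochain.

End StructureCochain.
Arguments mu {F A}.

(** * The Hochschild differential *)

Section Differential.
Variables (F : fieldType) (A : dgAlgebra F).
Local Notation word := (@word F A).
Local Notation CA := (cochain (regular A)).

Lemma mlinmap0 (V : lmodType F) (X : word -> V) u x v :
  mlinear X -> lval x = 0 -> X (u ++ x :: v) = 0.
Proof. by move=> lin; exact: (letter_linear0 (lin u v)). Qed.

Lemma cochain_mlinear (N : dgBimodule A) p (f : cochain N p) : mlinear f.
Proof. by move=> u v c x y z h; apply: (proj1 (cochainP f)). Qed.

Definition mu_term1 (V : lmodType F) (X : word -> V) u r : V :=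
  head_case r 0 (fun a z => koszul (wdeg u) *: X (u ++ mu $ [:: a] :: z)).

Definition mu_term2 (V : lmodType F) (X : word -> V) u r : V :=
  head_case r 0 (fun a r' => head_case r' 0 (fun b z =>
    koszul (wdeg u) *: X (u ++ mu $ [:: a; b] :: z))).

Lemma ins_muE (V : lmodType F) (X : word -> V) w : mlinear X ->
  ins mu X w = split2 w (mu_term1 X) + split2 w (mu_term2 X).
Proof.
move=> lin; rewrite -split2D; apply: eq_split2 => u r _.
have z0 v z : mu_fun v = 0 ->
    koszul ((-2 + 1) * wdeg u) *: X (u ++ mu $ v :: z) = 0.
  by move=> v0; rewrite mlinmap0 ?scaler0.
have sg x : koszul ((-2 + 1) * wdeg u) *: x = koszul (wdeg u) *: x :> V.
  by ksign.
rewrite /mu_term1 /mu_term2.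
case: r => [|a [|b r]].
- by rewrite split2_nil z0 // addr0.
- by rewrite split2_cons split2_nil z0 // add0r addr0 sg.
rewrite !split2_cons z0 // add0r !sg; congr (_ + _).
by rewrite split2_nil1 ?sg // => c u' v; rewrite z0.
Qed.

Variable N : dgBimodule A.
Implicit Types (p : int) (f : word -> bim_sort N).

Definition outer_l p f w : N := head_case w 0 (fun a v =>
  - (koszul ((ldeg a + 1) * p) *: bim_l N a (p + wdeg v) (f v))).

Definition outer_r p f w : N := last_case w 0 (fun u a =>
  koszul (p + wdeg u) *: bim_r N (p + wdeg u) (f u) a).

(** The inner terms of the differential are those of the differential of the bar
  construction; the action of the two outer letters is what is left. *)
Lemma hochDE p f w : mlinear f ->
  hochD p f w = bim_d N (p + wdeg w) (f w) + koszul p *: ins mu f w +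
    outer_l p f w + outer_r p f w.
Proof.
move=> lin; rewrite ins_muE // /hochD fctE.
have -> : hochD0 p f w =
    bim_d N (p + wdeg w) (f w) + koszul p *: split2 w (mu_term1 f).
  congr (_ + _); rewrite -sumrN /split2 big_nat_recr //= drop_size addr0.
  rewrite scaler_sumr; apply: eq_big_nat => i /andP[_ iw].
  rewrite (drop_nth letter0 iw) /= -scaleNr scalerA -koszulD.
  rewrite (letter_linearZ (lin _ _) (x := mu $ [:: nth letter0 w i]) (c := -1)).
  - by rewrite scalerA mulrN1 opprK.
  - by rewrite /= wdegE wdeg_nil; ring.
  - by rewrite /= scaleN1r.
rewrite /outer_l /outer_r.
case: w => [|a v]; first by rewrite !split2_nil /hochD1 /last_case /= !addr0.
rewrite /hochD1 scalerDr !addrA; congr (_ + _).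
  rewrite -[RHS]addrA [X in _ = _ + X]addrC !addrA; congr (_ + _).
  have -> : split2 (a :: v) (mu_term2 f) = \sum_(0 <= i < size v)
      mu_term2 f (take i (a :: v)) (drop i (a :: v)).
    rewrite /split2 /= (big_nat_recr (size v).+1) //= (big_nat_recr (size v)) //=.
    rewrite drop_size addr0 (drop_nth letter0) //= drop_oversize //.
    by rewrite /mu_term2 /= addr0.
  rewrite -sumrN big_add1 /= scaler_sumr; apply: eq_big_nat => i /andP[_ iv].
  have ia : (i < size (a :: v))%N by rewrite ltnS ltnW.
  rewrite (drop_nth letter0 ia) [drop i.+1 (a :: v)]/= (drop_nth letter0 iv).
  rewrite /mu_term2 /= -scaleNr scalerA -koszulD.
  rewrite -[a :: take i v]/(take i.+1 (a :: v)) (take_nth letter0 ia) wdeg_rcons.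
  set u := take i _; set b := nth letter0 (a :: v) i; set c := nth letter0 v i.
  rewrite (letter_linearZ (lin _ _) (x := mu $ [:: b; c]) (c := koszul (ldeg b))).
  - by rewrite -mulN1r -koszul1 -koszulD; ksign.
  - by rewrite /= !wdegE; ring.
  - by rewrite /= scalerA -koszulD (_ : koszul _ = 1) ?scale1r // -koszul0; parity.
rewrite lastI last_case_rcons.
have -> : take (size v) (rcons (belast a v) (last a v)) = belast a v.
  by rewrite -cats1 take_size_cat // size_belast.
by [].
Qed.

End Differential.

Lemma split3_collapse (T : Type) (F : fieldType) (V : lmodType F) (w : seq T)
    (L : seq T -> seq T -> seq T -> V) :
  (forall u v z, (1 < size u + size z)%N -> L u v z = 0) ->
  split3 w L = L [::] w [::] + head_case w 0 (fun a v => L [:: a] v [::]) +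
    last_case w 0 (fun v b => L [::] v [:: b]).
Proof.
move=> L0; rewrite /split3; case: w => [|a w].
  by rewrite !split2_nil /last_case /= !addr0.
rewrite split2_cons -addrA [X in _ = _ + X]addrC addrA; congr (_ + _).
  rewrite lastI last_case_rcons split2_rcons addrC split2_nil2 // => c u v.
  by rewrite L0 // size_rcons size_rcons.
rewrite split2_nil1 => [|c u v]; first by rewrite split2_nil2 // => c u v;
  rewrite L0 // size_rcons.
by rewrite split2_0 // => u' v' _; rewrite L0.
Qed.

Section RegularDifferential.
Variables (F : fieldType) (A : dgAlgebra F).
Local Notation word := (@word F A).
Local Notation CA := (cochain (regular A)).

Lemma circ_ins p q (f : CA p) (g : CA q) w :
  circ f g w = ins (V := regular A) g f w :> regular A.
Proof. exact: circE. Qed.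

Lemma mu_fun0 (w : word) : (2 < size w)%N -> mu_fun w = 0.
Proof. by case: w => [|a [|b [|c w]]]. Qed.

Lemma circ_muE p (f : CA p) w : circ mu f w =
  bim_d (regular A) (p + wdeg w) (f w) + outer_l p f w + outer_r p f w :> regular A.
Proof.
rewrite circ_ins /ins split3_collapse => [|u v z]; last first.
  by move=> uz; rewrite /= mu_fun0 ?scaler0 // size_cat /= addnS ltnS.
congr (_ + _ + _).
- by rewrite wdeg_nil mulr0 koszul0 scale1r.
- case: w => //= a v; rewrite /outer_l /= -scaleNr -mulN1r -koszul1 -koszulD; ksign.
case/lastP: w => // v b; rewrite /outer_r !last_case_rcons /=; ksign.
Qed.

(** For values in A the differential of A and the two outer terms are insertions
  into the structure cochain, and the other terms are insertions of it. *)
Lemma hochD_regular p (f : CA p) w :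
  hochD p f w = circ mu f w + koszul p *: circ f mu w.
Proof.
rewrite hochDE; last exact: cochain_mlinear.
by rewrite circ_muE circ_ins -!addrA; congr (_ + _); rewrite addrC -!addrA.
Qed.

(** The cocycle condition compares circ mu f with circ f mu; a linear slot turns
  both into insertions. *)
Lemma ins_mu_cocycle (V : lmodType F) p (f : CA p) (phi : letter A -> V) w :
  hochD p f = 0 -> letter_linear phi ->
  ins f (fun y => phi (mu $ y)) w =
  koszul (p + 1) *: ins mu (fun y => phi (f $ y)) w.
Proof.
move=> fD lin; rewrite !ins_slot //.
have -> : circ mu f w = koszul (p + 1) *: circ f mu w.
  have := congr1 (fun h => h w) fD; rewrite hochD_regular => /eqP.
  by rewrite addr_eq0 -scaleNr => /eqP ->; rewrite koszulD koszul1 mulrN1.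
have -> : -2 + p + 1 + wdeg w = p + -2 + 1 + wdeg w by ring.
have cn := gr_circ f mu w; have z0 := gr_zero A (p + -2 + 1 + wdeg w).
rewrite -[_ *: circ _ _ _]addr0 on_degree_comb //.
rewrite -[0 in LHS]/(lval (Letter z0)) [X in _ + X]on_degreeE //.
by rewrite (letter_linear0 lin) ?addr0.
Qed.

End RegularDifferential.

(** * The action of cochains *)

Section LinearityClosure.
Variables (F : fieldType) (A : dgAlgebra F) (V : lmodType F).
Local Notation word := (@word F A).
Local Notation CA := (cochain (regular A)).
Implicit Types (X : word -> V).

Lemma letter_comb_wdeg c (x y z : letter A) u v : letter_comb c x y z ->
  wdeg (u ++ x :: v) = wdeg (u ++ z :: v) /\
  wdeg (u ++ y :: v) = wdeg (u ++ z :: v).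
Proof. by case=> xz yz _; rewrite !wdegE xz yz. Qed.

Lemma letter_comb_cochain p (f : CA p) c x y z u v : letter_comb c x y z ->
  letter_comb c (f $ (u ++ x :: v)) (f $ (u ++ y :: v)) (f $ (u ++ z :: v)).
Proof.
move=> h; have [ex ey] := letter_comb_wdeg u v h.
by split; rewrite /= ?ex ?ey //; apply: (proj1 (cochainP f)).
Qed.

Lemma mlinear_scale X (s : word -> F) : mlinear X ->
  (forall y z, wdeg y = wdeg z -> s y = s z) -> mlinear (fun w => s w *: X w).
Proof.
move=> lin hs u v c x y z h; have [ex ey] := letter_comb_wdeg u v h.
by rewrite (hs _ _ ex) (hs _ _ ey) (lin _ _ _ _ _ _ h) scalerDr !scalerA mulrC.
Qed.

Lemma mlinearD X Y : mlinear X -> mlinear Y -> mlinear (fun w => X w + Y w).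
Proof.
move=> lX lY u v c x y z h.
by rewrite (lX _ _ _ _ _ _ h) (lY _ _ _ _ _ _ h) scalerDr addrACA.
Qed.

Lemma mlinear_split2 (K : word -> word -> V) :
  (forall v, mlinear (K^~ v)) -> (forall u, mlinear (K u)) ->
  mlinear (fun w => split2 w K).
Proof.
move=> l1 l2 s t c x y z h; rewrite !split2_ins scalerDr -addrACA -!split2Z.
rewrite -!split2D; congr (_ + _); apply: eq_split2 => u v _.
  by rewrite (l2 _ _ _ _ _ _ _ h).
by rewrite (l1 _ _ _ _ _ _ _ h).
Qed.

Lemma mlinear_split3 (K : word -> word -> word -> V) :
  (forall v z, mlinear (fun u => K u v z)) ->
  (forall u z, mlinear (fun v => K u v z)) ->
  (forall u v, mlinear (K u v)) -> mlinear (fun w => split3 w K).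
Proof.
move=> l1 l2 l3; apply: mlinear_split2 => [r s t c x y z h|u].
  rewrite -split2Z -split2D; apply: eq_split2 => v v' _.
  exact: (l1 _ _ _ _ _ _ _ _ h).
by apply: mlinear_split2 => // z; apply: l2.
Qed.

Lemma mlinear_slot p (f : CA p) (phi : letter A -> V) :
  letter_linear phi -> mlinear (fun w => phi (f $ w)).
Proof.
by move=> lin u v c x y z h; apply: lin; apply: letter_comb_cochain.
Qed.

Lemma mlinear_left X z : mlinear X -> mlinear (fun u => X (u ++ z)).
Proof. by move=> lin u v c x y t h; rewrite -!catA; apply: (lin u (v ++ z)). Qed.

Lemma mlinear_ins p (h : CA p) X : mlinear X -> mlinear (ins h X).
Proof.
move=> lin; apply: mlinear_split3 => [v z|u z|u v].
- apply: (mlinear_scale (X := fun u => X (u ++ h $ v :: z))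
    (s := fun u => koszul ((p + 1) * wdeg u))); first exact: mlinear_left.
  by move=> y y' ->.
- apply: (mlinear_scale (s := fun _ => koszul _)) => //.
  by apply: (mlinear_slot h (phi := (fun x => X (u ++ x :: z)))); apply: lin.
apply: (mlinear_scale (s := fun _ => koszul _)) => // s t c x y r e.
by have := lin (u ++ h $ v :: s) t c x y r e; rewrite -!catA.
Qed.

End LinearityClosure.

Section ActionLinear.
Variables (F : fieldType) (A : dgAlgebra F) (N : dgBimodule A).
Local Notation word := (@word F A).
Local Notation CA := (cochain (regular A)).

Lemma cochain_gr p (g : cochain N p) w : g w \in bim_gr N (p + wdeg w).
Proof. exact: (proj2 (cochainP g)). Qed.

Lemma gr_cast i j (n : N) : i = j -> n \in bim_gr N i -> n \in bim_gr N j.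
Proof. by move=> ->. Qed.

Lemma bim_gr_comb i c (m n : N) : m \in bim_gr N i -> n \in bim_gr N i ->
  c *: m + n \in bim_gr N i.
Proof. by case: (bim_gr_submod N i) => _; apply. Qed.

Lemma bim_gr0 i : (0 : N) \in bim_gr N i.
Proof. by case: (bim_gr_submod N i). Qed.

Lemma bim_grZ i c (n : N) : n \in bim_gr N i -> c *: n \in bim_gr N i.
Proof.
by move=> h; rewrite -[_ *: _]addr0; apply: bim_gr_comb => //; exact: bim_gr0.
Qed.

Lemma bim_gr_split2 (T : Type) (w : seq T) n (K : seq T -> seq T -> N) :
  (forall u v, w = u ++ v -> K u v \in bim_gr N n) ->
  split2 w K \in bim_gr N n.
Proof.
move=> h; rewrite /split2; elim/big_rec: _ => [|i x _ xn]; first exact: bim_gr0.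
rewrite -[K _ _]scale1r; apply: bim_gr_comb => //; apply: h.
by rewrite cat_take_drop.
Qed.

Lemma bim_l_letter_linear j (n : N) : n \in bim_gr N j ->
  letter_linear (fun x => bim_l N x j n).
Proof. by move=> nj c x y z h; apply: bim_l_comb. Qed.

Lemma actE p q (f : CA p) (g : cochain N q) w : act f g w =
  split2 w (fun u v => koszul (q * wdeg u) *:
    bim_l N (f $ u) (q + wdeg v) (g v)).
Proof. by []. Qed.

Lemma act_cochain p q (f : CA p) (g : cochain N q) : is_cochain (p + q) (act f g).
Proof.
split.
  suff: mlinear (act f g) by move=> lin c u v x y z h; apply: lin.
  apply: (mlinear_split2 (K := fun u v => koszul (q * wdeg u) *:
    bim_l N (f $ u) (q + wdeg v) (g v))) => [v|u].
    apply: (mlinear_scale (s := fun u => koszul (q * wdeg u))) => [|y z -> //].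
    apply: (mlinear_slot f (phi := (fun x => bim_l N x _ (g v)))).
    apply: bim_l_letter_linear; exact: cochain_gr.
  apply: (mlinear_scale (s := fun _ => koszul _)) => // s t c x y z h.
  have [-> ->] := letter_comb_wdeg s t h.
  by rewrite -bim_l_linear (proj1 (cochainP g) _ _ _ _ _ _ h).
move=> w; rewrite actE; apply: bim_gr_split2 => u v ->; apply: bim_grZ.
apply: (gr_cast _ (@bim_gr_l F A N (f $ u) _ _ (cochain_gr g v))).
rewrite /= wdeg_cat; ring.
Qed.

Definition actC p q (f : CA p) (g : cochain N q) : cochain N (p + q) :=
  Cochain (act_cochain f g).

End ActionLinear.

Lemma circ_cochain (F : fieldType) (A : dgAlgebra F) p q
    (f : cochain (regular A) p) (g : cochain (regular A) q) :
  is_cochain (N := regular A) (p + q + 1) (circ f g).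
Proof.
split; last exact: gr_circ.
move=> c u v x y z h; rewrite !circ_ins; apply: mlinear_ins => //.
exact: cochain_mlinear.
Qed.

Definition circC (F : fieldType) (A : dgAlgebra F) p q
    (f : cochain (regular A) p) (g : cochain (regular A) q) :=
  Cochain (circ_cochain f g).

Section LinearMaps.
Variables (F : fieldType) (A : dgAlgebra F) (U V : lmodType F) (L : U -> V).
Hypothesis lin : linear L.

Lemma linmap0 : L 0 = 0.
Proof. by have := lin (-1) 0 0; rewrite !scaleN1r !addNr. Qed.

Lemma linmapZ c x : L (c *: x) = c *: L x.
Proof. by rewrite -[c *: x]addr0 lin linmap0 addr0. Qed.

Lemma linmapD x y : L (x + y) = L x + L y.
Proof. by rewrite -[x in LHS]scale1r lin scale1r. Qed.

Lemma split2_map (T : Type) (w : seq T) (K : seq T -> seq T -> U) :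
  L (split2 w K) = split2 w (fun u v => L (K u v)).
Proof.
rewrite /split2; elim: (index_iota _ _) => [|i r IH].
  by rewrite !big_nil linmap0.
by rewrite !big_cons linmapD IH.
Qed.

Lemma ins_map p (h : cochain (regular A) p) (K : word A -> U) w :
  L (ins h K w) = ins h (fun y => L (K y)) w.
Proof.
rewrite split2_map; apply: eq_split2 => u r _; rewrite split2_map.
by apply: eq_split2 => v z _; rewrite linmapZ.
Qed.

End LinearMaps.

Section ActionLeibniz.
Variables (F : fieldType) (A : dgAlgebra F).
Local Notation word := (@word F A).
Local Notation CA := (cochain (regular A)).

Lemma split3_mu (V : lmodType F) p (f : CA p) (phi : letter A -> V) u :
  letter_linear phi -> ins f (fun y => phi (mu $ y)) u =
    phi (ld (f $ u)) +
    head_case u 0 (fun a v =>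
      koszul ((p + 1) * (ldeg a + 1) + ldeg a) *: phi (lmul a (f $ v))) +
    last_case u 0 (fun v b => koszul (p + wdeg v) *: phi (lmul (f $ v) b)).
Proof.
move=> lin; rewrite /ins split3_collapse => [|x v z uz]; last first.
  rewrite (letter_linear0 lin) ?scaler0 //= mu_fun0 // size_cat /= addnS ltnS //.
congr (_ + _ + _).
- rewrite wdeg_nil mulr0 koszul0 scale1r; congr phi; apply: letter_eq => //=.
  by rewrite !wdegE /=; ring.
- case: u => //= a v; rewrite koszulD -scalerA wdeg_cons wdeg_nil addr0.
  congr (_ *: _); apply: (letter_linearZ lin) => //=.
  by rewrite !wdegE /=; ring.
case/lastP: u => // v b; rewrite !last_case_rcons wdeg_nil mulr0 koszul0 scale1r.
by apply: (letter_linearZ lin) => //=; rewrite !wdegE /=; ring.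
Qed.

Lemma slot_hochD (V : lmodType F) p p' (f : CA p) (f' : CA p')
    (phi : letter A -> V) u :
  (forall w, f' w = hochD p f w) -> p' = p - 1 -> letter_linear phi ->
  phi (f' $ u) =
    phi (ld (f $ u)) +
    head_case u 0 (fun a v =>
      koszul ((p + 1) * (ldeg a + 1) + ldeg a) *: phi (lmul a (f $ v))) +
    last_case u 0 (fun v b => koszul (p + wdeg v) *: phi (lmul (f $ v) b)) +
    koszul p *: ins mu (fun y => phi (f $ y)) u.
Proof.
move=> fD pe lin; rewrite -split3_mu // !ins_slot //.
have -> : -2 + p + 1 + wdeg u = p' + wdeg u by rewrite pe; ring.
have e : p + -2 + 1 + wdeg u = p' + wdeg u by rewrite pe; ring.
have h1 : circ f mu u \in dga_gr A (p' + wdeg u) by rewrite -e; exact: gr_circ.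
have h2 : circ mu f u \in dga_gr A (p' + wdeg u).
  by have := gr_circ mu f u; congr (_ \in dga_gr A _); rewrite pe; ring.
rewrite e [RHS]addrC -on_degree_comb //.
rewrite -(@on_degreeE _ _ _ phi (p' + wdeg u) (f' $ u)) //=; congr (on_degree _ _ _).
by rewrite /= fD hochD_regular addrC.
Qed.

Variable N : dgBimodule A.

(** The action is therefore defined on cohomology. *)
Lemma act_leibniz p q p' q' (f : CA p) (g : cochain N q) (f' : CA p')
    (g' : cochain N q') w :
  (forall w, f' w = hochD p f w) -> (forall w, g' w = hochD q g w) ->
  p' = p - 1 -> q' = q - 1 ->
  hochD (p + q) (act f g) w = act f' g w + koszul p *: act f g' w.
Proof.
move=> fD gD pe qe; subst q'.
have gq v : g v \in bim_gr N (q + wdeg v) by exact: cochain_gr.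
pose J u v := bim_l N (f $ u) (q + wdeg v) (g v).
pose T1 := split2 w (fun u v => koszul (q * wdeg u) *:
  bim_l N (ld (f $ u)) (q + wdeg v) (g v)).
pose T2 := split2 w (fun u v => koszul (q * wdeg u + (p + wdeg u)) *:
  bim_l N (f $ u) (q - 1 + wdeg v) (bim_d N (q + wdeg v) (g v))).
pose T3 := split2 w (fun u v => koszul (p + q * wdeg u) *: ins mu (J^~ v) u).
pose T4 := split2 w (fun u v => koszul (p + q + (q - 1) * wdeg u) *:
   ins mu (J u) v).
pose T5 := split2 w (fun u v => koszul (q * wdeg u) *:
   head_case u 0 (fun a u' => koszul ((p + 1) * (ldeg a + 1) + ldeg a) *:
     bim_l N (lmul a (f $ u')) (q + wdeg v) (g v))).
pose T6 := split2 w (fun u v => koszul (p + (q - 1) * wdeg u) *: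
   last_case v 0 (fun v' b => koszul (q + wdeg v') *:
     bim_l N (f $ u) (q + wdeg v' + ldeg b) (bim_r N (q + wdeg v') (g v') b))).
pose G u a v := koszul (p + (q - 1) * wdeg u + (ldeg a + 1) * q) *:
     bim_l N (lmul (f $ u) a) (q + wdeg v) (g v).
(* In the product of Df and g, and in that of f and Dg, the terms in which the
  middle letter multiplies the value of f, respectively g, cancel. *)
pose T7 := split2 w (fun u v => head_case v 0 (G u)).
have -> : act f' g w = T1 + T5 + T7 + T3.
  rewrite actE /T7 -split2_move -!split2D; apply: eq_split2 => u v _.
  rewrite (slot_hochD (phi := fun x => bim_l N x (q + wdeg v) (g v)) u fD pe);
    last exact: bim_l_letter_linear.
  rewrite !scalerDr; congr (_ + _ + _ + _); last by ksign.
  case/lastP: u => [|u a]; first by rewrite !last_case_nil scaler0.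
  by rewrite !last_case_rcons /G; ksign.
have -> : koszul p *: act f g' w = T2 + T4 - T7 + T6.
  rewrite actE -split2Z -scaleN1r /T7 -split2Z -!split2D.
  apply: eq_split2 => u v _.
  have lin := @bim_l_linear F A N (f $ u) (q - 1 + wdeg v).
  rewrite gD hochDE; last exact: cochain_mlinear.
  rewrite !(linmapD lin) (linmapZ lin) !scalerDr; congr (_ + _ + _ + _).
  - by ksign.
  - rewrite (ins_map lin) (@eq_ins _ _ _ _ mu _ (J u)) => [|y ey]; first by ksign.
    by rewrite /J ey; congr (bim_l _ _ _ _); ring.
  - case: v {lin} => [|a v] /=.
      by rewrite (linmap0 (@bim_l_linear _ _ _ _ _)) !scaler0.
    have lin := @bim_l_linear F A N (f $ u) (q - 1 + wdeg (a :: v)).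
    rewrite -scaleNr (linmapZ lin) /G bim_lA //.
    have -> : q - 1 + wdeg (a :: v) = ldeg a + (q + wdeg v).
      by rewrite wdeg_cons; ring.
    by rewrite -[- koszul _]mulN1r -koszul1; ksign.
  case/lastP: v {lin} => [|v b].
    by rewrite /outer_r !last_case_nil (linmap0 (@bim_l_linear _ _ _ _ _)) !scaler0.
  have lin := @bim_l_linear F A N (f $ u) (q - 1 + wdeg (rcons v b)).
  rewrite /outer_r !last_case_rcons (linmapZ lin).
  have -> : q - 1 + wdeg (rcons v b) = q + wdeg v + ldeg b.
    by rewrite wdeg_rcons; ring.
  by ksign.
rewrite hochDE; last exact: (cochain_mlinear (actC f g)).
have -> : bim_d N (p + q + wdeg w) (act f g w) = T1 + T2.
  have lin := @bim_d_linear F A N (p + q + wdeg w).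
  rewrite actE (split2_map lin) -split2D; apply: eq_split2 => u v ew.
  rewrite (linmapZ lin) ew wdeg_cat.
  have -> : p + q + (wdeg u + wdeg v) = ldeg (f $ u) + (q + wdeg v).
    by rewrite /=; ring.
  rewrite bim_leibnizl // scalerDr; congr (_ + _).
  rewrite (_ : q + wdeg v - 1 = q - 1 + wdeg v); last by ring.
  by ksign.
have -> : koszul (p + q) *: ins mu (act f g) w = T3 + T4.
  rewrite (ins_split2 mu (fun u v => koszul (q * wdeg u) *: J u v)).
  rewrite -split2D -split2Z -split2D; apply: eq_split2 => u v _.
  rewrite scalerDr insZ; congr (_ + _); last by ksign.
  rewrite (@eq_ins _ _ _ _ mu _ (fun y => koszul (q * (wdeg u - 1)) *: J y v)).
    by rewrite insZ; ksign.
  by move=> y ->; congr (koszul _ *: _); ring.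
have -> : outer_l (p + q) (act f g) w = T5.
  rewrite /outer_l /T5; case: w {T1 T2 T3 T4 T6 T7 T5} => [|a w] /=.
    by rewrite split2_nil scaler0.
  have lin := @bim_l_linear F A N a (p + q + wdeg w).
  rewrite split2_cons scaler0 add0r actE (split2_map lin) -scaleNr -split2Z.
  apply: eq_split2 => u v ew; rewrite (linmapZ lin) ew wdeg_cat /=.
  have -> : p + q + (wdeg u + wdeg v) = ldeg (f $ u) + (q + wdeg v).
    by rewrite /=; ring.
  by rewrite -bim_lA // -[- koszul _]mulN1r -koszul1; ksign.
have -> : outer_r (p + q) (act f g) w = T6.
  rewrite /outer_r /T6; case/lastP: w {T1 T2 T3 T4 T6 T7 T5} => [|w b].
    by rewrite split2_nil last_case_nil scaler0.
  have lin : linear (fun n => bim_r N (p + q + wdeg w) n b) by exact: bim_r_linear.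
  rewrite last_case_rcons split2_rcons last_case_nil scaler0 addr0 actE.
  rewrite (split2_map lin) -split2Z.
  apply: eq_split2 => u v ew; rewrite (linmapZ lin) ew wdeg_cat last_case_rcons.
  have -> : p + q + (wdeg u + wdeg v) = ldeg (f $ u) + (q + wdeg v).
    by rewrite /=; ring.
  by rewrite bim_lr //; ksign.
module.
Qed.

End ActionLeibniz.

Section ActionAlgebra.
Variables (F : fieldType) (A : dgAlgebra F).
Local Notation word := (@word F A).
Local Notation CA := (cochain (regular A)).

Lemma act_slot (V : lmodType F) p q (f : CA p) (g : CA q) (phi : letter A -> V) u :
  letter_linear phi -> phi (actC f g $ u) =
  split2 u (fun u1 u2 =>
    koszul (q * wdeg u1) *: phi (lmul (f $ u1) (g $ u2))).
Proof.
move=> lin; pose n := p + q + wdeg u.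
have gn u1 u2 : u = u1 ++ u2 ->
    lval (lmul (f $ u1) (g $ u2)) \in dga_gr A n.
  move=> e; have := lvalP (lmul (f $ u1) (g $ u2)); congr (_ \in dga_gr A _).
  by rewrite /n e wdeg_cat /=; ring.
rewrite -(@on_degreeE _ _ _ phi n (actC f g $ u)) //.
rewrite -[lval (actC f g $ u)]/(act f g u) actE.
rewrite on_degree_split2 // => [|u1 u2 e].
  apply: eq_split2 => u1 u2 e; rewrite -[_ *: bim_l _ _ _ _]addr0.
  rewrite (on_degree_comb _ lin (gn _ _ e) (gr_zero A n)).
  rewrite -[0]/(lval (Letter (gr_zero A n))) !on_degreeE //=.
    by rewrite (letter_linear0 lin (x := Letter _)) ?addr0.
  by rewrite /n e wdeg_cat; ring.
have [_ lc] := dga_gr_submod A n.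
by rewrite -[_ *: _]addr0; apply: lc; [exact: gn | exact: gr_zero].
Qed.

Lemma act_assoc (N : dgBimodule A) p q r (f : CA p) (g : CA q)
    (h : cochain N r) w : act (actC f g) h w = act f (actC g h) w.
Proof.
have hr v : h v \in bim_gr N (r + wdeg v) by exact: cochain_gr.
transitivity (split2 w (fun u v => split2 u (fun u1 u2 =>
    koszul (r * wdeg (u1 ++ u2) + q * wdeg u1) *:
    bim_l N (lmul (f $ u1) (g $ u2)) (r + wdeg v) (h v)))).
  rewrite actE; apply: eq_split2 => u v _.
  rewrite (act_slot f g (phi := fun x => bim_l N x (r + wdeg v) (h v)));
    last exact: bim_l_letter_linear.
  rewrite -split2Z; apply: eq_split2 => u1 u2 ->; ksign.
rewrite split2A actE; apply: eq_split2 => u v _.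
have lin := @bim_l_linear F A N (f $ u) (q + r + wdeg v).
rewrite [actC g h v]actE (split2_map lin) -split2Z; apply: eq_split2 => v1 v2 ev.
rewrite (linmapZ lin) ev bim_lA // !wdeg_cat.
have -> : q + r + (wdeg v1 + wdeg v2) = ldeg (g $ v1) + (r + wdeg v2).
  by rewrite /=; ring.
by ksign.
Qed.

Lemma dga_d1 : dga_d A (dga_one A) = 0.
Proof.
have := dga_leibniz (dga_one A) (dga_gr1 A).
rewrite koszul0 scale1r !dga_mul1 dga_mulr1 => /eqP.
by rewrite -subr_eq0 opprD addrA subrr sub0r oppr_eq0 => /eqP.
Qed.

Lemma unit_is_cochain : is_cochain (N := regular A) 0 (@unit_cochain F A).
Proof.
split=> [c u v x y z _|w].
  by case: u => [|a u] /=; rewrite scaler0 addr0.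
case: w => [|a w] /=; last exact: gr_zero.
by rewrite wdeg_nil addr0 dga_gr1.
Qed.

Definition unitC : CA 0 := Cochain unit_is_cochain.

Lemma unit_cocycle : hochD (N := regular A) 0 unitC = 0.
Proof.
apply/funext => w; rewrite hochDE; last exact: cochain_mlinear.
have -> : ins mu unitC w = 0.
  by apply: split3_0 => u v z _; case: u => [|a u] /=; rewrite scaler0.
rewrite scaler0 addr0; case: w => [|a w].
  by rewrite /= dga_d1 add0r addr0.
have d0 : dga_d A 0 = 0 := linmap0 (@dga_d_linear F A).
rewrite /= d0 add0r lastI /outer_r last_case_rcons; case: w => [|b w] /=.
  rewrite wdeg_nil mulr0 addr0 koszul0 !scale1r dga_mulr1 dga_mul1.
  by rewrite addNr.
rewrite (linmap0 (@dga_mul_linearr F A _)) (linmap0 (@dga_mul_linearl F A _)).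
by rewrite !scaler0 oppr0 addr0.
Qed.

Lemma act_unit (N : dgBimodule A) q (g : cochain N q) w : act unitC g w = g w.
Proof.
rewrite actE split2_nil1 => [|a u v].
  rewrite wdeg_nil mulr0 koszul0 scale1r -[RHS](bim_l1 (cochain_gr g w)).
  by congr (bim_l _ _ _ _); apply: letter_eq; rewrite /= ?wdeg_nil ?addr0.
have lin := bim_l_letter_linear (cochain_gr g v).
by rewrite (letter_linear0 lin) ?scaler0.
Qed.

Lemma ins_pair_mu p q (f : CA p) (g : CA q) w :
  ins_pair f g (mu : word -> regular A) w = koszul p *: act f g w.
Proof.
have mu0 u v z1 z2 z3 : (0 < size u + size z1 + size z3)%N ->
    mu (u ++ f $ v :: z1 ++ g $ z2 :: z3) = 0.
  move=> h; rewrite /= mu_fun0 //= size_cat /= size_cat /= !addnS !ltnS.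
  by rewrite addnA.
rewrite /ins_pair /split3 split2_nil1 => [|a u r]; last first.
  apply: split2_0 => v z _; rewrite /ins split3_0 ?scaler0 // => z1 z2 z3 _.
  by rewrite mu0 ?scaler0.
rewrite actE -split2Z; apply: eq_split2 => v z _.
rewrite /ins /split3 split2_nil1 => [|a z1 r]; last first.
  by apply: split2_0 => z2 z3 _; rewrite mu0 ?scaler0.
rewrite split2_nil2 => [|a z2 z3].
  by rewrite /=; ksign.
by rewrite (mu0 [::] v [::]) ?scaler0 // size_rcons.
Qed.

End ActionAlgebra.
Arguments unitC {F A}.

Section CircSlots.
Variables (F : fieldType) (A : dgAlgebra F) (V : lmodType F).
Local Notation word := (@word F A).
Local Notation CA := (cochain (regular A)).
Implicit Types (K : word -> V).

Lemma circ_slot p q (f : CA p) (g : CA q) (phi : letter A -> V) w :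
  letter_linear phi -> phi (circC f g $ w) = ins g (fun y => phi (f $ y)) w.
Proof.
move=> lin; rewrite ins_slot //.
by rewrite -(@on_degreeE _ _ _ phi (p + q + 1 + wdeg w) (circC f g $ w)).
Qed.

Lemma ins_circ p q (f : CA p) (g : CA q) K w : mlinear K ->
  ins (circC f g) K w = nest f g K w.
Proof.
move=> lin; apply: eq_split3 => u v z _.
rewrite (circ_slot f g (phi := fun x => K (u ++ x :: z))); last exact: lin.
by congr (koszul _ *: _); ring.
Qed.

Lemma nest_mu_cocycle p (f : CA p) K w : hochD p f = 0 -> mlinear K ->
  nest mu f K w = koszul (p + 1) *: nest f mu K w.
Proof.
move=> fD lin; rewrite -split3Z; apply: eq_split3 => u v z _.
by rewrite (ins_mu_cocycle (phi := fun x => K (u ++ x :: z)) v fD) //; ksign.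
Qed.

(** The nested terms in the pre-Lie identity cancel by the cocycle condition, so
  that the coderivation of f commutes with the bar differential. *)
Lemma ins_mu_comm p (f : CA p) K w : hochD p f = 0 -> mlinear K ->
  ins f (ins mu K) w = koszul (p + 1) *: ins mu (ins f K) w.
Proof.
move=> fD lin; have := ins_comm mu f K w; rewrite nest_mu_cocycle //.
have -> : koszul ((-2 + 1) * (p + 1)) = koszul (p + 1) :> F by parity.
by rewrite scalerBr => /addIr.
Qed.

End CircSlots.

(** * Graded commutativity and the bracket *)

Section CupCommutative.
Variables (F : fieldType) (A : dgAlgebra F).
Local Notation word := (@word F A).
Local Notation CA := (cochain (regular A)).
Variables (p q : int) (f : CA p) (g : CA q).
Hypotheses (fD : hochD p f = 0) (gD : hochD q g = 0).

(** Gerstenhaber's homotopy. Both f and g commute with the structure cochain;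
  what remains of its commutator with the circle product are the two ways of
  inserting f and g side by side in it. *)
Lemma hochD_circ w : hochD (p + q + 1) (circC f g) w =
  - (koszul p *: act f g w +
     koszul ((p + 1) * (q + 1) + q) *: act g f w).
Proof.
rewrite (hochD_regular (circC f g)) !circ_ins /=.
rewrite ins_circ; last exact: (cochain_mlinear mu).
rewrite (@eq_ins _ _ _ _ mu (circC f g) (ins g (f : word -> regular A))); last first.
  by move=> y _; exact: circ_ins.
set E := ins mu (ins g _) w.
have e2 : ins g (ins mu (f : word -> regular A)) w = koszul (q + 1) *: E.
  by rewrite ins_mu_comm //; exact: (cochain_mlinear f).
have e3 : ins g (ins f (mu : word -> regular A)) w = koszul (p + 1 + (q + 1)) *: E.
  rewrite koszulD -scalerA -e2 -insZ; apply: eq_ins => y _.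
  have := congr1 (fun h => h y) fD; rewrite hochD_regular !circ_ins => /eqP.
  by rewrite addr_eq0 -scaleNr koszulD koszul1 mulrN1 => /eqP.
have := ins_ins f g (mu : word -> regular A) w.
rewrite e3 !ins_pair_mu scalerA -koszulD => /eqP; rewrite -subr_eq => /eqP <-.
have -> : koszul (p + 1 + (q + 1)) = - koszul (p + q + 1) :> F.
  by rewrite -mulN1r -koszul1 -koszulD; parity.
module.
Qed.

End CupCommutative.

Section Bracket.
Variables (F : fieldType) (A : dgAlgebra F).
Local Notation word := (@word F A).
Local Notation CA := (cochain (regular A)).
Variables (p q : int) (f : CA p) (g : CA q).

Lemma bracket_cochain : is_cochain (N := regular A) (p + q + 1) (bracket f g).
Proof.
have sub w : bracket f g w = (- koszul ((p + 1) * (q + 1))) *: circ g f w +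
    circ f g w by rewrite addrC scaleNr.
split=> [|w].
  have [lf _] := circ_cochain f g; have [lg _] := circ_cochain g f.
  move=> c u v x y z h; rewrite !sub (lf _ _ _ _ _ _ h) (lg _ _ _ _ _ _ h).
  by rewrite !scalerDr !scalerA mulrC addrACA.
rewrite sub; apply: (@bim_gr_comb _ _ (regular A)); last exact: gr_circ.
by have := gr_circ g f w; rewrite (addrC q).
Qed.

Definition bracketC := Cochain bracket_cochain.

Lemma bracket_slot (V : lmodType F) (phi : letter A -> V) w :
  letter_linear phi -> phi (bracketC $ w) =
  phi (circC f g $ w) - koszul ((p + 1) * (q + 1)) *: phi (circC g f $ w).
Proof.
move=> lin; rewrite [RHS]addrC -scaleNr; apply: lin; split=> //=.
  by rewrite (addrC q).
by rewrite /bracket addrC scaleNr.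
Qed.

Lemma bracket_cocycle : hochD p f = 0 -> hochD q g = 0 ->
  hochD (p + q + 1) bracketC = 0.
Proof.
move=> fD gD; pose k : F := - koszul ((p + 1) * (q + 1)).
have -> : hochD (p + q + 1) bracketC =
    k *: hochD (p + q + 1) (circC g f) + hochD (p + q + 1) (circC f g).
  rewrite -hochD_linear; congr hochD; apply/funext => w.
  by rewrite /k /= /bracket !fctE /= scaleNr addrC.
apply/funext => w; rewrite !fctE /= hochD_circ //.
rewrite (_ : p + q + 1 = q + p + 1); last by ring.
rewrite hochD_circ // /k -mulN1r -koszul1 -koszulD.
set x := act f g w; set y := act g f w.
have -> : koszul ((p + 1) * (q + 1) + q) =
    koszul (1 + (p + 1) * (q + 1)) * koszul q * koszul 1 :> F.
  by rewrite -!koszulD; parity.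
have -> : koszul ((q + 1) * (p + 1) + p) =
    koszul (1 + (p + 1) * (q + 1)) * koszul p * koszul 1 :> F.
  by rewrite -!koszulD; parity.
have kk : koszul (1 + (p + 1) * (q + 1)) * koszul (1 + (p + 1) * (q + 1)) = 1 :> F.
  by rewrite -koszulD -(@koszul0 F); parity.
move: kk; rewrite koszul1; move: (koszul (1 + _)) => s ss.
transitivity (((s * s - 1) * koszul p) *: x); first by module.
by rewrite ss subrr mul0r scale0r.
Qed.

End Bracket.

(** * Insertions in cyclic words *)

Section InsertionSums.
Variables (F : fieldType) (A : dgAlgebra F) (V : lmodType F).
Local Notation word := (@word F A).
Local Notation CA := (cochain (regular A)).

Lemma ins_sum2 p (h : CA p) (z w : word) (K : word -> word -> word -> V) :
  ins h (fun y => split2 z (fun z1 z2 => K z1 z2 y)) w =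
  split2 z (fun z1 z2 => ins h (K z1 z2) w).
Proof.
rewrite /ins -(split2_swap w z (fun u r z1 z2 => split2 r (fun v t => _))).
apply: eq_split2 => u r _.
rewrite -(split2_swap r z (fun v t z1 z2 => _)).
by apply: eq_split2 => v t _; rewrite split2Z.
Qed.

Lemma ins_swap p q (h : CA p) (g : CA q) (v w : word) (K : word -> word -> V) :
  ins h (fun x => ins g (fun y => K x y) w) v =
  ins g (fun y => ins h (fun x => K x y) v) w.
Proof.
rewrite {2}/ins {1}/split3 ins_sum2; apply: eq_split2 => u r _.
rewrite ins_sum2; apply: eq_split2 => s t _; exact: insZ.
Qed.

Lemma ins_split3 p (h : CA p) (K : word -> word -> word -> V) w :
  ins h (fun y => split3 y K) w =
  split3 w (fun u v z => ins h (fun y => K y v z) u) +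
  split3 w (fun u v z => koszul ((p + 1) * wdeg u) *:
    ins h (fun y => K u y z) v) +
  split3 w (fun u v z => koszul ((p + 1) * (wdeg u + wdeg v)) *:
    ins h (fun y => K u v y) z).
Proof.
rewrite {1}/split3 ins_split2 -addrA; congr (_ + _).
  by apply: eq_split2 => u r _; rewrite ins_sum2.
rewrite -split3D; apply: eq_split2 => u r _.
rewrite ins_split2 scalerDr -!split2Z -split2D; apply: eq_split2 => v z _.
by congr (_ + _); ksign.
Qed.

End InsertionSums.

Section CyclicWords.
Variables (F : fieldType) (A : dgAlgebra F) (V : lmodType F).
Local Notation word := (@word F A).
Local Notation CA := (cochain (regular A)).
Implicit Types (X : word -> V) (a : letter A) (u v w y z : word).

(** The word a :: w stands for the Hochschild chain a[w], and V-valued functions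
  of chains are composed with operators on chains. This one, the Lie derivative
  along h, inserts h everywhere in the cyclic word, also around a; the
  resulting letter then takes the place of a. *)
Definition lie p (h : CA p) X a w : V :=
  koszul ((p + 1) * (ldeg a + 1)) *: ins h (fun y => X (a :: y)) w +
  split3 w (fun u v z => koszul (wdeg z * (ldeg a + 1 + wdeg u + wdeg v)) *:
    X (h $ (z ++ a :: u) :: v)).

(** The cochain h is inserted around a, and g among the arguments of h that
  follow a. When h is the structure cochain this is the action of g on the
  dual of the chains; in general it is the homotopy between the action of a
  bracket and a commutator of a Lie derivative with an action. *)
Definition lie_pair p q (h : CA p) (g : CA q) X a w : V :=
  split3 w (fun u v z =>
    koszul (wdeg z * (ldeg a + 1 + wdeg u + wdeg v) +
            (q + 1) * (wdeg z + ldeg a + 1)) *: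
    ins g (fun y => X (h $ (z ++ a :: y) :: v)) u).

Definition on_chains (Y : letter A -> word -> V) : word -> V :=
  fun w => head_case w 0 Y.

(** The terms of the compositions below. In lie_triple the letter made by h lies
  outside the arguments of f, in lie_pair_circl it is one of them, and in
  lie_pair_circr the letter made by g is in turn an argument of h. *)
Section TwoInsertions.
Variables (p q r : int) (f : CA p) (h : CA q) (g : CA r) (X : word -> V).

Definition lie_triple a w : V := split3 w (fun u v z =>
    koszul (wdeg z * (ldeg a + 1 + wdeg u + wdeg v) +
      (r + 1) * (wdeg z + ldeg a + 1) +
      (q + 1) * (wdeg z + ldeg a + 1 + wdeg u)) *:
    ins g (fun y => ins h (fun x => X (f $ (z ++ a :: y) :: x)) v) u).

Definition lie_pair_circl a w : V := split3 w (fun u v z =>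
    koszul (wdeg z * (ldeg a + 1 + wdeg u + wdeg v) +
            (r + 1) * (wdeg z + ldeg a + 1)) *:
    ins g (fun y => ins h (fun x => X (f $ x :: v)) (z ++ a :: y)) u).

Definition lie_pair_circr a w : V := split3 w (fun u v z =>
    koszul (wdeg z * (ldeg a + 1 + wdeg u + wdeg v) +
            (q + 1 + (r + 1)) * (wdeg z + ldeg a + 1)) *:
    nest h g (fun y => X (f $ (z ++ a :: y) :: v)) u).

End TwoInsertions.

Section CompositionIdentity.
Variables (p q r : int) (f : CA p) (h : CA q) (g : CA r) (X : word -> V).
Let s0 a u v z := wdeg z * (ldeg a + 1 + wdeg u + wdeg v).
Let s1 a u v z := s0 a u v z + (r + 1) * (wdeg z + ldeg a + 1).

Lemma lie_pair_lie a w :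
  lie h (on_chains (lie_pair f g X)) a w =
  split3 w (fun u v z => koszul (s0 a u v z + (q + 1 + (r + 1)) *
      (wdeg z + ldeg a + 1)) *:
    ins h (ins g (fun y => X (f $ (z ++ a :: y) :: v))) u) +
  lie_triple f h g X a w +
  split3 w (fun u v z => koszul (s1 a u v z + (q + 1) * (r + 1)) *:
    ins g (fun y => ins h (fun x => X (f $ (x ++ a :: y) :: v)) z) u) +
  split3 w (fun u v1 t => split3 t (fun v2 v3 z =>
    koszul (s0 a u (v1 ++ v2 ++ v3) z +
      wdeg v3 * (q + 1 + wdeg z + ldeg a + 1 + wdeg u + wdeg v1 + wdeg v2) +
      (r + 1) * (wdeg v3 + q + 1 + wdeg z + ldeg a + 1 + wdeg u)) *:
    ins g (fun y => X (f $ (v3 ++ h $ (z ++ a :: u) :: y) :: v2)) v1)).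
Proof.
rewrite /lie; congr (_ + _).
  rewrite /= /lie_pair ins_split3 !scalerDr; congr (_ + _ + _).
  - rewrite -split3Z; apply: eq_split3 => u v z _.
    rewrite (@eq_ins _ _ _ _ h _ (fun y => koszul (s1 a u v z +
      wdeg z * (q + 1)) *: ins g (fun y' => X (f $ (z ++ a :: y') :: v)) y)).
      by rewrite insZ /s1 /s0; ksign.
    by move=> y ->; rewrite /s1 /s0; ksign.
  - rewrite -split3Z; apply: eq_split3 => u v z _.
    rewrite -ins_swap (@eq_ins _ _ _ _ h _ (fun y => koszul (s1 a u v z +
      wdeg z * (q + 1)) *: ins g (fun y' => X (f $ (z ++ a :: y') :: y)) u)).
      by rewrite insZ /s1 /s0; ksign.
    by move=> y ->; rewrite /s1 /s0; ksign.
  rewrite -split3Z; apply: eq_split3 => u v z _.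
  rewrite -ins_swap (@eq_ins _ _ _ _ h _ (fun y => koszul (s1 a u v z +
      (q + 1) * (ldeg a + 1 + wdeg u + wdeg v + (r + 1))) *:
     ins g (fun y' => X (f $ (y ++ a :: y') :: v)) u)).
    by rewrite insZ /s1 /s0; ksign.
  by move=> y ->; rewrite /s1 /s0; ksign.
rewrite -(split33_2 w (fun u v1 v2 v3 z => _)); apply: eq_split3 => u v z _.
rewrite /= /lie_pair -split3Z; apply: eq_split3 => v1 v2 v3 ->.
by rewrite /s0; ksign.
Qed.

Lemma lie_lie_pair a w :
  lie_pair h g (on_chains (lie f X)) a w =
  koszul ((p + 1) * (q + 1 + (r + 1))) *: lie_triple h f g X a w +
  split3 w (fun u v1 t => split3 t (fun v2 v3 z =>
    koszul (s1 a u (v1 ++ v2 ++ v3) z + wdeg v3 *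
      (q + 1 + wdeg z + ldeg a + 1 + wdeg u + (r + 1) + wdeg v1 + wdeg v2)) *:
    ins g (fun y => X (f $ (v3 ++ h $ (z ++ a :: y) :: v1) :: v2)) u)).
Proof.
rewrite -(split33_2 w (fun u v1 v2 v3 z => _)) -split3Z -split3D.
apply: eq_split3 => u v z _; rewrite /= /lie insD scalerDr; congr (_ + _).
  rewrite (@eq_ins _ _ _ _ g _ (fun y => koszul ((p + 1) *
      (q + wdeg z + ldeg a + 1 + wdeg u + (r + 1) + 1)) *:
    ins f (fun x => X (h $ (z ++ a :: y) :: x)) v)).
    by rewrite insZ; ksign.
  by move=> y ey; congr (koszul _ *: _); rewrite /= wdeg_cat wdeg_cons ey; ring.
rewrite /split3 ins_sum2 -split2Z; apply: eq_split2 => v1 t ->.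
rewrite ins_sum2 -split2Z; apply: eq_split2 => v2 v3 ->.
rewrite (@eq_ins _ _ _ _ g _ (fun y => koszul (wdeg v3 *
    (q + 1 + wdeg z + ldeg a + 1 + wdeg u + (r + 1) + wdeg v1 + wdeg v2)) *:
  X (f $ (v3 ++ h $ (z ++ a :: y) :: v1) :: v2))).
  by rewrite insZ /s1 /s0; ksign.
move=> y ey; congr (koszul _ *: _).
by rewrite /= wdeg_cat wdeg_cons ey; ring.
Qed.

Lemma lie_pair_circl_expand a w :
  lie_pair_circl f h g X a w =
  split3 w (fun u v z => koszul (s1 a u v z) *:
    ins g (fun y => ins h (fun x => X (f $ (x ++ a :: y) :: v)) z) u) +
  split3 w (fun u v z => koszul (s0 a u v z + (q + 1 + (r + 1)) *
      (wdeg z + ldeg a + 1)) *: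
    ins g (ins h (fun y => X (f $ (z ++ a :: y) :: v))) u) +
  split3 w (fun u v1 t => split3 t (fun v2 v3 z =>
    koszul (s1 a u (v1 ++ v2 ++ v3) z + wdeg v3 *
      (q + 1 + wdeg z + ldeg a + 1 + wdeg u + (r + 1) + wdeg v1 + wdeg v2)) *:
    ins g (fun y => X (f $ (v3 ++ h $ (z ++ a :: y) :: v1) :: v2)) u)) +
  koszul ((q + 1) * (r + 1)) *: split3 w (fun u v1 t => split3 t (fun v2 v3 z =>
    koszul (s0 a u (v1 ++ v2 ++ v3) z +
      wdeg v3 * (q + 1 + wdeg z + ldeg a + 1 + wdeg u + wdeg v1 + wdeg v2) +
      (r + 1) * (wdeg v3 + q + 1 + wdeg z + ldeg a + 1 + wdeg u)) *:
    ins g (fun y => X (f $ (v3 ++ h $ (z ++ a :: u) :: y) :: v2)) v1)).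
Proof.
pose sg u v1 v2 v3 z : F := koszul (s1 a (u ++ v1) v2 (v3 ++ z) + (q + 1) * wdeg v3).
transitivity (split3 w (fun u v z => koszul (s1 a u v z) *:
    ins g (fun y => ins h (fun x => X (f $ (x ++ a :: y) :: v)) z) u) +
  split3 w (fun u v z => koszul (s0 a u v z + (q + 1 + (r + 1)) *
      (wdeg z + ldeg a + 1)) *:
    ins g (ins h (fun y => X (f $ (z ++ a :: y) :: v))) u) +
  split3 w (fun u v z => split2 u (fun u1 u2 => split2 z (fun z1 z2 =>
    sg u1 u2 v z1 z2 *:
       ins g (fun y => X (f $ (z1 ++ h $ (z2 ++ a :: y) :: u2) :: v)) u1))) +
  split3 w (fun u v z => split2 u (fun u1 u2 => split2 z (fun z1 z2 =>
    (sg u1 u2 v z1 z2 * koszul ((r + 1) * wdeg u1)) *: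
       ins g (fun y => X (f $ (z1 ++ h $ (z2 ++ a :: u1) :: y) :: v)) u2)))).
  rewrite -!split3D; apply: eq_split3 => u v z _.
  rewrite (@eq_ins _ _ _ _ g _ (fun y =>
      ins h (fun x => X (f $ (x ++ a :: y) :: v)) z +
      koszul ((q + 1) * (wdeg z + ldeg a + 1)) *:
        ins h (fun y' => X (f $ (z ++ a :: y') :: v)) y +
      split2 z (fun z1 z2 => split2 y (fun y1 y2 => koszul ((q + 1) * wdeg z1) *:
        X (f $ (z1 ++ h $ (z2 ++ a :: y1) :: y2) :: v))))); last first.
    by move=> y _; rewrite (ins_mark h (fun x => X (f $ x :: v))).
  rewrite !insD insZ !scalerDr -[RHS]addrA; congr (_ + _ + _).
    by rewrite /s1 /s0; ksign.
  rewrite ins_sum2 -split2Z -(split2_swap z u (fun z1 z2 u1 u2 => _)).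
  rewrite -(split2_swap z u (fun z1 z2 u1 u2 => (_ * _) *: _)) -split2D.
  apply: eq_split2 => z1 z2 ->.
  rewrite (ins_split2 g (fun y1 y2 => koszul ((q + 1) * wdeg z1) *:
        X (f $ (z1 ++ h $ (z2 ++ a :: y1) :: y2) :: v))) scalerDr -!split2Z.
  rewrite -!split2D; apply: eq_split2 => u1 u2 ->.
  by rewrite !insZ /sg /s1 /s0; congr (_ + _); ksign.
congr (_ + _ + _ + _).
  rewrite split322; apply: eq_split3 => u v1 t _; apply: eq_split3 => v2 v3 z _.
  by rewrite /sg /s1 /s0; ksign.
rewrite split322 -split3Z; apply: eq_split3 => u v1 t _.
rewrite -split3Z; apply: eq_split3 => v2 v3 z _.
by rewrite /sg /s1 /s0; ksign.
Qed.

(** Among the arguments of f, the cochain h is inserted before the mark, after it,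
  or around it. In the last two cases g is inserted in an argument of h or
  separately. The other compositions of h and g with f contribute the same terms,
  and those where h lies outside f. *)
Lemma lie_pair_circ a w :
  lie_pair_circl f h g X a w =
  lie_pair h g (on_chains (lie f X)) a w
  - koszul ((p + 1) * (q + 1 + (r + 1))) *: lie_triple h f g X a w
  + koszul ((q + 1) * (r + 1)) *: (lie h (on_chains (lie_pair f g X)) a w
      - lie_pair_circr f g h X a w - lie_triple f h g X a w)
  + lie_pair_circr f h g X a w.
Proof.
rewrite lie_pair_circl_expand lie_pair_lie lie_lie_pair.
have -> : split3 w (fun u v z => koszul (s0 a u v z + (q + 1 + (r + 1)) *
      (wdeg z + ldeg a + 1)) *:
    ins g (ins h (fun y => X (f $ (z ++ a :: y) :: v))) u) =
  lie_pair_circr f h g X a w + koszul ((q + 1) * (r + 1)) *: (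
  split3 w (fun u v z => koszul (s0 a u v z + (q + 1 + (r + 1)) *
      (wdeg z + ldeg a + 1)) *:
    ins h (ins g (fun y => X (f $ (z ++ a :: y) :: v))) u) -
  lie_pair_circr f g h X a w).
  rewrite -scaleN1r -split3Z -split3D -split3Z -split3D.
  apply: eq_split3 => u v z _.
  have /eqP := ins_comm h g (fun y => X (f $ (z ++ a :: y) :: v)) u.
  rewrite subr_eq => /eqP ->; rewrite !scalerDr addrC; congr (_ + _).
  rewrite !scalerN !scaleN1r !scalerN; congr (_ - _); ksign.
have e : koszul ((q + 1) * (r + 1)) * koszul ((q + 1) * (r + 1)) = 1 :> F.
  by rewrite -koszulD -(@koszul0 F); parity.
set T := split3 w (fun u v z => koszul (s1 a u v z) *: _).
have -> : split3 w (fun u v z => koszul (s1 a u v z + (q + 1) * (r + 1)) *: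
    ins g (fun y => ins h (fun x => X (f $ (x ++ a :: y) :: v)) z) u) =
  koszul ((q + 1) * (r + 1)) *: T.
  by rewrite /T -split3Z; apply: eq_split3 => u v z _; ksign.
rewrite -[T in LHS]scale1r -e.
by module.
Qed.

End CompositionIdentity.

End CyclicWords.

Section CyclicCocycles.
Variables (F : fieldType) (A : dgAlgebra F) (V : lmodType F).
Local Notation word := (@word F A).
Local Notation CA := (cochain (regular A)).
Implicit Types (X : word -> V) (a : letter A) (u v w y z : word).

Lemma mlinear_head X v : mlinear X -> letter_linear (fun x => X (x :: v)).
Proof. by move=> lin; apply: (lin [::]). Qed.

Lemma lie_muE X a w : mlinear X ->
  lie mu X a w = koszul (ldeg a + 1) *: ins mu (fun y => X (a :: y)) w +
    (X (mu $ [:: a] :: w) + head_case w 0 (fun b v => X (mu $ [:: a; b] :: v)) +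
    last_case w 0 (fun v b => koszul ((ldeg b + 1) * (ldeg a + 1 + wdeg v)) *:
      X (mu $ [:: b; a] :: v))).
Proof.
move=> lin; rewrite /lie split3_collapse => [|u v z uz]; last first.
  rewrite (letter_linear0 (mlinear_head _ lin)) ?scaler0 //.
  by rewrite /= mu_fun0 // size_cat /= addnS ltnS addnC.
congr (_ + (_ + _ + _)).
- by ksign.
- by rewrite wdeg_nil mul0r koszul0 scale1r.
- by case: w => //= b v; rewrite wdeg_nil mul0r koszul0 scale1r.
case/lastP: w => // v b; rewrite !last_case_rcons /=; ksign.
Qed.

Lemma lie_pair_muE q (g : CA q) X a w : mlinear X ->
  lie_pair mu g X a w = koszul ((q + 1) * (ldeg a + 1)) *:
    split2 w (fun u v => X (mu $ [:: a; g $ u] :: v)).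
Proof.
move=> lin.
have mu0 z u1 b u3 v : (0 < size z + size u1 + size u3)%N ->
    X (mu $ (z ++ a :: u1 ++ b :: u3) :: v) = 0.
  move=> h; rewrite (letter_linear0 (mlinear_head _ lin)) //= mu_fun0 //.
  by rewrite size_cat /= size_cat /= !addnS !ltnS addnA.
rewrite -split2Z /lie_pair /split3; apply: eq_split2 => u r _.
rewrite split2_nil2 => [|b v z].
  rewrite wdeg_nil mul0r !add0r; congr (_ *: _).
  rewrite /ins /split3 split2_nil1 => [|b u1 r']; last first.
    by apply: split2_0 => u2 u3 _; rewrite (mu0 [::]) ?scaler0.
  rewrite split2_nil2 => [|b u2 u3].
    by rewrite wdeg_nil mulr0 koszul0 scale1r.
  by rewrite (mu0 [::] [::]) ?scaler0 // size_rcons.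
rewrite /ins split3_0 ?scaler0 // => u1 u2 u3 _.
by rewrite mu0 ?scaler0 // size_rcons.
Qed.

Variables (p q : int) (f : CA p) (g : CA q) (X : word -> V).
Hypotheses (fD : hochD p f = 0) (gD : hochD q g = 0) (lin : mlinear X).
Hypothesis XD : forall a w, lie mu X a w = 0.

Lemma lie_pair_lie_mu r s (h : CA r) (k : CA s) a w :
  lie_pair h k (on_chains (lie mu X)) a w = 0.
Proof.
apply: split3_0 => u v z _; rewrite /ins split3_0 ?scaler0 // => u1 u2 u3 _.
by rewrite /on_chains /= XD scaler0.
Qed.

Lemma mlinear_after_mark r (k : CA r) z a v :
  mlinear (fun y => X (k $ (z ++ a :: y) :: v)).
Proof.
move=> s t c x y y' e.
have := letter_comb_cochain k (z ++ a :: s) t e; rewrite -!catA /=.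
exact: mlinear_head.
Qed.

Lemma lie_pair_bracket a w : lie_pair mu (bracketC f g) X a w =
  lie_pair_circr mu f g X a w
  - koszul ((p + 1) * (q + 1)) *: lie_pair_circr mu g f X a w.
Proof.
rewrite -scaleN1r scalerA -!split3Z -split3D; apply: eq_split3 => u v z _.
set K := fun y => X (mu $ (z ++ a :: y) :: v).
have -> : ins (bracketC f g) K u =
    nest f g K u - koszul ((p + 1) * (q + 1)) *: nest g f K u.
  have linK : mlinear K by exact: mlinear_after_mark.
  rewrite -!ins_circ // -scaleN1r scalerA -split3Z -split3D.
  apply: eq_split3 => u1 u2 u3 _.
  rewrite (bracket_slot f g (phi := fun x => K (u1 ++ x :: u3))); last exact: linK.
  rewrite scalerDr; congr (_ + _).
  by rewrite scalerN mulN1r !scaleNr; congr (- _); ksign.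
rewrite scalerDr scalerN; congr (_ + _); first by ksign.
by rewrite mulN1r scaleNr; congr (- _); ksign.
Qed.

(** The identity lie_pair_circ is used twice, with the structure cochain as the
  outer and as the middle cochain. The cocycle conditions identify the circle
  terms of both, and in the difference the triple insertions cancel. What remains
  says that the commutator of the Lie derivative along f with the action of g is
  homotopic to the action of the bracket. *)
Lemma lie_action_commutator a w :
  lie_pair mu g (on_chains (lie f X)) a w
  - koszul ((p + 1) * q) *: lie f (on_chains (lie_pair mu g X)) a w =
  koszul (p + 1) *: lie_pair mu (bracketC f g) X a w
  - koszul (q + 1) *: lie mu (on_chains (lie_pair f g X)) a w.
Proof.
have c1 : lie_pair_circl f mu g X a w =
    koszul (p + 1) *: lie_pair_circl mu f g X a w.
  rewrite -split3Z; apply: eq_split3 => u v z _.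
  rewrite [RHS]scalerA [X in _ = X *: _]mulrC -[RHS]scalerA.
  rewrite -insZ; congr (_ *: _); apply: eq_ins => y _.
  rewrite (ins_mu_cocycle (phi := fun x => X (x :: v)) _ fD);
    last exact: mlinear_head.
  rewrite scalerA -koszulD -[LHS]scale1r -koszul0; ksign.
have c2 : lie_pair_circr f mu g X a w =
    koszul (q + 1) *: lie_pair_circr f g mu X a w.
  rewrite -split3Z; apply: eq_split3 => u v z _.
  by rewrite nest_mu_cocycle //; [ksign | exact: mlinear_after_mark].
have := lie_pair_circ f mu g X a w; have := lie_pair_circ mu f g X a w.
rewrite lie_pair_lie_mu c1 c2 => -> /eqP; rewrite -subr_eq0 => /eqP e.
rewrite lie_pair_bracket; apply/eqP; rewrite -subr_eq0; apply/eqP.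
rewrite -[RHS]oppr0 -[in RHS]e.
set t1 := lie_triple mu f g X a w; set t2 := lie_triple f mu g X a w.
have s1 : koszul ((p + 1) * (-2 + 1 + (q + 1))) = koszul ((p + 1) * q) :> F.
  by parity.
have s2 : koszul ((-2 + 1) * (q + 1)) = koszul (q + 1) :> F by parity.
have s3 : koszul ((-2 + 1) * (p + 1 + (q + 1))) =
   koszul (p + 1) * koszul (q + 1) :> F by rewrite -koszulD; parity.
have s4 : koszul ((p + 1) * (q + 1)) =
   koszul (p + 1) * koszul ((p + 1) * q) :> F by rewrite -koszulD; parity.
rewrite s1 s2 s3 s4; case: (koszul_pm F (p + 1)) => ->; module.
Qed.

End CyclicCocycles.

(** * The Cartan homotopy formula *)

Section Cartan.
Variables (F : fieldType) (A : dgAlgebra F) (V : lmodType F).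
Local Notation word := (@word F A).
Local Notation CA := (cochain (regular A)).
Implicit Types (X Y : word -> V) (a : letter A) (u v w y z : word).
Local Notation one := (letter1 A).

Definition cyc_sum Y a w : V :=
  split2 w (fun u z => koszul (wdeg z * (ldeg a + 1 + wdeg u)) *:
    Y (z ++ a :: u)).

Definition rotate X w : V := last_case w 0 (fun v b =>
  koszul ((ldeg b + 1) * wdeg v) *: X (b :: v)).

Lemma mu_1l b : mu $ [:: one; b] = b.
Proof.
apply: letter_eq => /=; first by rewrite !wdegE /=; ring.
by rewrite koszul0 scale1r dga_mul1.
Qed.

Lemma mu_1r b : lval (mu $ [:: b; one]) = koszul (ldeg b) *: lval b.
Proof. by rewrite /= dga_mulr1. Qed.

(** The differential of a chain with the unit in front: the faces at the unit
  give back the word and its rotation. *)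
Lemma lie_mu_one X y : mlinear X -> (0 < size y)%N ->
  lie mu X one y = X y - rotate X y - ins mu (fun x => X (one :: x)) y.
Proof.
move=> lin y0; rewrite lie_muE //.
rewrite [X (mu $ [:: one] :: y)](letter_linear0 (mlinear_head _ lin)); last first.
  exact: dga_d1.
have -> : head_case y 0 (fun b v => X (mu $ [:: one; b] :: v)) = X y.
  by case: y y0 => //= b v _; rewrite mu_1l.
have -> : last_case y 0 (fun v b => koszul ((ldeg b + 1) * (ldeg one + 1 + wdeg v))
   *: X (mu $ [:: b; one] :: v)) = - rotate X y.
  rewrite /rotate; case/lastP: y {y0} => [|v b].
    by rewrite !last_case_nil oppr0.
  rewrite !last_case_rcons.
  rewrite (@letter_linearZ _ _ _ (fun x => X (x :: v)) (koszul (ldeg b)) b).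
  - by rewrite -scaleNr -mulN1r -koszul1; ksign.
  - exact: mlinear_head.
  - by rewrite /= !wdegE /=; ring.
  - exact: mu_1r.
rewrite /= koszul1; module.
Qed.

Lemma ins_last p (f : CA p) (K : word -> V) u :
  ins f K u =
  split2 u (fun u1 u2 => koszul ((p + 1) * wdeg u1) *: K (rcons u1 (f $ u2))) +
  last_case u 0 (fun u' l => ins f (fun y => K (rcons y l)) u').
Proof.
rewrite /ins /split3; case/lastP: u => [|u l].
  by rewrite !split2_nil last_case_nil addr0 /= .
rewrite last_case_rcons !split2_rcons split2_nil cats1 addrAC; congr (_ + _).
rewrite -split2D; apply: eq_split2 => u1 r _; rewrite split2_rcons addrC cats1.
congr (_ + _); apply: eq_split2 => v z _.
by rewrite rcons_cat.
Qed.

Lemma split2_telescope w (G : word -> word -> V) :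
  split2 w G - split2 w (fun u z => head_case z 0 (fun l z' => G u (l :: z'))) =
  G w [::].
Proof.
rewrite -scaleN1r -split2Z -split2D split2_nil2 => [|b u z].
  by rewrite /= scaler0 addr0.
by case: z => [|c z] /=; rewrite scaleN1r subrr.
Qed.

Section Formula.
Variables (p : int) (f : CA p) (X : word -> V).
Hypotheses (fD : hochD p f = 0) (lin : mlinear X).
Hypothesis XD : forall a w, lie mu X a w = 0.
Local Notation psi := (fun y => X (one :: y)).

Definition cartan_homotopy a w : V := split2 w (fun u z =>
  koszul (wdeg z * (ldeg a + 1 + wdeg u) + (p + 1) * (wdeg z + ldeg a + 1)) *:
  ins f (fun y => psi (z ++ a :: y)) u).

Let P a w := split2 w (fun u z =>
  koszul (wdeg z * (ldeg a + 1 + wdeg u) + (p + 1) * (wdeg z + ldeg a + 1)) *: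
  ins f (fun y => ins mu psi (z ++ a :: y)) u).

Let F1 a w := split3 w (fun u z1 z2 =>
  koszul ((wdeg z1 + wdeg z2) * (ldeg a + 1 + wdeg u)) *:
  X (f $ z1 :: z2 ++ a :: u)).

Lemma cartan_telescope a w :
  P a w = koszul ((p + 1) * (ldeg a + 1)) *: ins f (fun y => X (a :: y)) w - F1 a w.
Proof.
pose s u z : F := koszul (wdeg z * (ldeg a + 1 + wdeg u) +
  (p + 1) * (wdeg z + ldeg a + 1)).
pose G u z := s u z *: ins f (fun y => X (z ++ a :: y)) u.
have -> : P a w = split2 w G -
    split2 w (fun u z => s u z *: ins f (fun y => rotate X (z ++ a :: y)) u).
  rewrite -scaleN1r -split2Z -split2D; apply: eq_split2 => u z _.
  rewrite (@eq_ins _ _ _ _ f _ (fun y => X (z ++ a :: y) +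
     -1 *: rotate X (z ++ a :: y))).
    by rewrite insD insZ /G; module.
  move=> y _; have := lie_mu_one lin (y := z ++ a :: y).
  rewrite size_cat addnS => /(_ isT); rewrite XD => /eqP.
  by rewrite eq_sym subr_eq0 scaleN1r => /eqP ->.
have -> : split2 w (fun u z => s u z *: ins f (fun y => rotate X (z ++ a :: y)) u) =
    F1 a w + split2 w (fun u z => head_case z 0 (fun l z' => G u (l :: z'))).
  rewrite -(split2_move w (fun u l z' => G u (l :: z'))) /F1 /split3.
  rewrite -(split2A w (fun u z1 z2 => _)) -split2D; apply: eq_split2 => u z _.
  rewrite ins_last scalerDr; congr (_ + _).
    rewrite -split2Z; apply: eq_split2 => u1 u2 ->.
    rewrite -rcons_cons -rcons_cat /rotate last_case_rcons /s.
    by ksign.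
  case/lastP: u => [|u l]; first by rewrite !last_case_nil scaler0.
  rewrite !last_case_rcons /G.
  rewrite (@eq_ins _ _ _ _ f _ (fun y => koszul ((ldeg l + 1) *
     (wdeg z + ldeg a + 1 + wdeg u + (p + 1))) *: X (l :: z ++ a :: y))).
    by rewrite insZ /s; ksign.
  move=> y ey; rewrite -rcons_cons -rcons_cat /rotate last_case_rcons.
  by rewrite !wdegE ey; ksign.
rewrite opprD addrCA split2_telescope /G /s addrC wdeg_nil mul0r !add0r.
by [].
Qed.

Lemma mlinear_psi z a : mlinear (fun y => psi (z ++ a :: y)).
Proof.
move=> s t c x y y' e.
by have := lin (one :: z ++ a :: s) t e; rewrite /= -!catA /=; apply.
Qed.

Let XBI a w := lie_pair mu f (on_chains (cyc_sum psi)) a w.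

Lemma cartan_commute a w :
  P a w = XBI a w + koszul (p + 1) *: lie mu (on_chains cartan_homotopy) a w.
Proof.
pose s u z := wdeg z * (ldeg a + 1 + wdeg u) + (p + 1) * (wdeg z + ldeg a + 1).
pose M1 := split2 w (fun u z => koszul (s u z + wdeg z + ldeg a + 1) *:
  ins mu (ins f (fun y => psi (z ++ a :: y))) u).
pose M2 := split2 w (fun u z => koszul (s u z) *:
  ins f (fun y => ins mu (fun x => psi (x ++ a :: y)) z) u).
pose M3 := split2 w (fun u1 r => split3 r (fun u2 z1 z2 =>
  koszul (s (u1 ++ u2) (z1 ++ z2) + wdeg z1 + (p + 1) * wdeg u1) *:
  ins f (fun y => psi (z1 ++ mu $ (z2 ++ a :: u1) :: y)) u2)).
have -> : P a w = M2 + koszul (p + 1) *: M1 + (XBI a w + M3).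
  pose T3 u z := split2 u (fun u1 u2 => split2 z (fun z1 z2 =>
      koszul (s (u1 ++ u2) (z1 ++ z2) + wdeg z1) *:
        ins f (fun y => psi (z1 ++ mu $ (z2 ++ a :: y) :: u2)) u1 +
      koszul (s (u1 ++ u2) (z1 ++ z2) + wdeg z1 + (p + 1) * wdeg u1) *:
        ins f (fun y => psi (z1 ++ mu $ (z2 ++ a :: u1) :: y)) u2)).
  have -> : XBI a w + M3 = split2 w T3.
    rewrite /T3 (split2A w (fun u1 u2 z => _)).
    rewrite /XBI /lie_pair /M3.
    transitivity (split3 w (fun u v z => split2 v (fun v1 v2 =>
       koszul (s (u ++ v1) (v2 ++ z) + wdeg v2) *:
        ins f (fun y => psi (v2 ++ mu $ (z ++ a :: y) :: v1)) u)) + M3).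
      congr (_ + _); apply: eq_split3 => u v z _.
      rewrite /= /cyc_sum ins_sum2 -split2Z; apply: eq_split2 => v1 v2 ->.
      rewrite (@eq_ins _ _ _ _ f _ (fun y => koszul (wdeg v2 *
          (wdeg z + ldeg a + 1 + wdeg u + (p + 1) - 1 + wdeg v1)) *:
        psi (v2 ++ mu $ (z ++ a :: y) :: v1))).
        by rewrite insZ /s; ksign.
      by move=> y ey; rewrite /= wdeg_cat wdeg_cons ey; ksign.
    rewrite split32_2 /M3 /split3 -split2D; apply: eq_split2 => u1 r _.
    rewrite -split2D; apply: eq_split2 => u2 r' _.
    by rewrite -split2D.
  rewrite /P /M1 /M2 -split2Z -!split2D; apply: eq_split2 => u z _.
  rewrite (@eq_ins _ _ _ _ f _ (fun y =>
     ins mu (fun x => psi (x ++ a :: y)) z +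
     koszul (wdeg z + ldeg a + 1) *: ins mu (fun x => psi (z ++ a :: x)) y +
     split2 z (fun z1 z2 => split2 y (fun y1 y2 => koszul (wdeg z1) *:
        psi (z1 ++ mu $ (z2 ++ a :: y1) :: y2))))); last first.
    move=> y _; rewrite (ins_mark mu psi); congr (_ + _ + _); first by ksign.
    by apply: eq_split2 => z1 z2 _; apply: eq_split2 => y1 y2 _; ksign.
  rewrite !insD insZ ins_mu_comm //; last exact: mlinear_psi.
  rewrite !scalerDr; congr (_ + _ + _); first by ksign.
  rewrite ins_sum2 /T3 -(split2_swap z u (fun z1 z2 u1 u2 => _)) -split2Z.
  apply: eq_split2 => z1 z2 ->.
  rewrite (ins_split2 f (fun y1 y2 => koszul (wdeg z1) *:
     psi (z1 ++ mu $ (z2 ++ a :: y1) :: y2))) scalerDr -!split2Z -split2D.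
  by apply: eq_split2 => u1 u2 ->; rewrite !insZ /s; congr (_ + _); ksign.
have -> : lie mu (on_chains cartan_homotopy) a w =
    M1 + koszul (p + 1) *: M2 + koszul (p + 1) *: M3.
  rewrite /lie; congr (_ + _).
    rewrite /= /cartan_homotopy ins_split2 scalerDr; congr (_ + _).
      rewrite -split2Z; apply: eq_split2 => u z _.
      rewrite (@eq_ins _ _ _ _ mu _ (fun y => koszul (s u z + wdeg z) *:
         ins f (fun y => psi (z ++ a :: y)) y)).
        by rewrite insZ /s; ksign.
      by move=> y ->; rewrite /s; ksign.
    rewrite -!split2Z; apply: eq_split2 => u z _.
    rewrite -ins_swap (@eq_ins _ _ _ _ mu _ (fun y => koszul (s u z +
       (ldeg a + 1 + wdeg u) + (p + 1)) *:
         ins f (fun x => psi (y ++ a :: x)) u)).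
      by rewrite insZ /s; ksign.
    by move=> y ->; rewrite /s; ksign.
  rewrite /M3 -split2Z; apply: eq_split2 => u r _.
  rewrite -split3Z /split3 -[RHS](split2A r (fun v1 v2 z => _)).
  apply: eq_split2 => v z _; rewrite /= /cartan_homotopy -split2Z.
  by apply: eq_split2 => v1 v2 ->; rewrite /s; ksign.
case: (koszul_pm F (p + 1)) => ->; module.
Qed.

(** The sum P is computed in two ways. As X is a cocycle, lie_mu_one turns it into
  a telescoping sum, which leaves the terms of the Lie derivative away from a and
  terms F1 of the second summand of the commutator. As the coderivation of f
  commutes with the bar differential, P is also the sum of a boundary and of the
  first summand of the commutator. *)
Lemma cartan_formula a w :
  lie_pair mu f (on_chains (cyc_sum psi)) a w +
  koszul (p + 1) *: cyc_sum (fun y => lie_pair mu f X one y) a w =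
  lie f X a w - koszul (p + 1) *: lie mu (on_chains cartan_homotopy) a w.
Proof.
have e : koszul (p + 1) *: cyc_sum (fun y => lie_pair mu f X one y) a w =
    F1 a w + split3 w (fun u v z =>
      koszul (wdeg z * (ldeg a + 1 + wdeg u + wdeg v)) *:
      X (f $ (z ++ a :: u) :: v)).
  rewrite /F1 /split3 -[X in _ = _ + X](split2A w (fun u v z => _)) -split2D.
  rewrite /cyc_sum -split2Z.
  apply: eq_split2 => u z _.
  rewrite lie_pair_muE // split2_ins !scalerDr -!split2Z.
  congr (_ + _); apply: eq_split2 => x y ->; rewrite mu_1l; ksign.
have := cartan_commute a w; rewrite cartan_telescope /XBI e /lie => e2.
apply/eqP; rewrite -subr_eq0; apply/eqP.
move/eqP: e2; rewrite -subr_eq0 => /eqP e2; rewrite -[RHS]oppr0 -[in RHS]e2.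
module.
Qed.

End Formula.
End Cartan.

(** * The operator of Connes *)

Section Connes.
Variables (F : fieldType) (A : dgAlgebra F) (V : lmodType F).
Local Notation word := (@word F A).
Local Notation CA := (cochain (regular A)).
Implicit Types (X Y : word -> V) (a l : letter A) (u v w y z : word).
Local Notation one := (letter1 A).

Lemma eq_cyc_sum Y Y' a w : (forall y, (0 < size y)%N -> Y y = Y' y) ->
  cyc_sum Y a w = cyc_sum Y' a w.
Proof.
move=> e; apply: eq_split2 => u z _; congr (_ *: _); apply: e.
by rewrite size_cat addnS.
Qed.

Lemma cyc_sumD Y Y' a w :
  cyc_sum (fun y => Y y + Y' y) a w = cyc_sum Y a w + cyc_sum Y' a w.
Proof. by rewrite -split2D; apply: eq_split2 => u z _; rewrite scalerDr. Qed.

Lemma cyc_sumN Y a w : cyc_sum (fun y => - Y y) a w = - cyc_sum Y a w.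
Proof.
rewrite -scaleN1r -split2Z; apply: eq_split2 => u z _.
by rewrite scaleN1r scalerN.
Qed.

Lemma cyc_sum_rotate X a w : cyc_sum (rotate X) a w = cyc_sum X a w.
Proof.
pose G u z := koszul (wdeg z * (ldeg a + 1 + wdeg u)) *: X (z ++ a :: u).
transitivity (split2 w (fun u z => (if nilp u then X (a :: z) else 0) +
    last_case u 0 (fun u' l => G u' (l :: z)))).
  apply: eq_split2 => u z _; case/lastP: u => [|u l].
    rewrite cats1 /rotate last_case_rcons last_case_nil addr0 scalerA -koszulD.
    by rewrite -[RHS]scale1r -koszul0; ksign.
  rewrite last_case_rcons -rcons_cons -rcons_cat /rotate last_case_rcons /G.
  by rewrite /nilp size_rcons add0r; ksign.
rewrite split2D split2_nil1; last by [].
rewrite (split2_move w (fun u l z => G u (l :: z))).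
have -> : (if nilp ([::] : word) then X (a :: w) else 0) = G w [::].
  by rewrite /G wdeg_nil mul0r koszul0 scale1r.
by rewrite -(split2_telescope w G) subrK.
Qed.

Lemma rotate_cyc_sum Y w :
  rotate (on_chains (cyc_sum Y)) w = on_chains (cyc_sum Y) w.
Proof.
case/lastP: w => [|w l] //; rewrite /rotate last_case_rcons.
case: w => [|a u]; first by rewrite wdeg_nil mulr0 koszul0 scale1r.
rewrite /= /cyc_sum split2_cons split2_rcons scalerDr [LHS]addrC -split2Z.
congr (_ + _).
  by apply: eq_split2 => x z ->; rewrite cat_rcons; ksign.
by rewrite /= cats1; ksign.
Qed.

Lemma cyc_sum_ins p (h : CA p) Y a w :
  cyc_sum (ins h Y) a w = lie h (on_chains (cyc_sum Y)) a w.
Proof.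
rewrite /lie /= {2}/cyc_sum ins_split2 scalerDr.
have -> : split3 w (fun u v z =>
     koszul (wdeg z * (ldeg a + 1 + wdeg u + wdeg v)) *:
       cyc_sum Y (h $ (z ++ a :: u)) v) =
  split2 w (fun u z => split2 z (fun z1 z2 => split2 u (fun u1 u2 =>
    koszul (wdeg z * (ldeg a + 1 + wdeg u) + (p + 1) * wdeg z1) *:
    Y (z1 ++ h $ (z2 ++ a :: u1) :: u2)))).
  transitivity (split3 w (fun u v z => split2 v (fun v1 v2 =>
    koszul ((wdeg v2 + wdeg z) * (ldeg a + 1 + wdeg u + wdeg v1) +
        (p + 1) * wdeg v2) *: Y (v2 ++ h $ (z ++ a :: u) :: v1)))).
    apply: eq_split3 => u v z _; rewrite -split2Z.
    by apply: eq_split2 => v1 v2 ->; ksign.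
  rewrite split32_2 /split3 -(split2A w (fun u1 u2 z => _)).
  apply: eq_split2 => u z _; rewrite split2_swap.
  apply: eq_split2 => z1 z2 ->; apply: eq_split2 => u1 u2 ->; ksign.
rewrite -!split2Z -!split2D; apply: eq_split2 => u z _.
rewrite ins_mark [X in _ *: (X + _)]addrC !scalerDr; congr (_ + _ + _).
- rewrite [in RHS](@eq_ins _ _ _ _ h _ (fun y =>
    koszul (wdeg z * (ldeg a + 1 + wdeg u + (p + 1))) *: Y (z ++ a :: y))).
    by rewrite insZ; ksign.
  by move=> y ->; ksign.
- rewrite [in RHS](@eq_ins _ _ _ _ h _ (fun y => koszul ((wdeg z + (p + 1)) *
    (ldeg a + 1 + wdeg u)) *: Y (y ++ a :: u))).
    by rewrite insZ; ksign.
  by move=> y ->; ksign.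
rewrite -split2Z; apply: eq_split2 => z1 z2 ->.
by rewrite -split2Z; apply: eq_split2 => u1 u2 _; ksign.
Qed.

Lemma ins_mu_cons X a w : mlinear X ->
  ins mu X (a :: w) = koszul (ldeg a + 1) *: ins mu (fun y => X (a :: y)) w +
    (X (mu $ [:: a] :: w) + head_case w 0 (fun b v => X (mu $ [:: a; b] :: v))).
Proof.
move=> lin; have m0 v t : mu_fun v = 0 -> X (mu $ v :: t) = 0.
  by move=> v0; rewrite (letter_linear0 (mlinear_head _ lin)).
rewrite (ins_mark mu X [::]).
have -> : ins mu (fun z' => X (z' ++ a :: w)) [::] = 0.
  by rewrite /ins /split3 !split2_nil /= m0 ?scaler0.
rewrite add0r split2_nil; congr (_ + _).
  by rewrite wdeg_nil add0r; ksign.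
case: w => [|b w]; first by rewrite split2_nil wdeg_nil mulr0 koszul0 scale1r addr0.
rewrite split2_cons wdeg_nil mulr0 koszul0 scale1r /=; congr (_ + _).
rewrite split2_nil1 => [|c u v]; first by rewrite scale1r.
by rewrite m0 ?scaler0.
Qed.

Lemma lie_mu_ins X a w : mlinear X ->
  lie mu X a w = ins mu X (a :: w) +
    last_case w 0 (fun v b => koszul ((ldeg b + 1) * (ldeg a + 1 + wdeg v)) *:
      X (mu $ [:: b; a] :: v)).
Proof. by move=> lin; rewrite lie_muE // ins_mu_cons // !addrA. Qed.

Lemma ins_mu_rotate X y l : mlinear X ->
  ins mu (rotate X) (rcons y l) =
  koszul ((ldeg l + 1) * wdeg y) *: ins mu X (l :: y) -
  koszul ((ldeg l + 1) * wdeg y) *: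
    head_case y 0 (fun a u => X (mu $ [:: l; a] :: u)) +
  last_case y 0 (fun v b => koszul (wdeg v + (ldeg b + ldeg l + 1) * wdeg v) *:
    X (mu $ [:: b; l] :: v)).
Proof.
move=> lin; have m0 v t : mu_fun v = 0 -> X (mu $ v :: t) = 0.
  by move=> v0; rewrite (letter_linear0 (mlinear_head _ lin)).
pose T u v := koszul (wdeg u + (wdeg v - 1) * wdeg u) *: X (mu $ v :: u).
rewrite ins_last last_case_rcons.
rewrite (@eq_ins _ _ _ _ mu _ (fun x => koszul ((ldeg l + 1) * (wdeg y - 1)) *:
   X (l :: x))); last by move=> x ex; rewrite /rotate last_case_rcons ex; ksign.
have -> : split2 (rcons y l) (fun u1 u2 => koszul ((-2 + 1) * wdeg u1) *:
    rotate X (rcons u1 (mu $ u2))) =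
  koszul ((ldeg l + 1) * wdeg y) *: X (mu $ [:: l] :: y) +
  last_case y 0 (fun v b => koszul (wdeg v + (ldeg b + ldeg l + 1) * wdeg v) *:
    X (mu $ [:: b; l] :: v)).
  transitivity (split2 (rcons y l) T).
    apply: eq_split2 => u v _; rewrite /rotate last_case_rcons /T.
    by ksign.
  rewrite split2_rcons /T m0 // scaler0 addr0.
  case/lastP: y => [|v b].
    by rewrite split2_nil last_case_nil addr0 /= wdeg_nil !mulr0 addr0.
  rewrite split2_rcons split2_nil2 => [|c u z].
    by rewrite last_case_rcons addrC /=; congr (_ + _); ksign.
  by rewrite m0 ?scaler0 // mu_fun0 // !size_rcons.
rewrite insZ ins_mu_cons // addrAC; congr (_ + _).
have -> : koszul ((ldeg l + 1) * (wdeg y - 1)) =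
    koszul ((ldeg l + 1) * wdeg y) * koszul (ldeg l + 1) :> F.
  by rewrite -koszulD; parity.
module.
Qed.

(** This is the relation b (1 - t) = (1 - t) b' of the cyclic bicomplex, where b'
  is the differential of the bar construction. *)
Lemma lie_mu_rotate X w : mlinear X -> (0 < size w)%N ->
  on_chains (lie mu X) w - rotate (on_chains (lie mu X)) w =
  ins mu (fun y => X y - rotate X y) w.
Proof.
move=> lin w0.
have -> : ins mu (fun y => X y - rotate X y) w = ins mu X w - ins mu (rotate X) w.
  rewrite (@eq_ins _ _ _ _ mu _ (fun y => X y + -1 *: rotate X y)).
    by rewrite insD insZ scaleN1r.
  by move=> y _; rewrite scaleN1r.
case/lastP: w w0 => [|y l] // _; rewrite ins_mu_rotate //.
rewrite /rotate last_case_rcons /= lie_mu_ins //.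
case: y => [|a u].
  rewrite /= !last_case_nil wdeg_nil mulr0 koszul0 lie_mu_ins // last_case_nil.
  module.
rewrite rcons_cons /= !lie_mu_ins // last_case_rcons.
have -> : last_case (a :: u) 0 (fun v b =>
    koszul (wdeg v + (ldeg b + ldeg l + 1) * wdeg v) *: X (mu $ [:: b; l] :: v)) =
  koszul ((ldeg l + 1) * wdeg (a :: u)) *: last_case (a :: u) 0 (fun v b =>
    koszul ((ldeg b + 1) * (ldeg l + 1 + wdeg v)) *: X (mu $ [:: b; l] :: v)).
  case/lastP: (a :: u) => [|v b]; first by rewrite !last_case_nil scaler0.
  by rewrite !last_case_rcons; ksign.
rewrite wdeg_cons; module.
Qed.

Lemma mlinear_rotate X : mlinear X -> mlinear (rotate X).
Proof.
move=> lin s t; case/lastP: t => [|t b] c x y z h.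
  rewrite !cats1 /rotate !last_case_rcons.
  have [ex ey _] := h; rewrite ex ey (mlinear_head s lin h).
  by rewrite scalerDr !scalerA mulrC.
rewrite -!rcons_cons -!rcons_cat /rotate !last_case_rcons.
have [-> ->] := letter_comb_wdeg s t h.
by rewrite (lin (b :: s) t c x y z h) scalerDr !scalerA mulrC.
Qed.

Definition unit_front X w : V := X (one :: w).

(** The action of the operator B of Connes on the dual of the unnormalised
  complex, up to sign. *)
Definition connes X a w : V :=
  cyc_sum (unit_front (fun y => X y - rotate X y)) a w.

Lemma mlinearB X Y : mlinear X -> mlinear Y -> mlinear (fun w => X w - Y w).
Proof.
move=> lX lY u v c x y z h.
by rewrite (lX _ _ _ _ _ _ h) (lY _ _ _ _ _ _ h) scalerBr opprD addrACA.
Qed.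

Lemma connes_lie_mu X a w : mlinear X ->
  connes (on_chains (lie mu X)) a w = - lie mu (on_chains (connes X)) a w.
Proof.
move=> lin; rewrite -cyc_sum_ins -cyc_sumN /connes.
have linY := mlinearB lin (mlinear_rotate lin).
rewrite (eq_cyc_sum (Y' := fun y => (X y + - rotate X y) +
    - ins mu (unit_front (fun y => X y - rotate X y)) y)).
  rewrite cyc_sumD cyc_sumD cyc_sumN cyc_sum_rotate subrr add0r.
  by [].
case=> [|b y] // _; rewrite /unit_front lie_mu_rotate // ins_mu_cons //= mu_1l.
rewrite -/(rotate X (b :: y)).
have -> : X (mu $ [:: one] :: b :: y) - rotate X (mu $ [:: one] :: b :: y) = 0.
  by apply: (letter_linear0 (mlinear_head (b :: y) linY)); exact: dga_d1.
by rewrite add0r add0r koszul1 scaleN1r addrC.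
Qed.

(** The transpose of B applies 1 - t first, and its values are invariant under the
  rotation t. *)
Lemma connes_connes X a w : connes (on_chains (connes X)) a w = 0.
Proof.
rewrite /connes (eq_cyc_sum (Y' := fun _ => 0)) => [|y _].
  by rewrite /cyc_sum split2_0 // => u z _; rewrite scaler0.
by rewrite /unit_front rotate_cyc_sum subrr.
Qed.

Lemma cyc_sum_lie_mu X a w : mlinear X ->
  cyc_sum (unit_front (on_chains (lie mu X))) a w =
  - lie mu (on_chains (cyc_sum (unit_front X))) a w.
Proof.
move=> lin; rewrite -cyc_sum_ins -cyc_sumN.
rewrite (eq_cyc_sum (Y' := fun y => (X y + - rotate X y) +
    - ins mu (unit_front X) y)).
  by rewrite !cyc_sumD !cyc_sumN cyc_sum_rotate subrr add0r.
by move=> y y0; rewrite /unit_front /= lie_mu_one.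
Qed.

(** A contracting homotopy for the chains with the unit in the second place: when
  its differential is added to a cocycle, the sum vanishes on these chains. *)
Definition unit_second X : word -> V :=
  on_chains (fun a v => koszul (ldeg a + 1) *: X (a :: one :: v)).

Lemma mlinear_on_chains (Y : letter A -> word -> V) :
  (forall w, letter_linear (Y^~ w)) -> (forall a, mlinear (Y a)) ->
  mlinear (on_chains Y).
Proof.
move=> l1 l2 [|a s] t c x y z h; first exact: (l1 t c x y z h).
exact: (l2 a s t c x y z h).
Qed.

Lemma letter_linear_scale (phi : letter A -> V) (s : int -> F) :
  letter_linear phi -> letter_linear (fun x => s (ldeg x) *: phi x).
Proof.
move=> lin c x y z h; have [-> -> _] := h.
by rewrite (lin _ _ _ _ h) scalerDr !scalerA mulrC.
Qed.

Lemma mlinear_unit_second X : mlinear X -> mlinear (unit_second X).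
Proof.
move=> lin; apply: mlinear_on_chains => [w|a].
  apply: (letter_linear_scale (fun n => koszul (n + 1))).
  exact: (mlinear_head (one :: w) lin).
apply: (mlinear_scale (s := fun _ => koszul _)) => // s t c x y z h.
exact: (lin (a :: one :: s) t c x y z h).
Qed.

Lemma lie_mu_unit_second X a v : mlinear X ->
  (forall a w, lie mu X a w = 0) ->
  lie mu (unit_second X) a (one :: v) = - X (a :: one :: v).
Proof.
move=> lin XD; have linZ := mlinear_unit_second lin.
pose I := ins mu (fun y => X (a :: one :: y)) (one :: v).
pose last_X := last_case (one :: one :: v) 0 (fun v b =>
  koszul ((ldeg b + 1) * (ldeg a + 1 + wdeg v)) *: X (mu $ [:: b; a] :: v)).
have X1 : X (mu $ [:: a; one] :: one :: v) = koszul (ldeg a) *: X (a :: one :: v).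
  apply: (letter_linearZ (mlinear_head (one :: v) lin)); last exact: mu_1r.
  by rewrite /= !wdegE /=; ring.
have e0 : koszul (ldeg a) *: I + X (mu $ [:: a] :: one :: one :: v) + last_X = 0.
  have := XD a (one :: one :: v); rewrite lie_muE // ins_mu_cons; last first.
    by move=> s t c x y z h; have := lin (a :: s) t c x y z h.
  rewrite /= mu_1l X1 [X (a :: mu $ [:: one] :: _)](_ : _ = 0); last first.
    by apply: (letter_linear0 (lin [:: a] (one :: v))); exact: dga_d1.
  rewrite -/I -/last_X koszulD koszul1 => <-; module.
rewrite lie_muE //= X1.
have -> : last_case (one :: v) 0 (fun v b =>
    koszul ((ldeg b + 1) * (ldeg a + 1 + wdeg v)) *:
    (koszul (-2 + wdeg [:: b; a] + 1) *: X (mu $ [:: b; a] :: one :: v))) =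
  koszul (ldeg a) *: last_X.
  by rewrite /last_X (lastI one v) -rcons_cons !last_case_rcons; ksign.
rewrite insZ -/I -[RHS]addr0 -[in RHS](scaler0 V (koszul (ldeg a))) -e0.
have -> : koszul (-2 + wdeg [:: a] + 1) = koszul (ldeg a) :> F.
  by rewrite !wdegE; parity.
have -> : koszul (-2 + wdeg [:: a; one] + 1) = - koszul (ldeg a) :> F.
  by rewrite -[- koszul _]mulN1r -koszul1 -koszulD !wdegE /=; parity.
by rewrite koszulD koszul1; case: (koszul_pm F (ldeg a)) => ->; module.
Qed.

Lemma rotateD X Y w : rotate (fun y => X y + Y y) w = rotate X w + rotate Y w.
Proof.
case/lastP: w => [|w l]; rewrite /rotate ?last_case_nil ?addr0 //.
by rewrite !last_case_rcons scalerDr.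
Qed.

Lemma connesD X Y a w :
  connes (fun y => X y + Y y) a w = connes X a w + connes Y a w.
Proof.
rewrite -cyc_sumD; apply: eq_cyc_sum => y _.
by rewrite /unit_front rotateD opprD addrACA.
Qed.

Lemma rotateZ c X w : rotate (fun y => c *: X y) w = c *: rotate X w.
Proof.
rewrite /rotate; case/lastP: w => [|w b]; first by rewrite !last_case_nil scaler0.
by rewrite !last_case_rcons !scalerA mulrC.
Qed.

Lemma connesZ c X a w : connes (fun y => c *: X y) a w = c *: connes X a w.
Proof.
rewrite -split2Z; apply: eq_split2 => u z _.
by rewrite /unit_front rotateZ -scalerBr !scalerA mulrC.
Qed.

(** The terms of B that do not start with the unit have it in second place. The
  cocycle X is therefore replaced by the cohomologous X', which vanishes on the
  chains with the unit in second place; this does the work of the normalised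
  complex. *)
Lemma connes_unit_front X a w : mlinear X -> (forall a w, lie mu X a w = 0) ->
  connes X a w = cyc_sum (unit_front X) a w +
    (lie mu (on_chains (connes (unit_second X))) a w -
     lie mu (on_chains (cyc_sum (unit_front (unit_second X)))) a w).
Proof.
move=> lin XD; pose Z := unit_second X.
have linZ : mlinear Z := mlinear_unit_second lin.
pose X' y := X y + on_chains (lie mu Z) y.
have X'0 b v : X' (b :: one :: v) = 0.
  by rewrite /X' /= lie_mu_unit_second // subrr.
have : connes X' a w = cyc_sum (unit_front X') a w.
  apply: eq_cyc_sum => y y0; rewrite /unit_front.
  case/lastP: y y0 => [|y l] // _; rewrite -rcons_cons /rotate last_case_rcons.
  by rewrite X'0 scaler0 subr0.
rewrite connesD connes_lie_mu // /unit_front cyc_sumD.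
rewrite -/(unit_front X) -/(unit_front (on_chains _)) cyc_sum_lie_mu //.
by move/eqP; rewrite subr_eq => /eqP ->; rewrite -addrA (addrC (- _)).
Qed.

End Connes.

(** * Functionals on Hochschild chains *)

Section StructureSquare.
Variables (F : fieldType) (A : dgAlgebra F).
Local Notation word := (@word F A).
Local Notation CA := (cochain (regular A)).

Lemma circ_mu_mu (w : word) : circ mu mu w = 0.
Proof.
rewrite circ_muE /outer_l /outer_r.
have d0 : dga_d A 0 = 0 := linmap0 (@dga_d_linear F A).
have m0 a : dga_mul A a 0 = 0 := linmap0 (@dga_mul_linearr F A a).
have m0' a : dga_mul A 0 a = 0 := linmap0 (@dga_mul_linearl F A a).
case: w => [|a [|b [|c w]]].
- by rewrite /= d0 !addr0.
- by rewrite (last_case_rcons [::]) /= dga_dd m0 m0' !scaler0 oppr0 !addr0.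
- rewrite (last_case_rcons [:: a]) /= (linmapZ (@dga_d_linear F A)).
  rewrite (dga_leibniz _ (lvalP a)).
  have -> : koszul ((ldeg a + 1) * -2) = 1 :> F by rewrite -(@koszul0 F); parity.
  have -> : koszul (-2 + wdeg [:: a]) = - koszul (ldeg a) :> F.
    by rewrite -[- koszul _]mulN1r -koszul1 -koszulD wdegE wdeg_nil; parity.
  by case: (koszul_pm F (ldeg a)) => ->; module.
case: w => [|e w].
  rewrite (last_case_rcons [:: a; b]) /= d0 add0r.
  rewrite (linmapZ (@dga_mul_linearr F A _)).
  rewrite (linmapZ (@dga_mul_linearl F A (lval c))) /= dga_mulA.
  have -> : koszul ((ldeg a + 1) * -2) = 1 :> F by rewrite -(@koszul0 F); parity.
  have -> : koszul (-2 + wdeg [:: a; b]) = koszul (ldeg a) * koszul (ldeg b) :> F.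
    by rewrite -koszulD !wdegE; parity.
  by case: (koszul_pm F (ldeg a)) => ->; module.
rewrite [last_case _ _ _](_ : _ = 0); last first.
  by rewrite lastI last_case_rcons /= m0' scaler0.
by rewrite /= d0 m0 scaler0 oppr0 !addr0.
Qed.

Lemma ins_mu_mu (V : lmodType F) (phi : letter A -> V) w :
  letter_linear phi -> ins mu (fun y => phi (mu $ y)) w = 0.
Proof.
move=> lin; rewrite ins_slot // circ_mu_mu.
rewrite -[0 in LHS]/(lval (Letter (gr_zero A (-2 + -2 + 1 + wdeg w)))).
by rewrite on_degreeE // (letter_linear0 lin).
Qed.

End StructureSquare.

Section LieLinear.
Variables (F : fieldType) (A : dgAlgebra F) (V : lmodType F).
Local Notation word := (@word F A).
Local Notation CA := (cochain (regular A)).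
Implicit Types (X Y : word -> V) (a : letter A).

Lemma lieD p (h : CA p) X Y a w :
  lie h (fun y => X y + Y y) a w = lie h X a w + lie h Y a w.
Proof.
rewrite /lie insD scalerDr addrACA -split3D; congr (_ + _).
by apply: eq_split3 => u v z _; rewrite scalerDr.
Qed.

Lemma lieZ p (h : CA p) c X a w :
  lie h (fun y => c *: X y) a w = c *: lie h X a w.
Proof.
rewrite /lie insZ scalerDr -split3Z; congr (_ + _).
  by rewrite !scalerA mulrC.
by apply: eq_split3 => u v z _; rewrite !scalerA mulrC.
Qed.

Lemma eq_lie p (h : CA p) X Y a w :
  (forall b y, X (b :: y) = Y (b :: y)) -> lie h X a w = lie h Y a w.
Proof.
move=> e; rewrite /lie; congr (_ *: _ + _); first exact: eq_ins.
by apply: eq_split3 => u v z _; rewrite e.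
Qed.

Lemma lie_pairD p q (h : CA p) (g : CA q) X Y a w :
  lie_pair h g (fun y => X y + Y y) a w = lie_pair h g X a w + lie_pair h g Y a w.
Proof.
by rewrite -split3D; apply: eq_split3 => u v z _; rewrite insD scalerDr.
Qed.

Lemma lie_pairZ p q (h : CA p) (g : CA q) c X a w :
  lie_pair h g (fun y => c *: X y) a w = c *: lie_pair h g X a w.
Proof.
by rewrite -split3Z; apply: eq_split3 => u v z _; rewrite insZ !scalerA mulrC.
Qed.

Lemma eq_lie_pair p q (h : CA p) (g : CA q) X Y a w :
  (forall b y, X (b :: y) = Y (b :: y)) ->
  lie_pair h g X a w = lie_pair h g Y a w.
Proof.
move=> e; apply: eq_split3 => u v z _; congr (_ *: _); exact: eq_ins.
Qed.

Lemma cyc_sumZ c Y a w : cyc_sum (fun y => c *: Y y) a w = c *: cyc_sum Y a w.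
Proof.
by rewrite -split2Z; apply: eq_split2 => u z _; rewrite !scalerA mulrC.
Qed.

Lemma lie_pair_mu_lie q (g : CA q) X a w : hochD q g = 0 -> mlinear X ->
  lie_pair mu g (on_chains (lie mu X)) a w =
  koszul q *: lie mu (on_chains (lie_pair mu g X)) a w.
Proof.
move=> gD lin; have := lie_pair_circ mu mu g X a w.
have -> : lie_pair_circl mu mu g X a w = 0.
  apply: split3_0 => u v z _.
  have e y : ins mu (fun x => X (mu $ x :: v)) y = 0.
    exact: (ins_mu_mu y (mlinear_head v lin)).
  by rewrite {1}/ins split3_0 ?scaler0 // => u1 u2 u3 _; rewrite e scaler0.
have -> : lie_pair_circr mu mu g X a w =
    koszul (q + 1) *: lie_pair_circr mu g mu X a w.
  rewrite -split3Z; apply: eq_split3 => u v z _.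
  by rewrite nest_mu_cocycle //; [ksign | exact: mlinear_after_mark].
have -> : koszul ((-2 + 1) * (-2 + 1 + (q + 1))) = koszul q :> F by parity.
have -> : koszul ((-2 + 1) * (q + 1)) = koszul (q + 1) :> F by parity.
rewrite koszulD koszul1 => e; apply/eqP; rewrite -subr_eq0 e; apply/eqP; module.
Qed.

End LieLinear.

Section LinearityOfOperators.
Variables (F : fieldType) (A : dgAlgebra F) (V : lmodType F).
Local Notation word := (@word F A).
Local Notation CA := (cochain (regular A)).
Implicit Types (X Y : word -> V) (a : letter A).

Lemma letter_linear_split2 (T : Type) (w : seq T)
    (K : letter A -> seq T -> seq T -> V) :
  (forall u v, letter_linear (fun a => K a u v)) ->
  letter_linear (fun a => split2 w (K a)).
Proof.
move=> l c x y z h; rewrite -split2Z -split2D; apply: eq_split2 => u v _.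
exact: (l u v c x y z h).
Qed.

Lemma letter_linear_split3 (T : Type) (w : seq T)
    (K : letter A -> seq T -> seq T -> seq T -> V) :
  (forall u v z, letter_linear (fun a => K a u v z)) ->
  letter_linear (fun a => split3 w (K a)).
Proof.
move=> l; apply: letter_linear_split2 => u r; exact: letter_linear_split2.
Qed.

Lemma letter_linearC (phi : letter A -> V) (k : F) :
  letter_linear phi -> letter_linear (fun x => k *: phi x).
Proof. exact: (letter_linear_scale (fun _ => k)). Qed.

Lemma letter_linear_ins p (h : CA p) (K : letter A -> word -> V) w :
  (forall y, letter_linear (fun a => K a y)) ->
  letter_linear (fun a => ins h (K a) w).
Proof.
move=> l; apply: letter_linear_split3 => u v z; exact: letter_linearC.
Qed.

Lemma mlinear_ins_out p (h : CA p) (K : word -> word -> V) w :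
  (forall y, mlinear (fun v => K v y)) -> mlinear (fun v => ins h (K v) w).
Proof. by move=> l s t; apply: letter_linear_ins => y; exact: l. Qed.

Lemma mlinearC X (k : F) : mlinear X -> mlinear (fun y => k *: X y).
Proof. by move=> lin; apply: (mlinear_scale (s := fun _ => k)). Qed.

Lemma mlinear_cons X a : mlinear X -> mlinear (fun y => X (a :: y)).
Proof. by move=> lin s t; exact: (lin (a :: s) t). Qed.

Lemma letter_linear_mark p (h : CA p) X z u v : mlinear X ->
  letter_linear (fun a => X (h $ (z ++ a :: u) :: v)).
Proof.
move=> lin c x y t e; apply: (mlinear_head v lin); exact: letter_comb_cochain.
Qed.

Lemma mlinear_before_mark p (h : CA p) X a u v : mlinear X ->
  mlinear (fun z => X (h $ (z ++ a :: u) :: v)).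
Proof.
move=> lin s t c x y z e; rewrite -!catA /=.
exact: (letter_linear_mark _ _ _ _ lin).
Qed.

Lemma mlinear_lie_pair p q (h : CA p) (g : CA q) X :
  mlinear X -> mlinear (on_chains (lie_pair h g X)).
Proof.
move=> lin; apply: mlinear_on_chains => [w|a].
  apply: letter_linear_split3 => u v z.
  apply: (letter_linear_scale (fun n => koszul (wdeg z * (n + 1 + wdeg u +
    wdeg v) + (q + 1) * (wdeg z + n + 1)))).
  by apply: letter_linear_ins => y; exact: letter_linear_mark.
apply: mlinear_split3 => [v z|u z|u v].
- apply: mlinear_scale => [|y y' -> //].
  by apply: mlinear_ins; exact: mlinear_after_mark.
- apply: mlinear_scale => [|y y' -> //].
  by apply: mlinear_ins_out => y; exact: mlinear_cons.
apply: mlinear_scale => [|y y' -> //].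
by apply: mlinear_ins_out => y; exact: mlinear_before_mark.
Qed.

Lemma mlinear_cyc_sum Y : mlinear Y -> mlinear (on_chains (cyc_sum Y)).
Proof.
move=> lin; apply: mlinear_on_chains => [w|a].
  apply: letter_linear_split2 => u z.
  apply: (letter_linear_scale (fun n => koszul (wdeg z * (n + 1 + wdeg u)))).
  exact: lin.
apply: mlinear_split2 => [z|u].
  apply: mlinear_scale => [|y y' -> //] s t.
  move=> c x x' x'' h; have := lin (z ++ a :: s) t c x x' x'' h.
  by rewrite -!catA.
by apply: mlinear_scale => [|y y' -> //]; exact: mlinear_left.
Qed.

Lemma mlinear_unit_front X : mlinear X -> mlinear (unit_front X).
Proof. exact: mlinear_cons. Qed.

Lemma mlinear_connes X : mlinear X -> mlinear (on_chains (connes X)).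
Proof.
move=> lin; apply: mlinear_cyc_sum; apply: mlinear_unit_front.
by apply: mlinearB => //; exact: mlinear_rotate.
Qed.

Lemma mlinear_cartan p (f : CA p) X : mlinear X ->
  mlinear (on_chains (cartan_homotopy f X)).
Proof.
move=> lin; have lin1 := mlinear_unit_front lin.
apply: mlinear_on_chains => [w|a].
  apply: letter_linear_split2 => u z.
  apply: (letter_linear_scale (fun n => koszul (wdeg z * (n + 1 + wdeg u) +
    (p + 1) * (wdeg z + n + 1)))).
  by apply: letter_linear_ins => y; exact: lin1.
apply: mlinear_split2 => [z|u].
  apply: mlinear_scale => [|y y' -> //].
  by apply: mlinear_ins; exact: mlinear_psi.
apply: mlinear_scale => [|y y' -> //].
apply: mlinear_ins_out => y; exact: (mlinear_left (a :: y) lin1).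
Qed.

End LinearityOfOperators.

Section Forms.
Variables (F : fieldType) (A : dgAlgebra F).
Local Notation word := (@word F A).
Local Notation CA := (cochain (regular A)).
Local Notation one := (letter1 A).
Implicit Types (X Y : word -> F^o) (a : letter A).

(** The functionals on chains that correspond to the cochains of degree p with
  values in the dual of A. *)
Definition is_form p X : Prop := mlinear X /\
  forall a w, ldeg a + wdeg w + p != 0 -> X (a :: w) = 0.

Lemma ins_0 p (h : CA p) (K : word -> F^o) w :
  (forall y, wdeg y = wdeg w + (p + 1) -> K y = 0) -> ins h K w = 0.
Proof.
move=> e; rewrite (@eq_ins _ _ _ _ h _ (fun _ => 0)) //.
by apply: split3_0 => u v z _; rewrite scaler0.
Qed.

Lemma form_lie_pair p q r (h : CA q) (g : CA r) X : is_form p X ->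
  is_form (p + q + r + 2) (on_chains (lie_pair h g X)).
Proof.
move=> [lin dX]; split=> [|a w hn]; first exact: mlinear_lie_pair.
apply: split3_0 => u v z ew; rewrite ins_0 ?scaler0 // => y ey; apply: dX.
by move: hn; congr (_ != _); rewrite ew /= !wdegE ey; ring.
Qed.

Lemma form_action p q (g : CA q) X : is_form p X ->
  is_form (q + p) (on_chains (lie_pair mu g X)).
Proof.
by move=> fX; have := form_lie_pair mu g fX; congr is_form; ring.
Qed.

Lemma form_cyc_sum p X : is_form p X ->
  is_form (p + 1) (on_chains (cyc_sum (unit_front X))).
Proof.
move=> [lin dX]; split=> [|a w hn].
  by apply: mlinear_cyc_sum; exact: mlinear_unit_front.
apply: split2_0 => u z ew; rewrite /unit_front dX ?scaler0 //.
by move: hn; congr (_ != _); rewrite ew !wdegE /=; ring.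
Qed.

Lemma form_rotate p X : is_form p X ->
  forall a w, ldeg a + wdeg w + p != 0 -> rotate X (a :: w) = 0.
Proof.
move=> [lin dX] a w; rewrite /rotate lastI last_case_rcons => hn.
rewrite dX ?scaler0 //; move: hn; congr (_ != _).
have := wdeg_cons a w; rewrite lastI wdeg_rcons => e.
have -> : wdeg w = wdeg (belast a w) + (ldeg (last a w) + 1) - (ldeg a + 1).
  by rewrite e; ring.
by ring.
Qed.

Lemma form_connes p X : is_form p X ->
  is_form (p + 1) (on_chains (connes X)).
Proof.
move=> fX; have [lin dX] := fX; split=> [|a w hn]; first exact: mlinear_connes.
apply: split2_0 => u z ew; rewrite /unit_front.
rewrite dX ?(form_rotate fX) ?subr0 ?scaler0 //;
  by move: hn; congr (_ != _); rewrite ew !wdegE /=; ring.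
Qed.

Lemma form_unit_second p X : is_form p X -> is_form (p + 1) (unit_second X).
Proof.
move=> [lin dX]; split=> [|a w hn]; first exact: mlinear_unit_second.
by rewrite /= dX ?scaler0 //; move: hn; congr (_ != _); rewrite !wdegE /=; ring.
Qed.

Lemma form_cartan p q (f : CA q) X : is_form p X ->
  is_form (p + q + 2) (on_chains (cartan_homotopy f X)).
Proof.
move=> [lin dX]; split=> [|a w hn]; first exact: mlinear_cartan.
apply: split2_0 => u z ew; rewrite ins_0 ?scaler0 // => y ey; apply: dX.
by move: hn; congr (_ != _); rewrite ew /= !wdegE ey; ring.
Qed.

Lemma form_comb p c X Y : is_form p X -> is_form p Y ->
  is_form p (fun y => c *: X y + Y y).
Proof.
move=> [lX dX] [lY dY]; split=> [|a w hn].
  by apply: mlinearD => //; exact: mlinearC.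
by rewrite dX ?dY ?scaler0 ?addr0.
Qed.

Lemma form_zero p : is_form p (fun _ => 0).
Proof. by split=> // u v c x y z _; rewrite scaler0 addr0. Qed.

Lemma form_scale p c X : is_form p X -> is_form p (fun y => c *: X y).
Proof.
move=> fX; have := form_comb c fX (form_zero p); congr is_form.
by apply/funext => y; rewrite addr0.
Qed.

End Forms.

(** * Cochains with values in the dual as functionals *)

Section Transport.
Variables (F : fieldType) (A : dgAlgebra F).
Local Notation word := (@word F A).
Local Notation CA := (cochain (regular A)).
Local Notation CD := (cochain (dual A)).
Implicit Types (X Y : word -> F^o) (a b : letter A).

Definition form_of (g : word -> dual A) : word -> F^o :=
  on_chains (V := F^o) (chain_form g).

Definition of_form X : word -> dual A := form_cochain (fun a w => X (a :: w)).

Lemma koszul_sq (e : int) : koszul e * koszul e = 1 :> F.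
Proof. by rewrite -koszulD -(@koszul0 F); parity. Qed.

Lemma scaleF (c x : F) : c *: (x : F^o) = c * x.
Proof. by []. Qed.

Lemma dual_addE (phi psi : dual A) a : (phi + psi) a = (phi a : F) + psi a.
Proof. by []. Qed.

Lemma dual_scaleE c (phi : dual A) a : (c *: phi) a = c * (phi a : F).
Proof. by []. Qed.

Lemma dual_oppE (phi : dual A) a : (- phi) a = - (phi a : F).
Proof. by []. Qed.

Lemma bim_dualE :
  (forall j (phi : dual A) b,
     bim_d (dual A) j phi b = - koszul j * (phi (ld b) : F) :> F) *
  (forall a j (phi : dual A) b, bim_l (dual A) a j phi b =
     koszul (ldeg a * (j + ldeg b)) * (phi (lmul b a) : F) :> F) *
  (forall a j (phi : dual A) b,
     bim_r (dual A) j phi a b = (phi (lmul a b) : F) :> F).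
Proof. by []. Qed.

Local Ltac fsign := rewrite ?mulrA -?koszulD; congr (_ * _);
  rewrite ?wdegE /= ?wdegE; parity.

Lemma form_ofK g : of_form (form_of g) = g.
Proof.
apply/funext => w; apply/funext => a.
by rewrite /of_form /form_cochain /= /chain_form mulrA koszul_sq mul1r.
Qed.

Lemma of_formK X a w : form_of (of_form X) (a :: w) = X (a :: w).
Proof. by rewrite /= /chain_form /of_form /form_cochain mulrA koszul_sq mul1r. Qed.

Lemma dual_letter_linear n (phi : dual A) : phi \in dual_gr n ->
  letter_linear (phi : letter A -> F^o).
Proof. by case/dual_grP => lin _ c x y z h; exact: lin. Qed.

Lemma cochain_dual_linear p (g : CD p) w : letter_linear (g w : letter A -> F^o).
Proof. exact: dual_letter_linear (cochain_gr g w). Qed.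

Lemma cochain_form p (g : CD p) : is_form p (form_of g).
Proof.
split=> [|a w hn].
  apply: mlinear_on_chains => [w|a].
    apply: (letter_linear_scale (fun n => koszul (n * wdeg w))).
    exact: cochain_dual_linear.
  apply: (mlinear_scale (X := fun w => g w a : F^o)
    (s := fun w => koszul (ldeg a * wdeg w))) => [|y y' -> //].
  move=> s t c x y z h; have := proj1 (cochainP g) c s t x y z h.
  by move=> ->.
rewrite /= /chain_form; have /dual_grP [_ ->] := cochain_gr g w.
  by rewrite mulr0.
by move=> e; case/eqP: hn; rewrite e; ring.
Qed.

Lemma of_form_cochain p X : is_form p X -> is_cochain (N := dual A) p (of_form X).
Proof.
move=> [lin dX]; split=> [c u v x y z h|w].
  apply/funext => b; rewrite dual_combE /of_form /form_cochain.
  have [-> ->] := letter_comb_wdeg u v h.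
  have /= -> := lin (b :: u) v c x y z h.
  rewrite -[c *: _]/(c * _) mulrDr; congr (_ + _); exact: mulrCA.
apply/dual_grP; split=> [c x y z h|x hx].
  rewrite /of_form /form_cochain; have [-> -> _] := h.
  have /= -> := mlinear_head w lin h.
  rewrite -[c *: _]/(c * _) mulrDr; congr (_ + _); exact: mulrCA.
rewrite /of_form /form_cochain dX ?mulr0 //; apply/eqP => e; apply: hx.
by apply/eqP; rewrite -subr_eq0 -e; apply/eqP; ring.
Qed.

Lemma form_hochD p (g : CD p) a w :
  form_of (hochD p g) (a :: w) = koszul (p + 1) *: lie mu (form_of g) a w.
Proof.
have ll u := cochain_dual_linear g u.
rewrite lie_muE; last exact: (cochain_form g).1.
rewrite /= /chain_form hochDE; last exact: cochain_mlinear.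
have -> : ins mu (fun y => koszul (ldeg a * wdeg y) * g y a : F^o) w =
    koszul (ldeg a * (wdeg w - 1)) *: ins mu (fun y => g y a : F^o) w.
  rewrite -insZ; apply: eq_ins => y ->; congr (_ * _); parity.
have e1 : g w (mu $ [:: a]) = g w (ld a).
  congr (g w _); apply: letter_eq => //=; rewrite !wdegE; ring.
have e2 u x y : g u (mu $ [:: x; y]) = koszul (ldeg x) * g u (lmul x y).
  apply: (letter_linearZ (ll u)) => //=; rewrite !wdegE; ring.
rewrite e1.
have em : ins mu (g : word -> dual A) w a = ins mu (fun y => g y a : F^o) w.
  by apply: (@ins_map _ _ _ _ (fun phi : dual A => phi a : F^o)).
set I := ins mu (fun y => g y a : F^o) w in em *.
rewrite !dual_addE dual_scaleE em bim_dualE !scaleF !mulrDr.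
rewrite [X in _ = X]addrA [X in _ = X + _]addrA.
congr (_ + _ + _).
- rewrite [LHS]addrC; congr (_ + _); first by fsign.
  rewrite -[- koszul _]mulN1r -koszul1; fsign.
- rewrite /outer_l; case: w {em I e1} => [|b v]; rewrite /head_case ?mulr0 //.
  rewrite dual_oppE dual_scaleE bim_dualE e2 -[- (koszul _ * _)]mulN1r -koszul1.
  fsign.
rewrite /outer_r; case/lastP: w {em I e1} => [|u b].
  by rewrite !last_case_nil !mulr0.
by rewrite !last_case_rcons dual_scaleE bim_dualE e2 scaleF; fsign.
Qed.

Lemma form_act i j (f : CA i) (g : CD j) a w :
  form_of (act f g) (a :: w) =
  koszul (i * j + i + 1) *: lie_pair mu f (form_of g) a w.
Proof.
have ll u := cochain_dual_linear g u.
rewrite lie_pair_muE; last exact: (cochain_form g).1.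
rewrite /= /chain_form actE.
have lin : linear (fun phi : dual A => phi a : F^o) by [].
rewrite (split2_map lin).
have e2 u x y : g u (mu $ [:: x; y]) = koszul (ldeg x) * g u (lmul x y).
  apply: (letter_linearZ (ll u)) => //=; rewrite !wdegE; ring.
rewrite -[koszul _ * _]/(koszul _ *: (_ : F^o)) -!split2Z.
apply: eq_split2 => u v ->; rewrite dual_scaleE bim_dualE e2 !scaleF; fsign.
Qed.

Lemma form_connesE p (g : CD p) a w :
  form_of (connes_dual g) (a :: w) = - (koszul p *: connes (form_of g) a w).
Proof.
pose T (b : word) : F^o :=
    form_of g (letter1 A :: b) - rotate (form_of g) (letter1 A :: b).
pose s i : F := koszul (wdeg (take i (a :: w)) * wdeg (drop i (a :: w))).
have -> : connes (form_of g) a w =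
    \sum_(0 <= i < (size w).+1) s i * T (rot i (a :: w)).
  rewrite /connes /cyc_sum /split2 big_nat_recr //= [RHS]big_nat_recl //=.
  rewrite addrC; congr (_ + _).
    rewrite drop_size take_size /s /T rot0 /=.
    by rewrite wdeg_nil !mul0r.
  by apply: eq_bigr => i _; rewrite /s /T /rot /= scaleF; fsign.
rewrite /= /chain_form /connes_dual /form_cochain mulrA koszul_sq mul1r.
rewrite -mulrN; congr (_ * _).
rewrite /form_eval /connesB big_flatten big_map -sumrN /index_iota subn0.
apply: eq_bigr => i _.
rewrite /= !big_cons big_nil addr0 /= -/(s i) /T.
have : size (rot i (a :: w)) = (size w).+1 by rewrite size_rot.
case/lastP: (rot i (a :: w)) => [|b l] //; rewrite size_rcons => -[bw].
rewrite last_rcons -cats1 take_size_cat // cats1 -rcons_cons.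
by rewrite /rotate last_case_rcons /= scaleF; ring.
Qed.

End Transport.

(** * Passage to cohomology *)

Section Classes.
Variables (F : fieldType) (A : dgAlgebra F) (N : dgBimodule A).
Local Notation word := (@word F A).
Implicit Types (f g h : word -> bim_sort N).

Lemma HHclassE p f (fc : f \in @is_cocycle F A N p) :
  HHclass p f = HHpi (Cocycle fc).
Proof. by congr HHpi; apply: val_inj; rewrite insubdK. Qed.

Lemma HHclass_repr p (x : HH N p) : HHclass p (cocycle_val (HHrepr x)) = x.
Proof.
rewrite (HHclassE (cocycle_valP (HHrepr x))) -[RHS]HHreprK.
by congr HHpi; apply: val_inj.
Qed.

Lemma HHclass_eqP p f g :
  f \in @is_cocycle F A N p -> g \in @is_cocycle F A N p ->
  HHclass p f = HHclass p g <->
  exists h : cochain N (p + 1), f - g = hochD (p + 1) h.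
Proof.
move=> fc gc; rewrite (HHclassE fc) (HHclassE gc) HHpiP.
by split=> [/is_coboundaryP|h]; [|apply/is_coboundaryP].
Qed.

Lemma HHclass_eq p q f g h (c : F) :
  f \in @is_cocycle F A N p -> g \in @is_cocycle F A N p ->
  is_cochain q h -> q = p + 1 -> (forall w, f w - g w = c *: hochD q h w) ->
  HHclass p f = HHclass p g.
Proof.
move=> fc gc hc eq e; subst q; apply/HHclass_eqP => //.
have lin := @hochD_linear F A N (p + 1).
have hc' : is_cochain (p + 1) (c *: h).
  split=> [d u v x y z hz|w]; last exact: bim_grZ (proj2 hc w).
  rewrite !fctE (proj1 hc _ _ _ _ _ _ hz) scalerDr !scalerA; congr (_ *: _ + _).
  exact: mulrC.
exists (Cochain hc') => /=; apply/funext => w; rewrite (linmapZ lin) !fctE.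
exact: e.
Qed.

Lemma HHclass_comb p c f g :
  f \in @is_cocycle F A N p -> g \in @is_cocycle F A N p ->
  HHclass p (c *: f + g) = c *: HHclass p f + HHclass p g.
Proof.
move=> fc gc; have fgc : c *: f + g \in @is_cocycle F A N p.
  by case: (is_cocycle_submod N p) => _; apply.
rewrite (HHclassE fc) (HHclassE gc) (HHclassE fgc).
rewrite -[c *: HHpi _]/(HHscale _ _) -HHpiZ -HHpiD.
by congr HHpi; apply: val_inj.
Qed.

Lemma zero_cocycle p : (0 : word -> bim_sort N) \in @is_cocycle F A N p.
Proof. by case: (is_cocycle_submod N p). Qed.

Lemma HHclass_zero p : HHclass (N := N) p 0 = 0.
Proof.
have c0 := zero_cocycle p.
have : HHclass (N := N) p 0 = 1 *: HHclass (N := N) p 0 + HHclass (N := N) p 0.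
  by rewrite -HHclass_comb // scaler0 addr0.
by move/eqP; rewrite scale1r -subr_eq0 opprD addrA subrr sub0r oppr_eq0 => /eqP.
Qed.

Lemma HHclass_cast p q (e : p = q) f :
  gcast (G := HH N) e (HHclass p f) = HHclass q f.
Proof. by case: q / e. Qed.

Lemma cocycle_repr p (x : HH N p) :
  hochD p (cocycle_cochain (HHrepr x)) = 0.
Proof. by case/is_cocycleP: (cocycle_valP (HHrepr x)). Qed.

Lemma cocycle_in p (g : cochain N p) : hochD p g = 0 ->
  (g : word -> N) \in @is_cocycle F A N p.
Proof. by move=> gD; apply/is_cocycleP; split=> //; exact: cochainP. Qed.

Lemma HHclass_surj p (x : HH N p) :
  exists2 g : cochain N p, hochD p g = 0 & x = HHclass p g.
Proof.
exists (cocycle_cochain (HHrepr x)); first exact: cocycle_repr.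
by rewrite HHclass_repr.
Qed.

Lemma repr_class p (g : cochain N p) : hochD p g = 0 ->
  exists h : cochain N (p + 1), forall w,
    cocycle_cochain (HHrepr (HHclass p g)) w - g w = hochD (p + 1) h w.
Proof.
move=> gD; have e := HHclass_repr (HHclass p g).
have [h eh] := (HHclass_eqP (cocycle_valP _) (cocycle_in gD)).1 e.
by exists h => w; rewrite -eh.
Qed.

End Classes.

Section ActionClasses.
Variables (F : fieldType) (A : dgAlgebra F) (N : dgBimodule A).
Local Notation word := (@word F A).
Local Notation CA := (cochain (regular A)).

Lemma cochain_sub_proof (M : dgBimodule A) p (f g : cochain M p) :
  is_cochain p (fun w => f w - g w).
Proof.
split=> [c u v x y z h|w].
  rewrite (proj1 (cochainP f) _ _ _ _ _ _ h) (proj1 (cochainP g) _ _ _ _ _ _ h).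
  by rewrite scalerBr opprD addrACA.
rewrite addrC -scaleN1r; apply: bim_gr_comb; exact: cochain_gr.
Qed.

Definition cochain_sub (M : dgBimodule A) p (f g : cochain M p) :=
  Cochain (cochain_sub_proof f g).

Lemma act_subl p q (f f' : CA p) (g : cochain N q) w :
  act (cochain_sub f f') g w = act f g w - act f' g w.
Proof.
rewrite !actE -scaleN1r -split2Z -split2D; apply: eq_split2 => u v _.
rewrite (@bim_l_comb F A N (-1) (f' $ u) (f $ u)); last exact: cochain_gr.
  by module.
by split=> //=; rewrite scaleN1r addrC.
Qed.

Lemma act_subr p q (f : CA p) (g g' : cochain N q) w :
  act f (cochain_sub g g') w = act f g w - act f g' w.
Proof.
rewrite !actE -scaleN1r -split2Z -split2D; apply: eq_split2 => u v _ /=.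
have lin := @bim_l_linear F A N (f $ u) (q + wdeg v).
by rewrite (linmapD lin) -[- g' v]scaleN1r (linmapZ lin); module.
Qed.

Lemma zero_is_cochain (M : dgBimodule A) p : is_cochain (N := M) p (fun _ => 0).
Proof.
split=> [c u v x y z _|w]; first by rewrite scaler0 addr0.
exact: bim_gr0.
Qed.

Definition zeroC (M : dgBimodule A) p := Cochain (zero_is_cochain M p).

Lemma act0l p q (g : cochain N q) w : act (zeroC (regular A) p) g w = 0.
Proof.
rewrite actE split2_0 // => u v _.
have lin := bim_l_letter_linear (cochain_gr g v).
by rewrite (letter_linear0 lin) ?scaler0.
Qed.

Lemma act0r p q (f : CA p) w : act f (zeroC N q) w = 0.
Proof.
rewrite actE split2_0 // => u v _ /=.
by rewrite (linmap0 (@bim_l_linear F A N _ _)) scaler0.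
Qed.

Lemma act_cocycle p q (f : CA p) (g : cochain N q) :
  hochD p f = 0 -> hochD q g = 0 -> hochD (p + q) (actC f g) = 0.
Proof.
move=> fD gD; apply/funext => w.
rewrite (@act_leibniz _ _ _ _ _ (p - 1) (q - 1) f g (zeroC _ _) (zeroC _ _)) //.
- by rewrite act0l act0r scaler0 addr0.
- by move=> v; rewrite fD.
- by move=> v; rewrite gD.
Qed.

(** The representatives are changed one after the other; the homotopies are the
  actions of, and on, the bounding cochains. *)
Lemma HHact_class p q (f : CA p) (g : cochain N q) :
  hochD p f = 0 -> hochD q g = 0 ->
  HHact (HHclass p f) (HHclass q g) = HHclass (p + q) (act f g).
Proof.
move=> fD gD; rewrite /HHact.
have [hf ehf] := repr_class fD; have [hg ehg] := repr_class gD.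
move: (cocycle_repr (HHclass p f)) (cocycle_repr (HHclass q g)) ehf ehg.
set f' := cocycle_cochain _; set g' := cocycle_cochain _ => f'D g'D ehf ehg.
transitivity (HHclass (p + q) (act f' g)).
  apply: (@HHclass_eq _ _ _ _ (p + (q + 1)) _ _ (act f' hg) (koszul p)).
  - exact: cocycle_in (act_cocycle f'D g'D).
  - exact: cocycle_in (act_cocycle f'D gD).
  - exact: act_cochain.
  - by rewrite addrA.
  move=> w; rewrite -act_subr.
  rewrite (@act_leibniz _ _ _ _ _ (p - 1) q f' hg (zeroC _ _) (cochain_sub g' g)).
  - by rewrite act0l add0r scalerA koszul_sq scale1r.
  - by move=> v; rewrite f'D.
  - by move=> v; rewrite -ehg.
  - by [].
  - by rewrite addrK.
apply: (@HHclass_eq _ _ _ _ (p + 1 + q) _ _ (act hf g) 1).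
- exact: cocycle_in (act_cocycle f'D gD).
- exact: cocycle_in (act_cocycle fD gD).
- exact: act_cochain.
- by rewrite addrAC.
move=> w; rewrite -act_subl scale1r.
rewrite (@act_leibniz _ _ _ _ _ p (q - 1) hf g (cochain_sub f' f) (zeroC _ _)).
- by rewrite act0r scaler0 addr0.
- by move=> v; rewrite -ehf.
- by move=> v; rewrite gD.
- by rewrite addrK.
by [].
Qed.

End ActionClasses.

Section DualClasses.
Variables (F : fieldType) (A : dgAlgebra F).
Local Notation word := (@word F A).
Local Notation CA := (cochain (regular A)).
Implicit Types (X Y W : word -> F^o) (a b : letter A).

(** The cocycles: by form_hochD the differential is lie mu, up to sign. *)
Definition is_cyc p X : Prop := is_form p X /\ forall a w, lie mu X a w = 0.

Definition cl p X : HH (dual A) p := HHclass (N := dual A) p (of_form X).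

Lemma of_form_ext X Y : (forall a w, X (a :: w) = Y (a :: w)) ->
  of_form X = of_form Y.
Proof.
by move=> e; apply/funext => w; apply/funext => a; rewrite /of_form /form_cochain e.
Qed.

Lemma of_form_hochD p X : is_form p X -> hochD (N := dual A) p (of_form X) =
  of_form (fun y => koszul (p + 1) *: on_chains (lie mu X) y).
Proof.
move=> fX; rewrite -[LHS]form_ofK; apply: of_form_ext => a w.
rewrite (form_hochD (Cochain (of_form_cochain fX))) /=; congr (_ *: _).
by apply: eq_lie => b y; rewrite of_formK.
Qed.

Lemma cyc_cocycle p X : is_cyc p X -> of_form X \in @is_cocycle F A (dual A) p.
Proof.
move=> [fX XD]; apply/is_cocycleP; split; first exact: of_form_cochain.
rewrite of_form_hochD //; apply/funext => w; apply/funext => a.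
by rewrite /of_form /form_cochain /= XD scaler0 mulr0.
Qed.

Lemma cl_ext p X Y : (forall a w, X (a :: w) = Y (a :: w)) -> cl p X = cl p Y.
Proof. by move=> e; rewrite /cl (of_form_ext e). Qed.

Lemma cl_eq p q c X Y W : is_cyc p X -> is_cyc p Y -> is_form q W -> q = p + 1 ->
  (forall a w, X (a :: w) - Y (a :: w) = c *: lie mu W a w) -> cl p X = cl p Y.
Proof.
move=> cX cY fW qe e.
apply: (@HHclass_eq _ _ _ _ q _ _ (of_form W) (c * koszul (q + 1))).
- exact: cyc_cocycle.
- exact: cyc_cocycle.
- exact: of_form_cochain.
- exact: qe.
move=> w; rewrite of_form_hochD //; apply/funext => a.
rewrite dual_addE dual_oppE dual_scaleE /of_form /form_cochain -mulrBr e /= !scaleF.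
set t := koszul (ldeg a * wdeg w); set s := koszul (q + 1).
have ss : s * s = 1 by exact: koszul_sq.
transitivity (t * (c * lie mu W a w) * (s * s)); last by ring.
by rewrite ss mulr1.
Qed.

Lemma cyc_comb p c X Y : is_cyc p X -> is_cyc p Y ->
  is_cyc p (fun y => c *: X y + Y y).
Proof.
move=> [fX XD] [fY YD]; split=> [|a w]; first exact: form_comb.
by rewrite lieD lieZ XD YD scaler0 addr0.
Qed.

Lemma cyc0 p : is_cyc p (fun _ => 0).
Proof.
split=> [|a w]; first exact: form_zero.
transitivity (lie mu (fun y => 0 *: (fun _ : word => 0 : F^o) y) a w).
  by apply: eq_lie => b y; rewrite scale0r.
by rewrite lieZ scale0r.
Qed.

Lemma cycZ p c X : is_cyc p X -> is_cyc p (fun y => c *: X y).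
Proof.
move=> [fX XD]; split=> [|a w]; first exact: (form_scale c fX).
by rewrite lieZ XD scaler0.
Qed.

Lemma cl_comb p c X Y : is_cyc p X -> is_cyc p Y ->
  cl p (fun y => c *: X y + Y y) = c *: cl p X + cl p Y.
Proof.
move=> cX cY; rewrite /cl -HHclass_comb; [|exact: cyc_cocycle..].
congr HHclass; apply/funext => w; apply/funext => a.
by rewrite cofun_combE dual_combE /of_form /form_cochain scaleF mulrDr mulrCA.
Qed.

Lemma cl0 p : cl p (fun _ => 0) = 0.
Proof.
have : cl p (fun _ => 0) = 1 *: cl p (fun _ => 0) + cl p (fun _ => 0).
  rewrite -cl_comb; [|exact: cyc0..].
  by apply: cl_ext => a w; rewrite scaler0 addr0.
by move/eqP; rewrite scale1r -subr_eq0 opprD addrA subrr sub0r oppr_eq0 => /eqP.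
Qed.

Lemma clZ p c X : is_cyc p X -> cl p (fun y => c *: X y) = c *: cl p X.
Proof.
move=> cX; have := cl_comb c cX (cyc0 p); rewrite cl0 addr0 => <-.
by apply: cl_ext => a w; rewrite addr0.
Qed.

Lemma cl_surj p (x : HH (dual A) p) : exists2 X, is_cyc p X & x = cl p X.
Proof.
have [g gD ->] := HHclass_surj x; exists (form_of g); last by rewrite /cl form_ofK.
split=> [|a w]; first exact: cochain_form.
have := form_hochD g a w; rewrite gD /= /chain_form mulr0 => e.
by rewrite -[LHS]scale1r -(koszul_sq F (p + 1)) -scalerA -e scaler0.
Qed.

Lemma cyc_action i j (f : CA i) X : hochD i f = 0 -> is_cyc j X ->
  is_cyc (i + j) (on_chains (lie_pair mu f X)).
Proof.
move=> fD [fX XD]; split=> [|a w]; first exact: form_action.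
have := lie_pair_mu_lie a w fD fX.1; rewrite lie_pair_lie_mu // => e.
by rewrite -[LHS]scale1r -(koszul_sq F i) -scalerA -e scaler0.
Qed.

Lemma HHact_cl i j (f : CA i) X : hochD i f = 0 -> is_cyc j X ->
  HHact (HHclass i f) (cl j X) =
  cl (i + j) (fun y => koszul (i * j + i + 1) *: on_chains (lie_pair mu f X) y).
Proof.
move=> fD cX; pose g := Cochain (of_form_cochain cX.1).
have gD : hochD j g = 0 by case/is_cocycleP: (cyc_cocycle cX).
rewrite (HHact_class fD gD) /cl -[act f g]form_ofK; congr HHclass.
apply: of_form_ext => a w; rewrite form_act /=; congr (_ *: _).
by apply: eq_lie_pair => b y; rewrite of_formK.
Qed.

Lemma cyc_connes j X : is_cyc j X -> is_cyc (j + 1) (on_chains (connes X)).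
Proof.
move=> [fX XD]; split=> [|a w]; first exact: form_connes.
rewrite -[LHS]opprK -connes_lie_mu; last exact: fX.1.
rewrite /connes (eq_cyc_sum (Y' := fun _ => 0)) => [|y _].
  by rewrite /cyc_sum split2_0 ?oppr0 // => u z _; rewrite scaler0.
have L0 y' : on_chains (lie mu X) y' = 0 by case: y' => [|b y'] //=.
rewrite /unit_front L0 /rotate; case/lastP: (_ :: y) => [|v b].
  by rewrite last_case_nil subrr.
by rewrite last_case_rcons L0 scaler0 subrr.
Qed.

Lemma cyc_cyc_sum j X : is_cyc j X ->
  is_cyc (j + 1) (on_chains (cyc_sum (unit_front X))).
Proof.
move=> [fX XD]; split=> [|a w]; first exact: form_cyc_sum.
rewrite -[LHS]opprK -cyc_sum_lie_mu; last exact: fX.1.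
rewrite (eq_cyc_sum (Y' := fun _ => 0)) => [|y _].
  by rewrite /cyc_sum split2_0 ?oppr0 // => u z _; rewrite scaler0.
by rewrite /unit_front /= XD.
Qed.

Lemma cl_connes j X : is_cyc j X ->
  cl (j + 1) (on_chains (connes X)) =
  cl (j + 1) (on_chains (cyc_sum (unit_front X))).
Proof.
move=> cX; have [fX XD] := cX; have fZ := form_unit_second fX.
apply: (@cl_eq _ (j + 1 + 1) 1 _ _ (fun y => -1 *:
  on_chains (cyc_sum (unit_front (unit_second X))) y +
  on_chains (connes (unit_second X)) y)).
- exact: cyc_connes.
- exact: cyc_cyc_sum.
- by apply: form_comb; [exact: form_cyc_sum | exact: form_connes].
- by [].
move=> a w; rewrite /= connes_unit_front //; last exact: fX.1.
by rewrite lieD lieZ; module.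
Qed.

(** The rotations preceded by the unit are easier to compute with than B. *)
Lemma HHconnes_cl j X : is_cyc j X -> HHconnes (cl j X) =
  cl (j + 1) (fun y => koszul (j + 1) *: on_chains (cyc_sum (unit_front X)) y).
Proof.
move=> cX; pose g := Cochain (of_form_cochain cX.1).
have gD : hochD j g = 0 by case/is_cocycleP: (cyc_cocycle cX).
have [h eh] := repr_class gD; rewrite /HHconnes.
move: (cocycle_repr (cl j X)) eh; rewrite -/(cl j X).
set g' := cocycle_cochain _ => g'D eh.
pose X' := form_of g'.
have cX' : is_cyc j X'.
  split=> [|a w]; first exact: cochain_form.
  have := form_hochD g' a w; rewrite g'D /= /chain_form mulr0 => e.
  by rewrite -[LHS]scale1r -(koszul_sq F (j + 1)) -scalerA -e scaler0.
have -> : connes_dual g' =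
    of_form (fun y => koszul (j + 1) *: on_chains (connes X') y).
  rewrite -[LHS]form_ofK; apply: of_form_ext => a w.
  by rewrite form_connesE koszulD koszul1 mulrN1 scaleNr.
rewrite -/(cl _ _) !clZ; [|exact: cyc_cyc_sum|exact: cyc_connes].
congr (_ *: _); rewrite cl_connes //.
apply: (@cl_eq _ (j + 1 + 1) (- koszul (j + 1 + 1)) _ _
  (on_chains (cyc_sum (unit_front (form_of h))))).
- exact: cyc_cyc_sum.
- exact: cyc_cyc_sum.
- by apply: form_cyc_sum; exact: cochain_form.
- by [].
move=> a w; rewrite /= scaleNr -scalerN -cyc_sum_lie_mu;
  last exact: (cochain_form h).1.
rewrite -cyc_sumZ -cyc_sumN -cyc_sumD; apply: eq_cyc_sum => y _.
rewrite /unit_front /= -form_hochD.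
have -> : hochD (j + 1) h = fun v => g' v - g v by apply/funext => v; rewrite eh.
rewrite /X' /= /chain_form -(of_formK X) /= /chain_form.
by rewrite dual_addE dual_oppE mulrBr.
Qed.

Lemma HHconnes_HHconnes j (x : HH (dual A) j) : HHconnes (HHconnes x) = 0.
Proof.
have [X cX ->] := cl_surj x; rewrite HHconnes_cl // clZ; last exact: cyc_cyc_sum.
rewrite -cl_connes // -clZ; last exact: cyc_connes.
rewrite HHconnes_cl; last by apply: cycZ; exact: cyc_connes.
have cY := cycZ (koszul (j + 1)) (cyc_connes cX).
rewrite clZ; last exact: cyc_cyc_sum.
rewrite -cl_connes // (@cl_ext _ _ (fun _ => 0)) ?cl0 ?scaler0 // => a w.
by rewrite /= connesZ connes_connes scaler0.
Qed.

End DualClasses.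

Section BracketAction.
Variables (F : fieldType) (A : dgAlgebra F).
Local Notation word := (@word F A).
Local Notation CA := (cochain (regular A)).
Implicit Types (X Y W : word -> F^o).

Local Notation act_form f X := (on_chains (lie_pair mu f X)).
Local Notation B_form X := (on_chains (cyc_sum (unit_front X))).

Lemma is_cyc_cast p q X : is_cyc p X -> p = q -> is_cyc q X.
Proof. by move=> cX <-. Qed.

Lemma is_form_cast p q X : is_form p X -> p = q -> is_form q X.
Proof. by move=> fX <-. Qed.

(** The Cartan formula, for X and for the action of g on X, replaces the Lie
  derivatives in lie_action_commutator by commutators with B. The homotopies of
  the three formulas add up to W. *)
Lemma cl_bracket i j k n (f : CA i) (g : CA j) X :
  hochD i f = 0 -> hochD j g = 0 -> is_cyc k X -> n = i + j + 1 + k ->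
  cl n (act_form (bracketC f g) X) = koszul (i + 1) *:
   (cl n (act_form g (act_form f (B_form X))) +
    koszul (i + 1) *: cl n (act_form g (B_form (act_form f X))) -
    koszul ((i + 1) * j) *: (cl n (act_form f (B_form (act_form g X))) +
      koszul (i + 1) *: cl n (B_form (act_form f (act_form g X))))).
Proof.
move=> fD gD cX en.
pose lam Y y := koszul (i + 1) *: B_form (act_form f Y) y + act_form f (B_form Y) y.
have lam_cyc l Y : is_cyc l Y -> is_cyc (i + l + 1) (lam Y).
  move=> cY; apply: cyc_comb; first by apply: cyc_cyc_sum; exact: cyc_action.
  rewrite -addrA; apply: cyc_action => //; exact: cyc_cyc_sum.
have lamE l Y a w : is_cyc l Y -> lam Y (a :: w) =
    lie f Y a w - koszul (i + 1) *: lie mu (on_chains (cartan_homotopy f Y)) a w.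
  by move=> [fY YD]; rewrite -(cartan_formula fD fY.1 YD) /lam addrC.
have cgX : is_cyc (j + k) (act_form g X) by exact: cyc_action.
have cfX : is_cyc (i + k) (act_form f X) by exact: cyc_action.
have cBX : is_cyc (k + 1) (B_form X) by exact: cyc_cyc_sum.
have c1 : is_cyc n (B_form (act_form f (act_form g X))).
  by apply: (is_cyc_cast (cyc_cyc_sum (cyc_action fD cgX))); rewrite en; ring.
have c2 : is_cyc n (act_form f (B_form (act_form g X))).
  by apply: (is_cyc_cast (cyc_action fD (cyc_cyc_sum cgX))); rewrite en; ring.
have c3 : is_cyc n (act_form g (B_form (act_form f X))).
  by apply: (is_cyc_cast (cyc_action gD (cyc_cyc_sum cfX))); rewrite en; ring.
have c4 : is_cyc n (act_form g (act_form f (B_form X))).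
  by apply: (is_cyc_cast (cyc_action gD (cyc_action fD cBX))); rewrite en; ring.
have cT : is_cyc n (act_form (bracketC f g) X).
  by apply: (is_cyc_cast (cyc_action (bracket_cocycle fD gD) cX)).
pose S := on_chains (cartan_homotopy f X).
pose S' := on_chains (cartan_homotopy f (act_form g X)).
pose Q := on_chains (lie_pair f g X).
have cU : is_cyc n (act_form g (lam X)).
  by apply: (is_cyc_cast (cyc_action gD (lam_cyc _ _ cX))); rewrite en; ring.
have cV : is_cyc n (lam (act_form g X)).
  by apply: (is_cyc_cast (lam_cyc _ _ cgX)); rewrite en; ring.
have -> : cl n (act_form f (B_form (act_form g X))) +
    koszul (i + 1) *: cl n (B_form (act_form f (act_form g X))) =
    cl n (lam (act_form g X)) by rewrite /lam cl_comb // addrC.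
have -> : cl n (act_form g (act_form f (B_form X))) +
    koszul (i + 1) *: cl n (act_form g (B_form (act_form f X))) =
    cl n (act_form g (lam X)).
  rewrite addrC -cl_comb //; apply: cl_ext => a w.
  by rewrite /= lie_pairD lie_pairZ.
rewrite [X in _ = _ *: X]addrC -scaleNr -cl_comb // -clZ; last exact: cyc_comb.
pose W y := koszul (i + 1) * koszul (j + 1) *: Q y +
  (koszul (i + 1) * koszul (i + 1 + j) *: act_form g S y +
   - (koszul (i + 1) * koszul ((i + 1) * j + (i + 1))) *: S' y).
have fX := cX.1.
apply: (@cl_eq _ _ _ (n + 1) 1 _ _ W) => //.
- by apply: cycZ; exact: cyc_comb.
- have fQ : is_form (n + 1) Q.
    by apply: (is_form_cast (form_lie_pair f g fX)); rewrite en; ring.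
  have fS : is_form (n + 1) (act_form g S).
    by apply: (is_form_cast (form_action g (form_cartan f fX))); rewrite en; ring.
  have fS' : is_form (n + 1) S'.
    by apply: (is_form_cast (form_cartan f cgX.1)); rewrite en; ring.
  by apply: form_comb => //; apply: form_comb => //; exact: form_scale.
move=> a w; have M := lie_action_commutator fD gD fX.1 cX.2 a w.
have linS : mlinear S by exact: (form_cartan f fX).1.
have eU : act_form g (lam X) (a :: w) = lie_pair mu g (on_chains (lie f X)) a w
    - koszul (i + 1) *: (koszul j *: lie mu (act_form g S) a w).
  rewrite -lie_pair_mu_lie // -lie_pairZ.
  transitivity (lie_pair mu g (fun y => on_chains (lie f X) y +
     - 1 *: (koszul (i + 1) *: on_chains (lie mu S) y)) a w).
    by apply: eq_lie_pair => b y; rewrite (lamE _ _ _ _ cX) scaleN1r.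
  by rewrite lie_pairD (lie_pairZ mu g (- 1)) scaleN1r.
rewrite eU (lamE _ _ _ _ cgX) /W !lieD !lieZ scale1r.
move/eqP: M; rewrite -subr_eq0 => /eqP M.
apply/eqP; rewrite -subr_eq0 -(scaler0 _ (- koszul (i + 1))) -[in X in _ == X]M.
rewrite -/S -/S' -/Q (koszulD _ (i + 1) j) (koszulD _ ((i + 1) * j)).
apply/eqP; case: (koszul_pm F (i + 1)) => ->; module.
Qed.

End BracketAction.

(** * Graded operators on the cohomology with dual coefficients *)

Section GradedCast.
Variables (F : fieldType) (G : int -> lmodType F).

Lemma gcast_comb i j (e : i = j) c (x y : G i) :
  gcast e (c *: x + y) = c *: gcast e x + gcast e y.
Proof. by case: j / e. Qed.

Lemma gcast_irr i j (e e' : i = j) (x : G i) : gcast e x = gcast e' x.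
Proof. by rewrite (eq_irrelevance e e'). Qed.

Lemma gcast_id i (e : i = i) (x : G i) : gcast e x = x.
Proof. by rewrite (gcast_irr e erefl). Qed.

Lemma gcast_zero i j (e : i = j) : gcast e (0 : G i) = 0.
Proof. by case: j / e. Qed.

Lemma gcast_trans i j k (e : i = j) (e' : j = k) (e'' : i = k) (x : G i) :
  gcast e' (gcast e x) = gcast e'' x.
Proof. by case: k / e' e'' => e''; rewrite gcast_id; exact: gcast_irr. Qed.

End GradedCast.

Section Families.
Variables (F : fieldType) (A : dgAlgebra F).
Local Notation word := (@word F A).
Local Notation CA := (cochain (regular A)).
Local Notation HA := (HH (regular A)).
Local Notation HD := (HH (dual A)).
Implicit Types (X Y : word -> F^o).

Lemma HHact_linearr i j (a : HA i) : linear (HHact a : HD j -> HD (i + j)).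
Proof.
move=> c x y; have [f fD ->] := HHclass_surj a.
have [X cX ->] := cl_surj x; have [Y cY ->] := cl_surj y.
apply: (etrans (congr1 (HHact _) (esym (cl_comb c cX cY)))).
rewrite (HHact_cl fD (cyc_comb c cX cY)).
rewrite (HHact_cl fD cX) (HHact_cl fD cY).
rewrite -cl_comb; [|apply: cycZ; exact: cyc_action..].
by apply: cl_ext => b w; rewrite /= lie_pairD lie_pairZ; module.
Qed.

Lemma HHact_linearl i j (x : HD j) : linear (fun a : HA i => HHact a x).
Proof.
move=> c a b; have [f fD ->] := HHclass_surj a.
have [g gD ->] := HHclass_surj b; have [h hD ->] := HHclass_surj x.
have fc := cocycle_in fD; have gc := cocycle_in gD.
rewrite -HHclass_comb // !HHact_class //.
have kc : c *: (f : word -> regular A) + (g : word -> regular A) \in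
    @is_cocycle F A (regular A) i.
  by case: (is_cocycle_submod (regular A) i) => _; apply.
have [kC kD] := elimT (is_cocycleP _ _) kc.
have := @HHact_class F A (dual A) i j (Cochain kC) h kD hD.
rewrite -HHclass_comb; [|exact: (cocycle_in (act_cocycle _ hD))..].
move=> /= ->; congr HHclass; apply/funext => w.
transitivity (c *: act f h w + act g h w); last by [].
rewrite !actE -split2Z -split2D; apply: eq_split2 => u v _.
rewrite (@bim_l_comb F A (dual A) c (f $ u) (g $ u)); last exact: cochain_gr.
  by module.
by split.
Qed.

Lemma HHconnes_linear j : linear (@HHconnes F A j).
Proof.
move=> c x y; have [X cX ->] := cl_surj x; have [Y cY ->] := cl_surj y.
apply: (etrans (congr1 (@HHconnes F A j) (esym (cl_comb c cX cY)))).
rewrite (HHconnes_cl (cyc_comb c cX cY)).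
rewrite (HHconnes_cl cX) (HHconnes_cl cY).
rewrite -cl_comb; [|apply: cycZ; exact: cyc_cyc_sum..].
apply: cl_ext => a w; rewrite /= /unit_front cyc_sumD cyc_sumZ.
by module.
Qed.

Lemma HHact_cup i j k (a : HA i) (b : HA j) (x : HD k) :
  gcast (G := HD) (addrA i j k) (HHact a (HHact b x)) = HHact (HHcup a b) x.
Proof.
have [f fD ->] := HHclass_surj a; have [g gD ->] := HHclass_surj b.
have [h hD ->] := HHclass_surj x; rewrite /HHcup !HHact_class //.
rewrite (HHact_class fD (act_cocycle gD hD)).
rewrite (HHact_class (act_cocycle fD gD) hD) HHclass_cast.
by congr HHclass; apply/funext => w; rewrite -act_assoc.
Qed.

Lemma HHact_unit k (x : HD k) :
  gcast (G := HD) (add0r k) (HHact (HHunit A) x) = x.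
Proof.
have [h hD ->] := HHclass_surj x.
rewrite (HHact_class (unit_cocycle A) hD) HHclass_cast.
by congr HHclass; apply/funext => w; exact: act_unit.
Qed.

Lemma HHcup_comm i j (a : HA i) (b : HA j) :
  HHcup a b = koszul (i * j) *: gcast (G := HA) (addrC j i) (HHcup b a).
Proof.
have [f fD ->] := HHclass_surj a; have [g gD ->] := HHclass_surj b.
rewrite /HHcup !HHact_class // HHclass_cast.
have c0 := zero_cocycle (regular A) (i + j).
have cfg := cocycle_in (act_cocycle fD gD).
have cgf : act g f \in @is_cocycle F A (regular A) (i + j).
  by rewrite -(addrC j); exact: cocycle_in (act_cocycle gD fD).
rewrite -[RHS]addr0 -(HHclass_zero (regular A)) -HHclass_comb //.
have cc : koszul (i * j) *: act g f + 0 \in @is_cocycle F A (regular A) (i + j).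
  by case: (is_cocycle_submod (regular A) (i + j)) => _; apply.
apply: (@HHclass_eq F A (regular A) (i + j) (i + j + 1) _ _ (circ f g)
  (- koszul i)) => //.
  exact: circ_cochain.
move=> w; rewrite (hochD_circ fD gD) addr0 !fctE.
have -> : koszul (i * j) = - (koszul i * koszul ((i + 1) * (j + 1) + j)) :> F.
  by rewrite -mulN1r -koszul1 -!koszulD; parity.
rewrite scalerN scalerDr !scalerA mulNr koszul_sq; module.
Qed.

Lemma rho_deg (i n : int) : i + (n - i) = n. Proof. by ring. Qed.
Lemma beta_deg (n : int) : n - 1 + 1 = n. Proof. by ring. Qed.

(** A family of classes, one in each degree, is an element of the product of the
  cohomology groups; on it the action and the operator B become endomorphisms,
  which are composed without transporting between equal degrees. *)
Definition hh_family : Type := forall k, HD k.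
Implicit Types (x y : hh_family).

Definition rho i (a : HA i) x : hh_family :=
  fun n => gcast (G := HD) (rho_deg i n) (HHact a (x (n - i))).

Definition beta x : hh_family :=
  fun n => gcast (G := HD) (beta_deg n) (HHconnes (x (n - 1))).

Lemma rho_at i (a : HA i) x k n (e : i + k = n) :
  rho a x n = gcast (G := HD) e (HHact a (x k)).
Proof.
have ek : n - i = k by rewrite -e; ring.
rewrite /rho; move: (rho_deg i n); rewrite ek => e'; exact: gcast_irr.
Qed.

Lemma beta_at x k n (e : k + 1 = n) :
  beta x n = gcast (G := HD) e (HHconnes (x k)).
Proof.
have ek : n - 1 = k by rewrite -e; ring.
rewrite /beta; move: (beta_deg n); rewrite ek => e'; exact: gcast_irr.
Qed.

Lemma rho_comb i (a : HA i) c x y n :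
  rho a (fun k => c *: x k + y k) n = c *: rho a x n + rho a y n.
Proof.
exact: (etrans (congr1 _ (HHact_linearr a c (x (n - i)) (y (n - i))))
  (gcast_comb _ _ _ _)).
Qed.

Lemma rho_combl i (a b : HA i) c x n :
  rho (c *: a + b) x n = c *: rho a x n + rho b x n.
Proof.
exact: (etrans (congr1 _ (HHact_linearl (x (n - i)) c a b))
  (gcast_comb _ _ _ _)).
Qed.

Lemma rhoZl i (a : HA i) c x n : rho (c *: a) x n = c *: rho a x n.
Proof. exact: (linmapZ (fun c a b => rho_combl a b c x n)). Qed.

Lemma beta_comb c x y n :
  beta (fun k => c *: x k + y k) n = c *: beta x n + beta y n.
Proof.
exact: (etrans (congr1 _ (HHconnes_linear c (x (n - 1)) (y (n - 1))))
  (gcast_comb _ _ _ _)).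
Qed.

Lemma rho_cast i j (e : i = j) (a : HA i) x :
  rho (gcast (G := HA) e a) x = rho a x.
Proof. by case: j / e. Qed.

Lemma rho_cup i j (a : HA i) (b : HA j) x : rho (HHcup a b) x = rho a (rho b x).
Proof.
apply: functional_extensionality_dep => n; pose k := n - (i + j).
have e1 : i + (j + k) = n by rewrite /k; ring.
have e2 : i + j + k = n by rewrite /k; ring.
rewrite (rho_at _ _ e1) (rho_at _ _ (erefl (j + k))) (rho_at _ _ e2) gcast_id.
by rewrite -HHact_cup (gcast_trans _ _ e1).
Qed.

Lemma rho_unit x : rho (HHunit A) x = x.
Proof.
apply: functional_extensionality_dep => n.
by rewrite (rho_at _ _ (add0r n)) HHact_unit.
Qed.

Lemma rho_comm i j (a : HA i) (b : HA j) x n :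
  rho a (rho b x) n = koszul (i * j) *: rho b (rho a x) n.
Proof.
have -> : rho a (rho b x) n =
    rho (koszul (i * j) *: gcast (G := HA) (addrC j i) (HHcup b a)) x n.
  by rewrite -HHcup_comm rho_cup.
by rewrite rhoZl rho_cast rho_cup.
Qed.

Lemma beta_beta x : beta (beta x) = fun _ => 0.
Proof.
apply: functional_extensionality_dep => n.
have [k e1] : exists k, k + 1 + 1 = n by exists (n - 2); ring.
rewrite (beta_at _ e1) (beta_at _ (erefl (k + 1))) gcast_id HHconnes_HHconnes.
by case: n / e1.
Qed.

End Families.

Section BracketOperator.
Variables (F : fieldType) (A : dgAlgebra F).
Local Notation word := (@word F A).
Local Notation CA := (cochain (regular A)).
Local Notation HA := (HH (regular A)).
Local Notation HD := (HH (dual A)).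
Implicit Types (X : word -> F^o) (x : hh_family A).

Local Notation act_form f X := (on_chains (lie_pair mu f X)).
Local Notation B_form X := (on_chains (cyc_sum (unit_front X))).

Lemma gcast_cl p q (e : p = q) X : gcast (G := HD) e (cl p X) = cl q X.
Proof. by case: q / e. Qed.

Lemma rho_class i (f : CA i) x k X c n :
  hochD i f = 0 -> is_cyc k X -> x k = c *: cl k X -> i + k = n ->
  rho (HHclass i f) x n = (koszul (i * k + i + 1) * c) *: cl n (act_form f X).
Proof.
move=> fD cX xk e; rewrite (rho_at _ _ e) xk -(clZ c cX).
rewrite (HHact_cl fD (cycZ c cX)) gcast_cl -clZ; last first.
  by rewrite -e; exact: cyc_action.
by apply: cl_ext => a w; rewrite /= lie_pairZ scalerA.
Qed.

Lemma beta_class x k X c n : is_cyc k X -> x k = c *: cl k X -> k + 1 = n ->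
  beta x n = (koszul (k + 1) * c) *: cl n (B_form X).
Proof.
move=> cX xk e; rewrite (beta_at _ e) xk -(clZ c cX).
rewrite (HHconnes_cl (cycZ c cX)) gcast_cl -clZ; last first.
  by rewrite -e; exact: cyc_cyc_sum.
by apply: cl_ext => a w; rewrite /= /unit_front cyc_sumZ scalerA.
Qed.

(** On cohomology the bracket acts as the double commutator of B with the actions
  of a and b. *)
Lemma rho_bracket i j (a : HA i) (b : HA j) x n :
  rho (HHbracket a b) x n =
  koszul i *: beta (rho a (rho b x)) n - rho a (beta (rho b x)) n
  - koszul ((i + 1) * j) *: (koszul i *: rho b (beta (rho a x)) n
      - rho b (rho a (beta x)) n).
Proof.
pose f := cocycle_cochain (HHrepr a); pose g := cocycle_cochain (HHrepr b).
have fD : hochD i f = 0 := cocycle_repr a.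
have gD : hochD j g = 0 := cocycle_repr b.
have -> : HHbracket a b = HHclass (N := regular A) (i + j + 1) (bracketC f g) by [].
have -> : rho a = rho (HHclass i f) by rewrite HHclass_repr.
have -> : rho b = rho (HHclass j g) by rewrite HHclass_repr.
have [k en] : exists k, i + j + 1 + k = n by exists (n - (i + j + 1)); ring.
have [X cX xk0] := cl_surj (x k).
have xk : x k = 1 *: cl k X by rewrite scale1r.
have cg := cyc_action gD cX; have cf := cyc_action fD cX.
have rb := rho_class gD cX xk (erefl (j + k)).
have ra := rho_class fD cX xk (erefl (i + k)).
have bx := beta_class cX xk (erefl (k + 1)).
have e1 : i + (j + k) + 1 = n by rewrite -en; ring.
have e2 : i + (j + k + 1) = n by rewrite -en; ring.
have e3 : j + (i + k + 1) = n by rewrite -en; ring.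
have e4 : j + (i + (k + 1)) = n by rewrite -en; ring.
rewrite (rho_class (bracket_cocycle fD gD) cX xk en).
rewrite (beta_class (cyc_action fD cg) (rho_class fD cg rb (erefl _)) e1).
rewrite (rho_class fD (cyc_cyc_sum cg) (beta_class cg rb (erefl _)) e2).
rewrite (rho_class gD (cyc_cyc_sum cf) (beta_class cf ra (erefl _)) e3).
rewrite (rho_class gD (cyc_action fD (cyc_cyc_sum cX))
  (rho_class fD (cyc_cyc_sum cX) bx (erefl _)) e4).
rewrite (cl_bracket fD gD cX (esym en)).
move: (cl n _) (cl n _) (cl n _) (cl n _) => v1 v2 v3 v4.
rewrite !koszul_oddz; oddz_norm.
by case: (oddz i); case: (oddz j); case: (oddz k); rewrite /= ?expr0 ?expr1; module.
Qed.

End BracketOperator.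

(** * Batalin-Vilkovisky structures from commutators *)

Section OperatorCalculus.
Variables (F : fieldType) (G M : int -> lmodType F).
Local Notation fam := (forall k, M k).
Implicit Types (x y : fam).

Variables (one : G 0) (mul : forall i j, G i -> G j -> G (i + j)).
Variable br : forall i j, G i -> G j -> G (i + j + 1).
Variables (rho : forall i, G i -> fam -> fam) (beta : fam -> fam).
Arguments mul {i j}.
Arguments br {i j}.
Arguments rho {i}.

Hypothesis rho_comb : forall i (a : G i) c x y n,
  rho a (fun k => c *: x k + y k) n = c *: rho a x n + rho a y n.
Hypothesis rho_combl : forall i (a b : G i) c x n,
  rho (c *: a + b) x n = c *: rho a x n + rho b x n.
Hypothesis beta_comb : forall c x y n,
  beta (fun k => c *: x k + y k) n = c *: beta x n + beta y n.
Hypothesis rho_mul : forall i j (a : G i) (b : G j) x,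
  rho (mul a b) x = rho a (rho b x).
Hypothesis rho_one : forall x, rho one x = x.
Hypothesis rho_comm : forall i j (a : G i) (b : G j) x n,
  rho a (rho b x) n = koszul (i * j) *: rho b (rho a x) n.
Hypothesis beta_beta : forall x, beta (beta x) = fun _ => 0.
Hypothesis rho_br : forall i j (a : G i) (b : G j) x n,
  rho (br a b) x n =
  koszul i *: beta (rho a (rho b x)) n - rho a (beta (rho b x)) n
  - koszul ((i + 1) * j) *: (koszul i *: rho b (beta (rho a x)) n
      - rho b (rho a (beta x)) n).

Definition fam_linear (T : fam -> fam) : Prop :=
  forall c x y n, T (fun k => c *: x k + y k) n = c *: T x n + T y n.

Lemma fam_linear0 T : fam_linear T -> T (fun _ => 0) = fun _ => 0.
Proof.
move=> lin; apply: functional_extensionality_dep => n.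
have := lin (- 1) (fun _ => 0) (fun _ => 0) n.
rewrite (_ : (fun k => -1 *: 0 + 0) = (fun _ => 0 : M _)).
  by rewrite scaleN1r addNr.
by apply: functional_extensionality_dep => k; rewrite scaler0 addr0.
Qed.

Lemma fam_linearZ T c x : fam_linear T ->
  T (fun n => c *: x n) = fun n => c *: T x n.
Proof.
move=> lin; apply: functional_extensionality_dep => n.
have := lin c x (fun _ => 0) n; rewrite (fam_linear0 lin) addr0 => <-.
by congr (T _ n); apply: functional_extensionality_dep => k; rewrite addr0.
Qed.

(** The shape of the right hand side of rho_br. *)
Lemma fam_linear4 T p q r x1 x2 x3 x4 : fam_linear T ->
  T (fun n => p *: x1 n - x2 n - q *: (r *: x3 n - x4 n)) =
  fun n => p *: T x1 n - T x2 n - q *: (r *: T x3 n - T x4 n).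
Proof.
move=> lin; apply: functional_extensionality_dep => n.
transitivity (T (fun k => p *: x1 k + (- 1 *: x2 k + (- (q * r) *: x3 k +
    ((q - 1) *: x4 k + x4 k)))) n).
  congr (T _ n); apply: functional_extensionality_dep => k; module.
by rewrite !lin; module.
Qed.

Lemma rho_linear i (a : G i) : fam_linear (rho a).
Proof. by move=> c x y n; exact: rho_comb. Qed.

Let rho4 i (a : G i) p q r x1 x2 x3 x4 :=
  fam_linear4 p q r x1 x2 x3 x4 (rho_linear a).
Let beta4 p q r x1 x2 x3 x4 := fam_linear4 p q r x1 x2 x3 x4 beta_comb.
Let rho_0 i (a : G i) := fam_linear0 (rho_linear a).
Let beta_0 := fam_linear0 beta_comb.
Let beta_Z c x := fam_linearZ c x beta_comb.

Lemma rho_brE i j (a : G i) (b : G j) x : rho (br a b) x = fun n =>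
  koszul i *: beta (rho a (rho b x)) n - rho a (beta (rho b x)) n
  - koszul ((i + 1) * j) *: (koszul i *: rho b (beta (rho a x)) n
      - rho b (rho a (beta x)) n).
Proof. by apply: functional_extensionality_dep => n; exact: rho_br. Qed.

Let rho_linearl i x n : linear (fun a : G i => rho a x n).
Proof. by move=> c a b; exact: rho_combl. Qed.

Lemma rho_zerol i x n : rho (0 : G i) x n = 0.
Proof. exact: (linmap0 (@rho_linearl i x n)). Qed.

Lemma rho_scalel i (a : G i) c x n : rho (c *: a) x n = c *: rho a x n.
Proof. exact: (linmapZ (@rho_linearl i x n)). Qed.

Lemma rho_oppl i (a : G i) x n : rho (- a) x n = - rho a x n.
Proof. by rewrite -scaleN1r rho_scalel scaleN1r. Qed.

Lemma rho_addl i (a b : G i) x n : rho (a + b) x n = rho a x n + rho b x n.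
Proof. exact: (linmapD (@rho_linearl i x n)). Qed.

Lemma rho_gcast i j (e : i = j) (a : G i) x : rho (gcast e a) x = rho a x.
Proof. by case: j / e. Qed.

Let rho_l := (rho_addl, rho_oppl, rho_scalel, rho_gcast, rho_zerol).

Ltac fam_atoms := repeat match goal with
  | |- context [beta ?y ?n] => move: (beta y n) => ?
  | |- context [rho ?a ?y ?n] => move: (rho a y n) => ?
  end.

Ltac signs := rewrite !koszul_oddz; oddz_norm;
  repeat match goal with |- context [oddz ?e] => case: (oddz e) end;
  rewrite /= ?expr0 ?expr1; module.

(** The bracket acts as a double commutator of an operator of square zero, and
  double commutators of this kind satisfy the Jacobi identity. *)
Lemma rho_jacobi i j k (a : G i) (b : G j) (c : G k) x n :
  rho (br a (br b c)) x n = rho (br (br a b) c) x n +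
  koszul ((i + 1) * (j + 1)) *: rho (br b (br a c)) x n.
Proof.
rewrite !rho_brE !(rho4, beta4, beta_beta, rho_0, beta_0).
fam_atoms; signs.
Qed.

(** Both sides are expanded into compositions of the same operators; the Poisson
  rule is the derivation property of a commutator with the operator of a. *)
Lemma rho_poisson i j k (a : G i) (b : G j) (c : G k) x n :
  rho (br a (mul b c)) x n = rho (mul (br a b) c) x n +
  koszul ((i + 1) * j) *: rho (mul b (br a c)) x n.
Proof.
rewrite !rho_mul !rho_brE !rho_mul !rho4.
fam_atoms; signs.
Qed.

Lemma rho_commE i j (a : G i) (b : G j) x :
  rho a (rho b x) = fun n => koszul (i * j) *: rho b (rho a x) n.
Proof. by apply: functional_extensionality_dep => n; exact: rho_comm. Qed.

Lemma rho_br_anti i j (a : G i) (b : G j) x n :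
  rho (br a b) x n = - (koszul ((i + 1) * (j + 1)) *: rho (br b a) x n).
Proof.
rewrite !rho_brE (rho_commE b a x) (rho_comm b a (beta x)) beta_Z.
fam_atoms; signs.
Qed.

Lemma rho_comblE i (a b : G i) c x :
  rho (c *: a + b) x = fun n => c *: rho a x n + rho b x n.
Proof. by apply: functional_extensionality_dep => n; exact: rho_combl. Qed.

Lemma fam_linear2 T c x y : fam_linear T ->
  T (fun k => c *: x k + y k) = fun n => c *: T x n + T y n.
Proof. by move=> lin; apply: functional_extensionality_dep => n; exact: lin. Qed.

Let rho2 i (a : G i) c x y := fam_linear2 c x y (rho_linear a).
Let beta2 c x y := fam_linear2 c x y beta_comb.

Section Faithful.
Variable pt : fam.
Hypothesis faithful : forall i (a b : G i),
  (forall n, rho a pt n = rho b pt n) -> a = b.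

(** An identity between elements of G holds as soon as both sides act in the same
  way on the family pt, so every axiom reduces to an identity of operators. *)
Lemma operator_gerstenhaber : is_gerstenhaber one (@mul) (@br).
Proof.
split.
- move=> i j b c a a'; apply: faithful => n.
  by rewrite rho_combl !rho_mul rho_combl.
- move=> i j a c b b'; apply: faithful => n.
  by rewrite rho_combl !rho_mul rho_comblE rho_comb.
- by move=> i j k a b c; apply: faithful => n; rewrite rho_gcast !rho_mul.
- by move=> i a; apply: faithful => n; rewrite rho_gcast rho_mul rho_one.
- by move=> i a; apply: faithful => n; rewrite rho_gcast rho_mul rho_one.
- move=> i j a b; apply: faithful => n.
  by rewrite rho_scalel rho_gcast !rho_mul rho_comm.
- move=> i j b c a a'; apply: faithful => n.
  rewrite rho_combl !rho_brE !rho_comblE ?(rho2, beta2); fam_atoms; module.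
- move=> i j a c b b'; apply: faithful => n.
  rewrite rho_combl !rho_brE !rho_comblE ?(rho2, beta2); fam_atoms; module.
- move=> i j a b; apply: faithful => n.
  by rewrite rho_oppl rho_scalel rho_gcast rho_br_anti.
- move=> i j k a b c; apply: faithful => n.
  by rewrite rho_addl rho_scalel !rho_gcast rho_jacobi.
- move=> i j k a b c; apply: faithful => n.
  by rewrite rho_addl rho_scalel !rho_gcast rho_poisson.
Qed.

Hypothesis beta_pt : beta pt = fun _ => 0.
Variable Delta : forall i, G i -> G (i + 1).
Hypothesis rho_Delta : forall i (a : G i) n, rho (Delta a) pt n = beta (rho a pt) n.

Let rho_DeltaE i (a : G i) : rho (Delta a) pt = beta (rho a pt).
Proof. by apply: functional_extensionality_dep => n; exact: rho_Delta. Qed.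

(** As beta kills pt, one of the four terms of the double commutator vanishes on
  pt; the other three are the terms of the Batalin-Vilkovisky formula. *)
Lemma operator_batalin_vilkovisky :
  is_batalin_vilkovisky one (@mul) (@br) Delta.
Proof.
split; first exact: operator_gerstenhaber.
- move=> i c a b; apply: faithful => n.
  by rewrite rho_combl !rho_Delta rho_comblE beta_comb.
- move=> i a; apply: faithful => n.
  by rewrite rho_Delta rho_DeltaE beta_beta rho_zerol.
- move=> i j a b; apply: faithful => n.
  rewrite !rho_l !rho_mul rho_Delta rho_mul rho_brE beta_pt !rho_0.
  rewrite (rho_comm (Delta a)) !rho_DeltaE.
  fam_atoms; signs.
Qed.

End Faithful.
End OperatorCalculus.

(** * The class m *)

Section Fundamental.
Variables (F : fieldType) (A : dgAlgebra F) (d : int) (m : HH (dual A) d).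
Local Notation HA := (HH (regular A)).
Local Notation HD := (HH (dual A)).

(** As a family, m is in the domain of the operators rho and beta. *)
Definition point : hh_family A := fun k =>
  match d =P k with
  | ReflectT e => gcast (G := HD) e m
  | ReflectF _ => 0
  end.

Lemma point_at : point d = m.
Proof. by rewrite /point; case: eqP => [e|//]; exact: gcast_id. Qed.

Lemma point_off k : d <> k -> point k = 0.
Proof. by rewrite /point; case: eqP. Qed.

Lemma rho_point i (a : HA i) : rho a point (i + d) = HHact a m.
Proof. by rewrite (rho_at a point (erefl (i + d))) point_at. Qed.

Lemma rho_null i (a : HA i) (x : hh_family A) n : x (n - i) = 0 -> rho a x n = 0.
Proof.
move=> e; rewrite /rho e.
exact: (etrans (congr1 (gcast (G := HD) (rho_deg i n))
  (linmap0 (HHact_linearr a))) (gcast_zero _ _)).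
Qed.

Lemma beta_null (x : hh_family A) n k :
  k + 1 = n -> HHconnes (x k) = 0 -> beta x n = 0.
Proof.
move=> e x0.
exact: (etrans (beta_at x e)
  (etrans (congr1 (gcast (G := HD) e) x0) (gcast_zero _ _))).
Qed.

Lemma HHconnes_null j (y : HD j) : y = 0 -> HHconnes y = 0.
Proof.
exact: (fun e => etrans (congr1 _ e) (linmap0 (@HHconnes_linear F A j))).
Qed.

Lemma rho_point_off i (a : HA i) n : i + d <> n -> rho a point n = 0.
Proof.
by move=> ne; apply/rho_null/point_off => e; apply: ne; rewrite e; ring.
Qed.

Lemma beta_point : HHconnes m = 0 -> beta point = fun _ => 0.
Proof.
move=> m0; apply: functional_extensionality_dep => n.
apply: (beta_null (beta_deg n)).
have [<-|/eqP ne] := eqVneq d (n - 1); last exact/HHconnes_null/point_off.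
exact: (etrans (congr1 _ point_at) m0).
Qed.

Lemma beta_rho_point i (a : HA i) : beta (rho a point) (i + 1 + d) =
  gcast (G := HD) (addrAC i d 1) (HHconnes (HHact a m)).
Proof. by rewrite (beta_at _ (addrAC i d 1)) rho_point. Qed.

Lemma beta_rho_point_off i (a : HA i) n : i + 1 + d <> n ->
  beta (rho a point) n = 0.
Proof.
move=> ne; apply: (beta_null (beta_deg n)); apply/HHconnes_null/rho_point_off.
by move=> e; apply: ne; rewrite addrAC e; ring.
Qed.

End Fundamental.

Theorem proposition11 (F : fieldType) (A : dgAlgebra F) (d : int)
    (m : HH (dual A) d) :
  (forall n : int, bijective (fun a : HH (regular A) n => HHact a m)) ->
  HHconnes m = 0 ->
  exists Delta : forall n : int, HH (regular A) n -> HH (regular A) (n + 1),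
    (forall (n : int) (a : HH (regular A) n),
       HHact (Delta n a) m =
       gcast (G := HH (dual A)) (addrAC n d 1) (HHconnes (HHact a m))) /\
    is_batalin_vilkovisky (G := HH (regular A))
      (HHunit A) (@HHcup F A) (@HHbracket F A) Delta.
Proof.
move=> bij m0.
have surj n (y : HH (dual A) (n + d)) :
    exists a : HH (regular A) n, HHact a m = y.
  by case: (bij n) => inv _ invK; exists (inv y); exact: invK.
pose D n (a : HH (regular A) n) := cid (surj (n + 1)
  (gcast (G := HH (dual A)) (addrAC n d 1) (HHconnes (HHact a m)))).
exists (fun n a => projT1 (D n a)); split=> [n a|]; first exact: projT2 (D n a).
apply: (operator_batalin_vilkovisky (@rho_comb F A) (@rho_combl F A)
  (@beta_comb F A) (@rho_cup F A) (@rho_unit F A) (@rho_comm F A)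
  (@beta_beta F A) (@rho_bracket F A) (pt := point m)).
- move=> i a b ab; apply: (bij_inj (bij i)).
  by have := ab (i + d); rewrite !rho_point.
- exact: beta_point.
- move=> i a n; have [<-|/eqP ne] := eqVneq (i + 1 + d) n.
    rewrite rho_point beta_rho_point; exact: projT2 (D i a).
  exact: (etrans (rho_point_off m _ ne) (esym (beta_rho_point_off m a ne))).
Qed.
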